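(* Consider the distributed algorithm $$\boldsymbol\theta_n=(W_n\otimes I_d)\,P_{G^N}\left[\boldsymbol\theta_{n-1}+\gamma_n\boldsymbol Y_n\right],\qquad n\ge 1,$$ and suppose that Assumptions 1, 2 and 3 (written out in the context) hold. Let $f:=\frac1N\sum_{i=1}^N f_i$ and let $$\mathcal L:=\{\theta\in G:\ -\nabla f(\theta)\in\mathcal N_G(\theta)\}$$ be the set of KKT points of $f$ on $G$. Assume that $f(\mathcal L)\subset\mathbb R$ has an empty interior. Then, almost surely, the sequence $(\boldsymbol\theta_n)_{n\ge1}$ converges to the set $\{\mathbf 1\otimes\theta:\theta\in\mathcal L\}$. Moreover, almost surely, the sequence of averages $(\langle\boldsymbol\theta_n\rangle)_{n\ge1}$ converges to a connected component of $\mathcal L$.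
   Context: **Notation.** $N\ge1$, $d\ge1$ are integers; $|\cdot|$ is the Euclidean norm; $\mathbf 1\in\mathbb R^N$ is the all-ones vector; $I_k$ is the $k\times k$ identity; $\otimes$ is the Kronecker product. $P_C$ is the Euclidean projection onto a closed convex set $C$, and $G^N=G\times\cdots\times G\subset\mathbb R^{dN}$. For $\boldsymbol x=(x_1^T,\dots,x_N^T)^T\in\mathbb R^{dN}$ with $x_i\in\mathbb R^d$, $\langle\boldsymbol x\rangle:=(x_1+\cdots+x_N)/N$. The normal cone is $\mathcal N_G(\theta):=\{v\in\mathbb R^d:\forall\theta'\in G,\ v^T(\theta-\theta')\ge0\}$. A sequence $(x_n)$ converges to a set $A$ if $\mathsf d(x_n,A):=\inf\{|x_n-a|:a\in A\}\to0$ (this does not mean convergence to a point of $A$). **Algorithm.** $f_1,\dots,f_N:\mathbb R^d\to\mathbb R$ are functions, $(\gamma_n)_{n\ge1}$ is a deterministic sequence, $\boldsymbol\theta_0$ is a random vector in $\mathbb R^{dN}$, $(\boldsymbol Y_n)_{n\ge1}$ are random vectors in $\mathbb R^{dN}$ and $(W_n)_{n\ge1}$ are random $N\times N$ matrices, all on one probability space $(\Omega,\mathbb P)$ with expectation $\mathbb E$. Write $\boldsymbol\theta_n=(\theta_{n,1}^T,\dots,\theta_{n,N}^T)^T$ and $\mathcal F_n:=\sigma(\boldsymbol\theta_0,\boldsymbol Y_1,\dots,\boldsymbol Y_n,W_1,\dots,W_n)$, $n\ge1$. $(\mu_{\boldsymbol\theta})_{\boldsymbol\theta\in\mathbb R^{dN}}$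 is a given family of probability measures on $\mathbb R^{dN}$. **Assumption 1.** (a) Each $W_n$ has non-negative entries, $W_n\mathbf 1=\mathbf 1$, and $\mathbf 1^T\mathbb E(W_n)=\mathbf 1^T$. (b) The spectral norm $\rho_n$ of $\mathbb E\left(W_n^T(I_N-\mathbf 1\mathbf 1^T/N)W_n\right)$ satisfies $\lim_{n\to\infty}n(1-\rho_n)=+\infty$. (c) For every $n\ge 1$: conditionally on $\mathcal F_n$, $W_{n+1}$ and $\boldsymbol Y_{n+1}$ are independent; $W_{n+1}$ is independent of $\mathcal F_n$ (so $(W_n)$ is an independent, not necessarily identically distributed, sequence); and $\mathbb P(\boldsymbol Y_{n+1}\in A\mid\mathcal F_n)=\mu_{\boldsymbol\theta_n}(A)$ for every measurable $A$. (d) Each $f_i$ is continuously differentiable. (e) For every $n\ge1$, $\mathbb E[\boldsymbol Y_{n+1}\mid\mathcal F_n]=-(\nabla f_1(\theta_{n,1})^T,\dots,\nabla f_N(\theta_{n,N})^T)^T$. (f) $\sup_{\boldsymbol\theta\in G^N}\int|\boldsymbol y|^2\,d\mu_{\boldsymbol\theta}(\boldsymbol y)<\infty$. **Assumption 2.** (a) $\gamma_n>0$ for all $n$ and $\sum_n\gamma_n=\infty$. (b) There is $\alpha>1/2$ with $\lim_{n\to\infty}n^\alpha\gamma_n=0$ and $\liminf_{n\to\infty}\frac{1-\rho_n}{n^\alpha\gamma_n}>0$. **Assumption 3.** $G=\{\theta\in\mathbb R^d:\ q_j(\theta)\le0,\ j=1,\dots,p\}$ with $1\le p<\infty$, where (a)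 $G$ is nonempty and compact; (b) each $q_j:\mathbb R^d\to\mathbb R$ is convex, and continuously differentiable in a neighborhood of the boundary $\partial G$; (c) for every $\theta\in\partial G$, the vectors $(\nabla q_j(\theta):j\in A(\theta))$ are linearly independent, where $A(\theta)=\{j:q_j(\theta)=0\}$ is the active set at $\theta\in G$. *)

(* Defs.v *)
From HB Require Import structures.
From mathcomp Require Import all_boot all_order all_algebra.
From mathcomp Require Import all_classical all_reals all_analysis.
From mathcomp Require Import mxtens. (* A *t B is the Kronecker product *)
Set Implicit Arguments.
Unset Strict Implicit.
Unset Printing Implicit Defensive.
Import Order.TTheory GRing.Theory Num.Theory.
Import numFieldNormedType.Exports.

Local Open Scope classical_set_scope.
Local Open Scope ring_scope.

(* Matrices, hence vectors, carry their Borel sigma-algebra. *)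
HB.instance Definition _ (R : realType) (m n : nat) :=
  Measurable.copy 'M[R]_(m, n) (g_sigma_algebraType (@open 'M[R]_(m, n))).

Section euclidean.
Context {R : realType}.

Definition dotv n (u v : 'cV[R]_n) : R := (u^T *m v) ord0 ord0.

(* The norm [`|x|] that the library puts on matrices is the sup norm. *)
Definition enorm n (x : 'cV[R]_n) : R := Num.sqrt (dotv x x).

(* Extended-real valued, so that nothing is at finite distance from [set0]. *)
Definition edistv n (x : 'cV[R]_n) (A : set 'cV[R]_n) : \bar R :=
  ereal_inf [set (enorm (x - a))%:E | a in A].

(* Convergence of a sequence to a set, not to one of its points. *)
Definition cvg_to_set n (u : nat -> 'cV[R]_n) (A : set 'cV[R]_n) : Prop :=
  edistv (u k) A @[k --> \oo] --> 0%E.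

(* Meaningful when [C] is nonempty, closed and convex. *)
Definition eproj n (C : set 'cV[R]_n) (x : 'cV[R]_n) : 'cV[R]_n :=
  xget 0 [set y | C y /\ forall z, C z -> enorm (x - y) <= enorm (x - z)].

Definition spectral_norm m n (A : 'M[R]_(m, n)) : R :=
  sup [set enorm (A *m x) | x in [set x | enorm x <= 1]].

Definition normal_cone n (G : set 'cV[R]_n) (x : 'cV[R]_n) : set 'cV[R]_n :=
  [set v | forall y, G y -> 0 <= dotv v (x - y)].

Definition grad n (f : 'cV[R]_n -> R) (x : 'cV[R]_n) : 'cV[R]_n :=
  \col_k 'D_(delta_mx k ord0) f x.

(* [U] is meant to be open. *)
Definition C1_on n (U : set 'cV[R]_n) (f : 'cV[R]_n -> R) : Prop :=
  forall x, U x -> differentiable f x /\ {for x, continuous (grad f)}.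

Definition KKT n (f : 'cV[R]_n -> R) (G : set 'cV[R]_n) : set 'cV[R]_n :=
  [set x | G x /\ normal_cone G x (- grad f x)].

Definition boundary (T : topologicalType) (A : set T) : set T :=
  closure A `\` A°.

End euclidean.

(* A vector of R^(dN) is the column of its N consecutive blocks of size d, in
   the index order that [*t] uses. *)
Section blocks.
Context {R : realType} {N d : nat}.

Definition block (x : 'cV[R]_(N * d)) (i : 'I_N) : 'cV[R]_d :=
  \col_k x (mxtens_index (i, k)) ord0.

Definition stack (x : 'I_N -> 'cV[R]_d) : 'cV[R]_(N * d) :=
  \col_j x (mxtens_unindex j).1 (mxtens_unindex j).2 ord0.

Definition block_mean (x : 'cV[R]_(N * d)) : 'cV[R]_d :=
  N%:R^-1 *: \sum_i block x i.

Definition set_power (G : set 'cV[R]_d) : set 'cV[R]_(N * d) :=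
  [set x | forall i, G (block x i)].

(* 1 (x) x ; the type of [*t] is 'M_(N * d, 1 * 1), which is convertible. *)
Definition consensus (x : 'cV[R]_d) : 'cV[R]_(N * d) :=
  (const_mx 1 : 'cV[R]_N) *t x.

End blocks.

Section conditioning.
Context {R : realType} {disp : measure_display} {T : measurableType disp}
  (P : probability T R).
Implicit Types (F : set (set T)) (X Z : T -> R).

(* E[X | F] = Z almost surely, for a sub-sigma-algebra F: some version Z0 of
   the conditional expectation of the integrable variable X coincides with Z
   outside a negligible set; Z itself need not be F-measurable. *)
Definition cond_exp_eq F X Z : Prop :=
  P.-integrable setT (EFin \o X) /\
  exists Z0 : T -> R,
    [/\ g_sigma_algebra_preimage Z0 `<=` F,
        P.-integrable setT (EFin \o Z0),
        forall A, F A ->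
          (\int[P]_(w in A) (X w)%:E = \int[P]_(w in A) (Z0 w)%:E)%E
      & {ae P, forall w, Z0 w = Z w}].

Definition cond_prob_eq F (A : set T) Z : Prop := cond_exp_eq F (\1_A) Z.

Definition cond_indep F d1 d2 (T1 : measurableType d1) (T2 : measurableType d2)
    (X1 : T -> T1) (X2 : T -> T2) : Prop :=
  forall (A : set T1) (B : set T2), measurable A -> measurable B ->
    exists ZA ZB : T -> R,
      [/\ cond_prob_eq F (X1 @^-1` A) ZA,
          cond_prob_eq F (X2 @^-1` B) ZB
        & cond_prob_eq F (X1 @^-1` A `&` X2 @^-1` B) (fun w => ZA w * ZB w)].

Definition indep_of F d1 (T1 : measurableType d1) (X : T -> T1) : Prop :=
  forall (A : set T1) (B : set T), measurable A -> F B ->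
    P (X @^-1` A `&` B) = (P (X @^-1` A) * P B)%E.

Definition expectation_mx m n (X : T -> 'M[R]_(m, n)) : 'M[R]_(m, n) :=
  \matrix_(i, j) fine 'E_P[fun w => X w i j].

End conditioning.

(* sigma(theta0, Y_1, ..., Y_n, W_1, ..., W_n) *)
Definition history {disp d0 d1 d2 : measure_display} {T : measurableType disp}
    {T0 : measurableType d0} {T1 : measurableType d1} {T2 : measurableType d2}
    (theta0 : T -> T0) (Y : nat -> T -> T1) (W : nat -> T -> T2) (n : nat) :
    set (set T) :=
  <<s g_sigma_algebra_preimage theta0 `|`
      \bigcup_(k in [set k | (0 < k <= n)%N])
        (g_sigma_algebra_preimage (Y k) `|` g_sigma_algebra_preimage (W k)) >>.

(* Main.v *)
(* Almost surely the squared disagreements between the agents are summable (the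
   gossip contracts them by [rho n], the observations feed them by
   [gamma n ^ 2]), and the series of martingale increments due to the
   observations and to the column sums of [W n] converge. Hence the mean
   of the agents obeys [x k.+1 = x k + gam k *: (g k - v k) + e k], where [g k]
   is asymptotic to the negative gradient of [f] at [x k], [v k] is almost
   normal to [G] and the series of [e] converges.

   On windows of bounded [gam]-length, [x] stays close to the exact projected
   gradient scheme started from the same point, along which [f] decreases, by a
   fixed amount if the window starts close to a point that is not KKT. Since the
   values of [f] on KKT points have empty interior, a cluster point [z] that is
   not KKT would yield a level [c < f z] that is not critical and that [f x]
   crosses downwards and then upwards infinitely often, which is impossible. So
   the cluster points of [x] are KKT points; their set is connected because the
   steps of [x] vanish. *)

(* The noise is known only through the convergence of its series; its terms are not compared with
   [gam]. It is therefore carried by the tails [r] of that series, and the comparison with the exact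
   scheme is made for [x + r], in which the noise cancels. Both schemes are driven by the same [g],
   and normal vectors are monotone, so the squared distance between the schemes only accumulates
   errors.

   The observations have bounded conditional second moments but no uniform bound, so [v] may be
   large at single steps. What replaces boundedness is an estimate on windows: the [gam]-weighted
   sum of the sizes is at most a constant times the [gam]-length, plus a random constant.

   Gossip acts after the projection, hence after the new observation. Averaging over [W n.+1] thus
   requires independence from the past and [Y n.+1] jointly, which is derived from conditional
   independence and independence from the past.

   The condition [alpha > 1/2] makes both the mean squared disagreements and [gamma n ^+ 2] of order
   [n ^ - (2 * beta)] with [2 * beta > 1], hence summable. *)
Require Import Defs.
From mathcomp Require Import all_boot all_order all_algebra.
From mathcomp Require Import all_classical all_reals all_analysis.
From mathcomp Require Import finmap measurable_realfun mxtens ring lra.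
Set Implicit Arguments.
Unset Strict Implicit.
Unset Printing Implicit Defensive.
Import Order.TTheory GRing.Theory Num.Theory.
Import numFieldNormedType.Exports.
Local Open Scope classical_set_scope.
Local Open Scope ring_scope.

(** * Euclidean geometry and projections *)

Section euclidean_geometry.
Context {R : realType} {n : nat}.
Implicit Types (u v w x y z : 'cV[R]_n) (c : R).

Lemma dotvE u v : dotv u v = \sum_i u i ord0 * v i ord0.
Proof. by rewrite /dotv mxE; apply: eq_bigr => i _; rewrite mxE. Qed.

Lemma dotvC u v : dotv u v = dotv v u.
Proof. by rewrite !dotvE; apply: eq_bigr => i _; rewrite mulrC. Qed.

Lemma dotvDr u v w : dotv u (v + w) = dotv u v + dotv u w.
Proof. by rewrite /dotv mulmxDr mxE. Qed.

Lemma dotvDl u v w : dotv (v + w) u = dotv v u + dotv w u.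
Proof. by rewrite dotvC dotvDr !(dotvC u). Qed.

Lemma dotvZr c u v : dotv u (c *: v) = c * dotv u v.
Proof. by rewrite /dotv -scalemxAr mxE. Qed.

Lemma dotvZl c u v : dotv (c *: u) v = c * dotv u v.
Proof. by rewrite dotvC dotvZr dotvC. Qed.

Lemma dotvNr u v : dotv u (- v) = - dotv u v.
Proof. by rewrite -scaleN1r dotvZr mulN1r. Qed.

Lemma dotvNl u v : dotv (- u) v = - dotv u v.
Proof. by rewrite -scaleN1r dotvZl mulN1r. Qed.

Lemma dotv0r u : dotv u 0 = 0.
Proof. by rewrite /dotv mulmx0 mxE. Qed.

Definition dotv_lin := (dotvDl, dotvDr, dotvNl, dotvNr, dotvZl, dotvZr).

Lemma dotvv_ge0 u : 0 <= dotv u u.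
Proof. by rewrite dotvE sumr_ge0// => i _; rewrite -expr2 sqr_ge0. Qed.

Lemma dotvv_eq0 u : (dotv u u == 0) = (u == 0).
Proof.
apply/eqP/eqP => [|->]; last by rewrite dotv0r.
rewrite dotvE => /eqP; rewrite psumr_eq0; last first.
  by move=> i _; rewrite -expr2 sqr_ge0.
move=> /allP h; apply/colP => i; rewrite mxE.
by have := h i (mem_index_enum i); rewrite /= -expr2 sqrf_eq0 => /eqP.
Qed.

Lemma enorm_ge0 u : 0 <= enorm u.
Proof. exact: sqrtr_ge0. Qed.

Lemma enorm_sqr u : enorm u ^+ 2 = dotv u u.
Proof. by rewrite sqr_sqrtr// dotvv_ge0. Qed.

Lemma enorm_eq0 u : (enorm u == 0) = (u == 0).
Proof. by rewrite -sqrf_eq0 enorm_sqr dotvv_eq0. Qed.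

Lemma enorm0 : enorm (0 : 'cV[R]_n) = 0.
Proof. by apply/eqP; rewrite enorm_eq0. Qed.

Lemma enormN u : enorm (- u) = enorm u.
Proof. by rewrite /enorm dotvNl dotvNr opprK. Qed.

Lemma enormB u v : enorm (u - v) = enorm (v - u).
Proof. by rewrite -enormN opprB. Qed.

Lemma enormZ c u : enorm (c *: u) = `|c| * enorm u.
Proof.
by rewrite /enorm dotvZl dotvZr mulrA -expr2 sqrtrM ?sqr_ge0// sqrtr_sqr.
Qed.

Lemma dotv_le_enorm u v : dotv u v <= enorm u * enorm v.
Proof.
have [->|v0] := eqVneq v 0; first by rewrite dotv0r enorm0 mulr0.
have b0 : 0 < dotv v v by rewrite lt_def dotvv_ge0 dotvv_eq0 v0.
have : 0 <= dotv (dotv v v *: u - dotv u v *: v) (dotv v v *: u - dotv u v *: v).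
  exact: dotvv_ge0.
rewrite !dotv_lin (dotvC v u) => h.
have {h} : 0 <= dotv v v * (dotv u u * dotv v v - dotv u v ^+ 2) by nra.
rewrite pmulr_rge0// subr_ge0 => h.
apply: (le_trans (ler_norm _)).
by rewrite -ler_sqr ?nnegrE ?mulr_ge0 ?enorm_ge0// exprMn !enorm_sqr -normrX ger0_norm ?sqr_ge0.
Qed.

Lemma ler_enormD u v : enorm (u + v) <= enorm u + enorm v.
Proof.
rewrite -ler_sqr ?nnegrE ?addr_ge0 ?enorm_ge0//.
rewrite enorm_sqr !dotv_lin -!enorm_sqr (dotvC v u).
by have := dotv_le_enorm u v; nra.
Qed.

Lemma ler_enormB u v : enorm (u - v) <= enorm u + enorm v.
Proof. by rewrite (le_trans (ler_enormD _ _))// enormN. Qed.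

Lemma ler_enorm_triangle u v w : enorm (u - w) <= enorm (u - v) + enorm (v - w).
Proof. by rewrite (le_trans _ (ler_enormD _ _))// addrA subrK. Qed.

Lemma ler_coord_enorm u i : `|u i ord0| <= enorm u.
Proof.
rewrite -ler_sqr ?nnegrE ?enorm_ge0// enorm_sqr dotvE real_normK ?num_real//.
rewrite (bigD1 i)//= -expr2 lerDl sumr_ge0// => j _.
by rewrite -expr2 sqr_ge0.
Qed.

Lemma ler_norm_enorm u : `|u| <= enorm u.
Proof.
rewrite [leLHS]mx_normrE; apply/bigmax_leP; split; first exact: enorm_ge0.
by move=> [i j] _ /=; rewrite (ord1 j) ler_coord_enorm.
Qed.

Lemma ler_enorm_sum u : enorm u <= \sum_i `|u i ord0|.
Proof.
rewrite -ler_sqr ?nnegrE ?enorm_ge0 ?sumr_ge0// enorm_sqr dotvE.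
rewrite expr2 mulr_suml ler_sum// => i _.
rewrite (le_trans (ler_norm _))// normrM ler_wpM2l//.
by rewrite (bigD1 i)//= lerDl sumr_ge0.
Qed.

Lemma ler_enorm_norm u : enorm u <= n%:R * `|u|.
Proof.
rewrite (le_trans (ler_enorm_sum u))//.
rewrite (_ : n%:R * `|u| = \sum_(i < n) `|u|); last first.
  by rewrite sumr_const card_ord mulr_natl.
rewrite ler_sum// => i _; rewrite [leRHS]mx_normrE.
by rewrite (le_bigmax _ (fun ij : 'I_n * 'I_1 => `|u ij.1 ij.2|) (i, ord0)).
Qed.

(** The topology of the library is that of the sup norm. Equivalence of the two norms turns
    topological statements into Euclidean estimates. *)
Lemma enorm_ball x (A : set 'cV[R]_n) :
  nbhs x A <-> exists2 e, 0 < e & forall y, enorm (x - y) < e -> A y.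
Proof.
rewrite -nbhs_nbhs_norm; split => [[e /= e0 h]|[e e0 h]].
  exists e => // y xy; apply: h => /=.
  exact: le_lt_trans (ler_norm_enorm _) xy.
(* [n.+1] instead of [n] keeps the radius positive when [n = 0]. *)
exists (e / n.+1%:R) => /=; first by rewrite divr_gt0.
move=> y /= xy; apply: h.
rewrite (le_lt_trans (ler_enorm_norm _))//.
rewrite ltr_pdivlMr// in xy; apply: le_lt_trans xy.
by rewrite mulrC ler_wpM2l// ler_nat.
Qed.

Lemma enorm_continuous : continuous (@enorm R n).
Proof.
move=> x; apply/(cvgrPdist_lt (FF := nbhs_filter x)) => e e0.
apply/enorm_ball; exists e => // y; apply: le_lt_trans.
rewrite ler_norml; apply/andP; split.
- by rewrite lerNl opprB lerBlDr enormB (le_trans _ (ler_enormD _ _))// subrK.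
- by rewrite lerBlDr (le_trans _ (ler_enormD _ _))// subrK.
Qed.

End euclidean_geometry.

Definition segment_closed {R : realType} n (C : set 'cV[R]_n) : Prop :=
  forall x y (t : R), C x -> C y -> 0 <= t <= 1 -> C (t *: x + (1 - t) *: y).

(** Existence of nearest points is all that [eproj] requires, and unlike a compactness argument it
    passes from [G] to [set_power G] block by block. *)
Definition proximinal {R : realType} n (C : set 'cV[R]_n) : Prop :=
  forall x, exists y, C y /\ forall z, C z -> enorm (x - y) <= enorm (x - z).

Section projection.
Context {R : realType} {n : nat}.
Implicit Types (C : set 'cV[R]_n) (x y z : 'cV[R]_n).

Lemma compact_proximinal C : C !=set0 -> compact C -> proximinal C.
Proof.
move=> C0 Cc x.
have cf : continuous (fun z => enorm (x - z)).
  move=> z; apply: continuous_comp; last exact: enorm_continuous.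
  by apply: continuousB; [exact: cst_continuous|exact: id].
have [y yC ymin] := compact_EVT_min C0 Cc (continuous_subspaceT cf).
exists y; split; first exact: set_mem.
by move=> z zC; apply: ymin; exact: mem_set.
Qed.

Lemma eprojP C x : proximinal C ->
  C (eproj C x) /\ forall z, C z -> enorm (x - eproj C x) <= enorm (x - z).
Proof.
move=> /(_ x) [y Cy]; rewrite /eproj.
by case: xgetP => [z _ []//|/(_ y)]; case: Cy => Cy h []; split.
Qed.

Lemma eproj_in C x : proximinal C -> C (eproj C x).
Proof. by move=> /(eprojP x)[]. Qed.

(** The obtuse angle property. If the product were positive, moving from the projection a little
    towards [z] would bring the point closer to [x]. *)
Lemma dotv_eproj_le0 C x z : segment_closed C -> proximinal C -> C z ->
  dotv (x - eproj C x) (z - eproj C x) <= 0.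
Proof.
move=> Ccvx /(eprojP x)[]; set p := eproj C x => Cp pmin Cz.
rewrite leNgt; apply/negP; set a := dotv _ _ => a0.
set b := dotv (z - p) (z - p).
have b0 : 0 <= b := dotvv_ge0 _.
have ab0 : 0 < a + b by rewrite ltr_wpDr.
(* This [t] always lies in [[0, 1]], contrary to the minimizer [a / b], and it still gains:
   [t * b = a - t * a] is less than [2 * a]. *)
set t := a / (a + b).
have t01 : 0 <= t <= 1.
  by rewrite divr_ge0 ?(ltW a0) ?(ltW ab0)//= ler_pdivrMr// mul1r lerDl.
have := pmin _ (Ccvx _ _ _ Cz Cp t01).
rewrite -ler_sqr ?nnegrE ?enorm_ge0// !enorm_sqr.
have -> : x - (t *: z + (1 - t) *: p) = (x - p) - t *: (z - p).
  by apply/colP => i; rewrite !mxE; ring.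
rewrite [X in _ <= X]dotvDl !(dotvDr _ (x - p)) !(dotvNl, dotvNr, dotvZl, dotvZr).
rewrite -/b -/a (dotvC (z - p)) -/a.
have tab : t * (a + b) = a by rewrite /t divfK// gt_eqF.
have t0 : 0 < t by rewrite divr_gt0.
have : 0 < t * a by rewrite mulr_gt0.
have tb : t * b = a - t * a by move: tab; rewrite mulrDr => ?; lra.
have tta : 0 < t * (t * a) by apply: mulr_gt0 => //; exact: mulr_gt0.
rewrite tb !(mulrN, mulrBr).
by move=> *; lra.
Qed.

Lemma eproj_nonexpansive C x y : segment_closed C -> proximinal C ->
  enorm (eproj C x - eproj C y) <= enorm (x - y).
Proof.
move=> cC pC.
have hx := dotv_eproj_le0 x cC pC (eproj_in y pC).
have hy := dotv_eproj_le0 y cC pC (eproj_in x pC).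
move: hx hy; set p := eproj C x; set q := eproj C y => hx hy.
have [->|pq] := eqVneq p q; first by rewrite subrr enorm0 enorm_ge0.
have pq0 : 0 < enorm (p - q) by rewrite lt_def enorm_eq0 subr_eq0 pq enorm_ge0.
rewrite -(ler_pM2l pq0) -expr2 enorm_sqr (le_trans _ (dotv_le_enorm _ _))//.
by move: hx hy; rewrite !dotv_lin (dotvC q p) !(dotvC p) !(dotvC q) => hx hy; lra.
Qed.

Lemma eproj_id C x : proximinal C -> C x -> eproj C x = x.
Proof.
move=> /(eprojP x)[_ /[apply]]; rewrite subrr enorm0 => h.
by apply/esym/eqP; rewrite -subr_eq0 -enorm_eq0 eq_le h enorm_ge0.
Qed.

Lemma eproj_continuous C : segment_closed C -> proximinal C ->
  continuous (eproj C).
Proof.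
move=> cC pC x A /enorm_ball[e e0 h]; apply/enorm_ball; exists e => // y xy.
by apply: h; exact: le_lt_trans (eproj_nonexpansive _ _ cC pC) xy.
Qed.

Lemma compact_seq_cluster C (u : nat -> 'cV[R]_n) : compact C ->
  (forall k, C (u k)) ->
  exists2 x, C x &
    forall e, 0 < e -> forall k0, exists2 k, (k0 <= k)%N & enorm (u k - x) < e.
Proof.
move=> Cc Cu.
have FC : (u @ \oo) C by exists 0%N => // k _; exact: Cu.
have [x [Cx xc]] := Cc (u @ \oo) _ FC.
exists x => // e e0 k0.
have [] := xc (u @` [set k | (k0 <= k)%N]) [set y | enorm (x - y) < e].
- by exists k0 => // k k0k; exists k.
- by apply/enorm_ball; exists e.
- by move=> _ [[k k0k <-]] /= h; exists k => //; rewrite enormB.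
Qed.

End projection.

(** * Gradients of continuously differentiable functions on compact convex sets *)

Section gradient.
Context {R : realType} {n : nat}.
Implicit Types (F : 'cV[R]_n -> R) (G : set 'cV[R]_n) (u v x y z : 'cV[R]_n).

Lemma enorm_cts m (h : 'cV[R]_n -> 'cV[R]_m) x : {for x, continuous h} ->
  forall e, 0 < e ->
  exists2 r, 0 < r & forall y, enorm (x - y) < r -> enorm (h x - h y) < e.
Proof.
move=> hx e e0; apply/(enorm_ball x [set y | enorm (h x - h y) < e]).
apply: (hx [set z | enorm (h x - z) < e]).
by apply/enorm_ball; exists e.
Qed.

Lemma real_cts F x : {for x, continuous F} ->
  forall e, 0 < e ->
  exists2 r, 0 < r & forall y, enorm (x - y) < r -> `|F x - F y| < e.
Proof.
move=> Fx e e0; apply/(enorm_ball x [set y | `|F x - F y| < e]).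
by apply: (Fx [set z | `|F x - z| < e]); rewrite -nbhs_nbhs_norm; exists e.
Qed.

Lemma derive_dotv F x v : differentiable F x -> 'D_v F x = dotv (grad F x) v.
Proof.
move=> dF; rewrite deriveE// dotvE.
have vE : v = \sum_k v k ord0 *: delta_mx k ord0.
  rewrite [LHS]matrix_sum_delta; apply: eq_bigr => k _.
  by rewrite big_ord1.
rewrite {1}vE linear_sum; apply: eq_bigr => k _.
by rewrite linearZ /grad mxE deriveE// mulrC.
Qed.

Lemma segment_MVT F x y : C1_on setT F ->
  exists2 t : R, 0 <= t <= 1 &
    F y - F x = dotv (grad F (t *: y + (1 - t) *: x)) (y - x).
Proof.
move=> F1; pose l (t : R) := x + t *: (y - x).
have lD (t : R) : is_derive t 1 (F \o l : R -> R) (dotv (grad F (l t)) (y - x)).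
  have [dF _] := F1 (l t) I.
  rewrite -derive_dotv//.
  have lE : (fun h : R => h^-1 *: ((F \o l) (h *: 1 + t) - (F \o l) t)) =
            (fun h : R => h^-1 *: (F (h *: (y - x) + l t) - F (l t))).
    apply/funext => h /=; congr (_ *: (F _ - _)).
    by rewrite /l [h *: 1]mulr1 scalerDl addrCA.
  have dl := @diff_derivable _ _ _ _ _ (y - x) dF.
  by split; [rewrite /derivable lE|rewrite /derive lE].
have cF : {within `[0, 1], continuous (F \o l : R -> R)}.
  apply: derivable_within_continuous => t _.
  by have [] := lD t.
have [t t01] := MVT_segment ler01 (fun t _ => lD t) cF.
rewrite /l/= scale1r scale0r addr0 [x + (y - x)]addrC subrK subr0 mulr1 => h.
exists t; first by move: t01; rewrite in_itv.
rewrite h; congr (dotv (grad F _) _).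
by apply/colP => i; rewrite !mxE; ring.
Qed.

Lemma C1_continuous F : C1_on setT F -> continuous F.
Proof. by move=> F1 x; apply: differentiable_continuous; case: (F1 x I). Qed.

Lemma grad_continuous F : C1_on setT F -> continuous (grad F).
Proof. by move=> F1 x; case: (F1 x I). Qed.

Lemma compact_enorm_bound m (h : 'cV[R]_n -> 'cV[R]_m) G : compact G ->
  continuous h -> exists2 K, 0 < K & forall x, G x -> enorm (h x) <= K.
Proof.
move=> Gc hc; have [G0|] := pselect (G !=set0); last first.
  by move=> G0; exists 1 => // x Gx; exfalso; apply: G0; exists x.
have hc' : continuous (fun x => enorm (h x)).
  by move=> x; apply: continuous_comp; [exact: hc|exact: enorm_continuous].
have [c _ hcmax] := compact_EVT_max G0 Gc (continuous_subspaceT hc').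
exists (enorm (h c) + 1); first by rewrite ltr_wpDl ?enorm_ge0.
by move=> x Gx; rewrite (le_trans (hcmax x _)) ?lerDl//; exact: mem_set.
Qed.

(** By contradiction: pairs of points at distance at most [1 / (k + 1)] with images more than [e]
    apart would cluster at a point where [h] is not continuous. *)
Lemma compact_unif_cts m (h : 'cV[R]_n -> 'cV[R]_m) G : compact G ->
  continuous h -> forall e, 0 < e -> exists2 r, 0 < r &
    forall x y, G x -> G y -> enorm (x - y) <= r -> enorm (h x - h y) <= e.
Proof.
move=> Gc hc e e0; apply: contrapT => H.
have {}H k : exists xy : 'cV[R]_n * 'cV[R]_n, [/\ G xy.1, G xy.2,
    enorm (xy.1 - xy.2) <= k.+1%:R^-1 & e < enorm (h xy.1 - h xy.2)].
  apply: contrapT => Hk; apply: H; exists k.+1%:R^-1; first by rewrite invr_gt0.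
  move=> x y Gx Gy xy; rewrite leNgt; apply/negP => exy.
  by apply: Hk; exists (x, y).
have [xy xyP] := choice H.
have [|x Gx xc] := @compact_seq_cluster _ _ _ (fun k => (xy k).1) Gc.
  by move=> k; case: (xyP k).
have e20 : 0 < e / 2 by rewrite divr_gt0.
have [r r0 hr] := enorm_cts (hc x) e20.
have r20 : 0 < r / 2 by rewrite divr_gt0.
have [k0 k0r] : exists k0, forall k, (k0 <= k)%N -> k.+1%:R^-1 < r / 2.
  have := @near_infty_natSinv_lt R (PosNum r20).
  by move=> [k0 _ h0]; exists k0 => k /h0.
have [k /k0r kr xk] := xc _ r20 k0.
have [_ _ xyk] := xyP k; apply/negP; rewrite -leNgt.
rewrite (le_trans (ler_enorm_triangle _ (h x) _))//.
rewrite enormB [leRHS]splitr lerD// ltW// hr//.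
  by rewrite enormB (lt_trans xk)// ltr_pdivrMr// ltr_pMr// ltr1n.
rewrite (le_lt_trans (ler_enorm_triangle _ (xy k).1 _))//.
rewrite [ltRHS]splitr ltrD//; first by rewrite enormB.
exact: le_lt_trans xyk kr.
Qed.

(** The gradient is taken at a third point because the exact scheme moves from [x] to [y], while [g]
    approximates the gradient at the nearby iterate [z]. The mean value theorem yields a point of
    the segment, which the convexity of balls keeps within [r] of [z]. *)
Lemma C1_unif_diff F G : compact G -> segment_closed G -> C1_on setT F ->
  forall e, 0 < e -> exists2 r, 0 < r &
  forall x y z, G x -> G y -> G z -> enorm (x - z) <= r -> enorm (y - z) <= r ->
    F y - F x <= dotv (grad F z) (y - x) + e * enorm (y - x).
Proof.
move=> Gc Gcvx F1 e e0.
have [r r0 hr] := compact_unif_cts Gc (grad_continuous F1) e0.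
exists r => // x y z Gx Gy Gz xz yz.
have [t t01 ->] := segment_MVT x y F1.
rewrite -lerBlDl -dotvNl -dotvDl (le_trans (dotv_le_enorm _ _))//.
rewrite ler_wpM2r ?enorm_ge0// hr//; first exact: Gcvx.
have -> : t *: y + (1 - t) *: x - z = t *: (y - z) + (1 - t) *: (x - z).
  by apply/colP => i; rewrite !mxE; ring.
have /andP[t0 t1] := t01.
rewrite (le_trans (ler_enormD _ _))// !enormZ !ger0_norm ?subr_ge0//.
rewrite (_ : r = t * r + (1 - t) * r); last by ring.
by rewrite lerD// ler_wpM2l ?subr_ge0.
Qed.

Lemma C1_lipschitz F G : compact G -> segment_closed G -> C1_on setT F ->
  exists2 K, 0 < K & forall x y, G x -> G y -> F y - F x <= K * enorm (y - x).
Proof.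
move=> Gc Gcvx F1.
have [K K0 hK] := compact_enorm_bound Gc (grad_continuous F1).
exists K => // x y Gx Gy; have [t t01 ->] := segment_MVT x y F1.
rewrite (le_trans (dotv_le_enorm _ _))// ler_wpM2r ?enorm_ge0// hK//.
exact: Gcvx.
Qed.

End gradient.

(** * The projected Euler scheme *)

Section window_sums.
Context {R : realType}.
Implicit Types (a b gam u : nat -> R).

Lemma cvg0_lt u : u @ \oo --> (0 : R) -> forall e, 0 < e ->
  exists n0, forall k, (n0 <= k)%N -> `|u k| < e.
Proof.
move=> /cvgrPdist_lt u0 e e0; have [n0 _ h] := u0 e e0.
by exists n0 => k /h /=; rewrite sub0r normrN.
Qed.

(** Time is measured by [gam], as in a continuous-time interpolation: a window of length [T] has no
    bound on its number of steps. Only upper bounds are required, since [a] will bound errors. *)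
Definition window_negligible gam a : Prop :=
  forall T e, 0 < e -> exists n0, forall n j, (n0 <= n)%N ->
    \sum_(n <= k < n + j) gam k <= T -> \sum_(n <= k < n + j) a k <= e.

Lemma window_negligibleD gam a b : window_negligible gam a ->
  window_negligible gam b -> window_negligible gam (fun k => a k + b k).
Proof.
move=> ha hb T e e0; have e20 : 0 < e / 2 by rewrite divr_gt0.
have [n1 h1] := ha T _ e20; have [n2 h2] := hb T _ e20.
exists (maxn n1 n2) => n j; rewrite geq_max => /andP[n1n n2n] nT.
by rewrite big_split/= [leRHS]splitr lerD// ?h1 ?h2.
Qed.

Lemma window_negligible_series gam a : (forall k, 0 <= a k) ->
  cvgn (series a) -> window_negligible gam a.
Proof.
move=> a0 /cauchy_cvgP/cauchy_seriesP ca T e e0.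
have [[A B] [[n1 _ h1] [n2 _ h2]] hAB] := ca _ e0.
exists (maxn n1 n2) => n j; rewrite geq_max => /andP[n1n n2n] _.
apply: (le_trans (ler_norm _)); apply/ltW; apply: (hAB (n, n + j)%N).
by split; [exact: h1|apply: h2 => /=; rewrite (leq_trans n2n)// leq_addr].
Qed.

(** The weights [u] vanish, while the sum of [b] over a window of length at most [T] stays below the
    constant [M]. *)
Lemma window_negligibleM gam b u A kappa : (forall k, 0 < gam k) ->
  (forall k, 0 <= b k) -> 0 <= A ->
  (forall n j, \sum_(n <= k < n + j) b k <=
               A * \sum_(n <= k < n + j) gam k + kappa) ->
  u @ \oo --> (0 : R) -> window_negligible gam (fun k => u k * b k).
Proof.
move=> g0 b0 A0 hb u0 T e e0.
pose M := A * `|T| + `|kappa| + 1.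
have M0 : 0 < M by rewrite ltr_wpDl// addr_ge0 ?mulr_ge0.
have [n0 h0] := cvg0_lt u0 (divr_gt0 e0 M0).
exists n0 => n j n0n jT.
rewrite (@le_trans _ _ (\sum_(n <= k < n + j) (e / M * b k)))//.
  rewrite ler_sum_nat// => k /andP[nk _]; rewrite ler_wpM2r//.
  by rewrite (le_trans (ler_norm _))// ltW// h0// (leq_trans n0n).
rewrite -mulr_sumr mulrAC ler_pdivrMr// ler_pM2l//.
rewrite (le_trans (hb _ _))// /M -addrA lerD//.
  by rewrite ler_wpM2l// (le_trans jT)// ler_norm.
by rewrite (le_trans (ler_norm _))// lerDl.
Qed.

End window_sums.

Section tracking_step.
Context {R : realType} {d : nat}.
Implicit Types (G : set 'cV[R]_d) (x y z r g v : 'cV[R]_d).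

Lemma enorm_proj_step G y g (c C : R) : segment_closed G -> proximinal G ->
  0 <= c -> enorm g <= C -> G y ->
  enorm (eproj G (y + c *: g) - y) <= c * C.
Proof.
move=> Gc Gp c0 gC Gy; rewrite -{2}(eproj_id Gp Gy).
rewrite (le_trans (eproj_nonexpansive _ _ Gc Gp))//.
by rewrite addrC addKr enormZ ger0_norm// ler_wpM2l.
Qed.

(** With [u = y + c *: g - y'] for the new exact point [y'], the new difference is
    [(x + r - y) + (u - c *: v)]. Since [u] is normal to [G] at [y'] and [v] is almost normal at
    [x], the cross terms have the right sign up to the displacements [r] and [y' - y]. *)
Lemma track_step G x r y g v (c C e : R) : segment_closed G -> proximinal G ->
  0 <= c -> enorm g <= C -> G x -> G y ->
  (forall z, G z -> - e <= dotv v (x - z)) ->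
  enorm (x + c *: (g - v) + r - eproj G (y + c *: g)) ^+ 2 <=
  enorm (x + r - y) ^+ 2 +
  2 * (c * e + enorm r * (c * enorm v) + C * (enorm r * c) + 2 * C ^+ 2 * (c * c)
      + (c * enorm v) ^+ 2).
Proof.
move=> Gc Gp c0 gC Gx Gy hv; set y' := eproj G _.
have C0 : 0 <= C := le_trans (enorm_ge0 _) gC.
have yy' : enorm (y' - y) <= c * C by exact: enorm_proj_step.
pose u := y + c *: g - y'.
have uC : enorm u <= c * C.
  have [_ /(_ _ Gy)] := eprojP (y + c *: g) Gp; rewrite -/y' -/u.
  by move=> /le_trans; apply; rewrite addrC addKr enormZ ger0_norm// ler_wpM2l.
have -> : x + c *: (g - v) + r - y' = (x + r - y) + (u - c *: v).
  by apply/colP => i; rewrite /u !mxE; ring.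
rewrite enorm_sqr dotvDl !(dotvDr _ (x + r - y)) (dotvC _ (x + r - y)).
rewrite -enorm_sqr.
have h1 : dotv (x + r - y) u <= enorm r * (c * C) + (c * C) * (c * C).
  have -> : x + r - y = r + ((x - y') + (y' - y)).
    by apply/colP => i; rewrite !mxE; ring.
  rewrite dotvDl (dotvDl _ (x - y')).
  have hr : dotv r u <= enorm r * (c * C).
    by rewrite (le_trans (dotv_le_enorm _ _))// ler_wpM2l ?enorm_ge0.
  have hx : dotv (x - y') u <= 0 by rewrite dotvC; exact: dotv_eproj_le0.
  have hy : dotv (y' - y) u <= (c * C) * (c * C).
    by rewrite (le_trans (dotv_le_enorm _ _))// ler_pM ?enorm_ge0.
  by lra.
have h2 : - dotv (x + r - y) (c *: v) <= c * e + c * (enorm r * enorm v).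
  rewrite dotvZr -mulrN -mulrDr ler_wpM2l//.
  have -> : x + r - y = r + (x - y) by apply/colP => i; rewrite !mxE; ring.
  rewrite dotvDl opprD addrC lerD//; first by rewrite dotvC lerNl hv.
  by rewrite -dotvNl (le_trans (dotv_le_enorm _ _))// enormN.
have h3 : dotv (u - c *: v) (u - c *: v) <=
    2 * ((c * C) * (c * C)) + 2 * (c * enorm v) ^+ 2.
  rewrite -enorm_sqr.
  have := ler_enormB u (c *: v); rewrite enormZ ger0_norm//.
  have := enorm_ge0 (u - c *: v).
  have cv0 : 0 <= c * enorm v by rewrite mulr_ge0 ?enorm_ge0.
  have cC0 : 0 <= c * C by rewrite mulr_ge0.
  move: uC cv0 (enorm_ge0 u) cC0; move: (c * C) (c * enorm v) (enorm u).
  move=> a b p pa b0 p0 a0 q0 qpb.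
  have : enorm (u - c *: v) ^+ 2 <= (a + b) ^+ 2.
    by rewrite ler_sqr ?nnegrE ?addr_ge0//; lra.
  by have := sqr_ge0 (a - b); lra.
rewrite [dotv _ (u - _)]dotvDr dotvNr; lra.
Qed.

End tracking_step.

Definition cluster_point {R : realType} d (x : nat -> 'cV[R]_d) z : Prop :=
  forall e, 0 < e -> forall n0, exists2 n, (n0 <= n)%N & enorm (x n - z) < e.

(** * Cluster points of slowly varying sequences in a compact set *)

Section connected_cluster_set.
Context {R : realType} {d : nat} (G : set 'cV[R]_d) (x : nat -> 'cV[R]_d).
Hypotheses (G_compact : compact G) (xG : forall k, G (x k)).

(** Compactness along the indices satisfying [P]. Keeping [P] in the conclusion is what localizes
    the crossings of a set or of a level. *)
Lemma subseq_cluster (P : nat -> Prop) :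
  (forall n0, exists2 n, (n0 <= n)%N & P n) -> exists2 z, G z &
  forall e, 0 < e -> forall n0, exists n, [/\ (n0 <= n)%N, P n & enorm (x n - z) < e].
Proof.
move=> HP; have [|u uP] := @choice _ _ (fun k n => (k <= n)%N /\ P n).
  by move=> k; have [n] := HP k; exists n.
have [z Gz zc] := @compact_seq_cluster _ _ G (x \o u) G_compact (fun k => xG _).
exists z => // e e0 n0; have [k n0k xk] := zc _ e0 n0.
by have [ku Pu] := uP k; exists (u k); split => //; exact: leq_trans ku.
Qed.

(** Otherwise the indices at which [x] is far from all cluster points would have a cluster point of
    their own. *)
Lemma cvg_cluster_set e : 0 < e -> exists n0, forall n, (n0 <= n)%N ->
  exists2 z, cluster_point x z & enorm (x n - z) < e.
Proof.
move=> e0; apply: contrapT => H.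
have [|z Gz zc] := @subseq_cluster (fun n => ~ exists2 z, cluster_point x z &
    enorm (x n - z) < e).
  move=> n0; apply: contrapT => H0; apply: H; exists n0 => n n0n.
  by apply: contrapT => Hn; apply: H0; exists n.
have [n [_ nP xz]] := zc _ e0 0%N; apply: nP; exists z => // e' e'0 n0.
by have [m []] := zc _ e'0 n0; exists m.
Qed.

Hypothesis x_slow : forall e, 0 < e -> exists n0, forall n, (n0 <= n)%N ->
  enorm (x n.+1 - x n) < e.

Lemma switch_often (P : nat -> Prop) :
  (forall n0, exists2 n, (n0 <= n)%N & P n) ->
  (forall n0, exists2 n, (n0 <= n)%N & ~ P n) ->
  forall n0, exists2 n, (n0 <= n)%N & P n /\ ~ P n.+1.
Proof.
move=> HP HnP n0; have [n1 n01 Pn1] := HP n0; have [m n1m Pm] := HnP n1.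
apply: contrapT => H; apply: Pm; rewrite -(subnKC n1m).
elim: (m - n1)%N => [|k IH]; first by rewrite addn0.
apply: contrapT; rewrite addnS => Pk; apply: H; exists (n1 + k)%N => //.
by rewrite (leq_trans n01)// leq_addr.
Qed.

(* A clopen part [B] of the cluster set would be left infinitely often by
   steps from near [B] to near its complement. *)
Lemma cluster_set_connected : connected (cluster_point x).
Proof.
move=> B [b0 Bb0] [C Co BC] [D Dc BD].
apply: contrapT => BK.
have BsubK b : B b -> cluster_point x b by rewrite BC => -[].
have [b1 [Kb1 Bb1]] : exists b1, cluster_point x b1 /\ ~ B b1.
  apply: contrapT => H; apply: BK; apply/seteqP; split => // b Kb.
  by apply: contrapT => Bb; apply: H; exists b.
(* A strict comparison of distances: it holds around every point of [B] and fails around every other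
   cluster point, which is where [B] being both open and closed in the cluster set is used. *)
pose nearB y := exists2 b, B b & forall b', cluster_point x b' -> ~ B b' ->
  enorm (y - b) < enorm (y - b').
have near_in b : B b -> exists2 r, 0 < r & forall y, enorm (y - b) < r -> nearB y.
  move=> Bb; have Cb : C b by move: Bb; rewrite BC => -[].
  have /enorm_ball[r r0 hr] : nbhs b C by exact: open_nbhs_nbhs.
  exists (r / 2); first by rewrite divr_gt0.
  move=> y yb; exists b => // b' Kb' Bb'.
  have : r <= enorm (b - b').
    by rewrite leNgt; apply/negP => /hr Cb'; apply: Bb'; rewrite BC.
  by have := ler_enorm_triangle b y b'; rewrite (enormB b y); lra.
have near_out b : cluster_point x b -> ~ B b ->
    exists2 r, 0 < r & forall y, enorm (y - b) < r -> ~ nearB y.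
  move=> Kb Bb; have Db : ~ D b by move=> Db; apply: Bb; rewrite BD.
  have /enorm_ball[r r0 hr] : nbhs b (~` D).
    by apply: open_nbhs_nbhs; split => //; exact: closed_openC.
  exists (r / 2); first by rewrite divr_gt0.
  move=> y yb [b' Bb' /(_ _ Kb Bb)].
  have : r <= enorm (b - b').
    by rewrite leNgt; apply/negP => /hr; apply; move: Bb'; rewrite BD => -[].
  by have := ler_enorm_triangle b y b'; rewrite (enormB b y); lra.
have sw := @switch_often (fun n => nearB (x n)).
have [|z Gz zc] := @subseq_cluster (fun n => nearB (x n) /\ ~ nearB (x n.+1)).
  apply: sw => n0.
    by have [r r0 hr] := near_in _ Bb0; have [n n0n /hr] := BsubK _ Bb0 _ r0 n0; exists n.
  by have [r r0 hr] := near_out _ Kb1 Bb1; have [n n0n /hr] := Kb1 _ r0 n0; exists n.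
have Kz : cluster_point x z.
  by move=> e e0 n0; have [n []] := zc _ e0 n0; exists n.
(* Near the limit [z] of the switching times, [nearB] is constant. If [z] is in [B], the short step
   to [x n.+1] stays in that neighborhood, contradicting the switch; otherwise [nearB (x n)] already
   fails. *)
have [Bz|Bz] := pselect (B z).
- have [r r0 hr] := near_in _ Bz; have r20 : 0 < r / 2 by rewrite divr_gt0.
  have [n1 h1] := x_slow r20; have [n [n1n [_ Pn] xz]] := zc _ r20 n1.
  apply/Pn/hr; have := h1 _ n1n.
  by have := ler_enorm_triangle (x n.+1) (x n) z; lra.
- have [r r0 hr] := near_out _ Kz Bz.
  by have [n [_ [Pn _] /hr]] := zc _ r0 0%N.
Qed.

End connected_cluster_set.

(** * Tracking, descent and criticality of the cluster points *)

Section projected_euler.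
Context {R : realType} {d : nat} (G : set 'cV[R]_d) (F : 'cV[R]_d -> R).
Hypotheses (G_compact : compact G) (G_convex : segment_closed G).
Hypothesis F1 : C1_on setT F.
Context (x g v r : nat -> 'cV[R]_d) (gam eps : nat -> R) (A kappa : R).
Hypotheses (xG : forall k, G (x k)) (gam_gt0 : forall k, 0 < gam k).
Hypotheses (gam_cvg0 : gam @ \oo --> (0 : R)).
Hypotheses (gam_dvg : series gam @ \oo --> +oo).
(** The noise appears as a difference of consecutive remainders, so that [x k + r k] evolves without
    noise. *)
Hypothesis x_step : forall k,
  x k.+1 = x k + gam k *: (g k - v k) + (r k - r k.+1).
Hypothesis g_grad : enorm (g k + grad F (x k)) @[k --> \oo] --> (0 : R).
Hypothesis r_cvg0 : enorm (r k) @[k --> \oo] --> (0 : R).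
Hypothesis v_normal : forall k y, G y -> - eps k <= dotv (v k) (x k - y).
Hypothesis eps_ge0 : forall k, 0 <= eps k.
Hypothesis eps_series : cvgn (series (fun k => gam k * eps k)).
Hypothesis v_series : cvgn (series (fun k => (gam k * enorm (v k)) ^+ 2)).
Hypothesis A_ge0 : 0 <= A.
(** This replaces a uniform bound on [v]: it makes the products
    [enorm (r k) * (gam k * enorm (v k))] negligible on windows. *)
Hypothesis v_window : forall n j,
  \sum_(n <= k < n + j) gam k * enorm (v k) <=
  A * \sum_(n <= k < n + j) gam k + kappa.

Let G_prox : proximinal G.
Proof. by apply: compact_proximinal => //; exists (x 0%N). Qed.

Let sum_recr (a : nat -> R) n j :
  \sum_(n <= k < n + j.+1) a k = \sum_(n <= k < n + j) a k + a (n + j)%N.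
Proof. by rewrite addnS big_nat_recr//= leq_addr. Qed.

Let gam_sum_mono n i j : (i <= j)%N ->
  \sum_(n <= k < n + i) gam k <= \sum_(n <= k < n + j) gam k.
Proof.
move=> ij; rewrite [leRHS](@big_cat_nat _ _ _ (n + i)%N)/= ?leq_addr ?leq_add2l//.
by rewrite lerDl sumr_ge0// => k _; exact: ltW.
Qed.

Let g_bounded : exists2 C, 0 < C &
  exists n0, forall k, (n0 <= k)%N -> enorm (g k) <= C.
Proof.
have [K K0 hK] := compact_enorm_bound G_compact (grad_continuous F1).
exists (K + 1); first by rewrite addr_gt0.
have [n0 h0] := cvg0_lt g_grad ltr01.
exists n0 => k /h0 h; rewrite -(addrK (grad F (x k)) (g k)).
rewrite (le_trans (ler_enormB _ _))// addrC lerD ?hK//.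
by rewrite (le_trans (ler_norm _))// ltW.
Qed.

(* The projected Euler scheme started from [x n] and driven by the same [g]. *)
Fixpoint shadow n j : 'cV[R]_d :=
  if j is i.+1 then eproj G (shadow n i + gam (n + i)%N *: g (n + i)%N)
  else x n.

Let shadowG n j : G (shadow n j).
Proof. by case: j => [|j]; [exact: xG|exact: eproj_in]. Qed.

(** Iterating [track_step] leaves the initial [r n] and the window sum of [err]. Two terms of [err]
    belong to convergent series; the other three are a vanishing factor times a quantity with
    bounded window sums. *)
Lemma shadow_track T e : 0 < e -> exists n0, forall n j, (n0 <= n)%N ->
  \sum_(n <= k < n + j) gam k <= T -> enorm (x (n + j)%N - shadow n j) <= e.
Proof.
move=> e0; have [C C0 [n1 gC]] := g_bounded.
pose err k := gam k * eps k + enorm (r k) * (gam k * enorm (v k)) +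
  C * (enorm (r k) * gam k) + 2 * C ^+ 2 * (gam k * gam k) +
  (gam k * enorm (v k)) ^+ 2.
have gamM u : u @ \oo --> (0 : R) -> window_negligible gam (fun k => u k * gam k).
  move=> u0; apply: (@window_negligibleM _ gam gam u 1 0) => //.
    by move=> k; exact: ltW.
  by move=> n j; rewrite mul1r addr0.
have cst0 c u : u @ \oo --> (0 : R) -> (fun k => c * u k) @ \oo --> (0 : R).
  by move=> u0; rewrite -(mulr0 c); apply: cvgMl_tmp; exact: u0.
have err_neg : window_negligible gam err.
  apply: window_negligibleD; last first.
    by apply: window_negligible_series => // k; exact: sqr_ge0.
  apply: window_negligibleD; last first.
    rewrite (_ : (fun k => _) = (fun k => (2 * C ^+ 2 * gam k) * gam k)).
      by apply: gamM; exact: cst0.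
    by apply/funext => k; rewrite mulrA.
  apply: window_negligibleD; last first.
    rewrite (_ : (fun k => _) = (fun k => (C * enorm (r k)) * gam k)).
      by apply: gamM; exact: cst0.
    by apply/funext => k; rewrite mulrA.
  apply: window_negligibleD.
    by apply: window_negligible_series => // k; rewrite mulr_ge0// ltW.
  apply: (@window_negligibleM _ gam _ _ A kappa) => // k.
  by rewrite mulr_ge0 ?enorm_ge0// ltW.
have e2 : 0 < e / 2 by rewrite divr_gt0.
have [n2 h2] := cvg0_lt r_cvg0 e2.
have e4 : 0 < (e / 2) ^+ 2 / 4 by rewrite divr_gt0 ?exprn_gt0.
have [n3 h3] : exists n3, forall k, (n3 <= k)%N ->
    enorm (r k) ^+ 2 < (e / 2) ^+ 2 / 4.
  have r2 : (fun k => enorm (r k) * enorm (r k)) @ \oo --> (0 : R).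
    by rewrite -(mulr0 0); apply: cvgM; exact: r_cvg0.
  have [n3 h3] := cvg0_lt r2 e4.
  exists n3 => k /h3; apply: le_lt_trans; rewrite -expr2; exact: ler_norm.
have [n4 h4] := err_neg T _ e4.
exists (maxn (maxn n1 n2) (maxn n3 n4)) => n j.
rewrite !geq_max => /andP[/andP[n1n n2n] /andP[n3n n4n]] jT.
have key : enorm (x (n + j)%N + r (n + j)%N - shadow n j) ^+ 2 <=
    enorm (r n) ^+ 2 + 2 * \sum_(n <= k < n + j) err k.
  elim: j {jT} => [|j IH].
    by rewrite addn0 big_geq// mulr0 addr0 addrAC subrr add0r.
  rewrite sum_recr mulrDr addrA addnS x_step.
  rewrite (_ : x (n + j)%N + _ + _ + _ = x (n + j)%N +
    gam (n + j)%N *: (g (n + j)%N - v (n + j)%N) + r (n + j)%N); last first.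
    by apply/colP => i; rewrite !mxE; ring.
  apply: (le_trans (track_step (C := C) _ G_convex G_prox _ _ _ _ (@v_normal _))) => //.
  - exact: ltW.
  - by apply: gC; rewrite (leq_trans n1n)// leq_addr.
  - by rewrite lerD2r.
have {}key : enorm (x (n + j)%N + r (n + j)%N - shadow n j) <= e / 2.
  rewrite -ler_sqr ?nnegrE ?enorm_ge0 ?(ltW e2)//.
  apply: (le_trans key); have := h3 _ n3n; have := h4 _ _ n4n jT.
  by have := exprn_gt0 2 e2; lra.
rewrite (_ : _ - _ = (x (n + j)%N + r (n + j)%N - shadow n j) - r (n + j)%N).
  rewrite (le_trans (ler_enormB _ _))// [leRHS]splitr lerD//.
  rewrite (le_trans (ler_norm _))// ltW// h2//.
  by rewrite (leq_trans n2n)// leq_addr.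
by apply/colP => i; rewrite !mxE; ring.
Qed.

(** A path covering a distance [D] in time [T] lowers [F] by about [D ^+ 2 / T]. The free slope [s]
    linearizes this bound, so that it can be proved step by step; [s = D / T] recovers it. *)
Lemma shadow_descent T e s : 0 < e -> 0 <= T -> 0 <= s ->
  exists n0, forall n j, (n0 <= n)%N ->
  \sum_(n <= k < n + j) gam k <= T ->
  F (shadow n j) <= F (x n) - 2 * s * enorm (shadow n j - x n) + s ^+ 2 * T + e.
Proof.
move=> e0 T0 s0; have [C C0 [n1 gC]] := g_bounded.
(* A step loses at most [e1 * enorm (y' - y)] to the variation of the gradient and as much to
   [g_grad]. As it is no longer than [c * C], the losses add up to at most [2 * C * e1 * T <= e]. *)
pose e1 := e / (2 * C * (T + 1)).
have T1 : 0 < T + 1 by rewrite ltr_wpDl.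
have e10 : 0 < e1 by rewrite divr_gt0// !mulr_gt0.
have [dl dl0 hdl] := C1_unif_diff G_compact G_convex F1 e10.
have dl2 : 0 < dl / 2 by rewrite divr_gt0.
have [n2 h2] := shadow_track T dl2.
have [n3 h3] := cvg0_lt gam_cvg0 (divr_gt0 dl2 C0).
have [n4 h4] := cvg0_lt g_grad e10.
exists (maxn (maxn n1 n2) (maxn n3 n4)) => n j.
rewrite !geq_max => /andP[/andP[n1n n2n] /andP[n3n n4n]].
have key i : \sum_(n <= k < n + i) gam k <= T ->
  F (shadow n i) <= F (x n) - 2 * s * enorm (shadow n i - x n) +
     (s ^+ 2 + 2 * C * e1) * \sum_(n <= k < n + i) gam k.
  elim: i => [|i IH] iT.
    by rewrite addn0 big_geq//= subrr enorm0 !mulr0 subr0 addr0.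
  have iT' : \sum_(n <= k < n + i) gam k <= T.
    by rewrite (le_trans _ iT)// gam_sum_mono.
  have {}IH := IH iT'.
  rewrite sum_recr; set y := shadow n i in IH *; set y' := shadow n i.+1.
  set c := gam (n + i)%N; set X := x (n + i)%N.
  have c0 : 0 < c by exact: gam_gt0.
  have gC' : enorm (g (n + i)%N) <= C.
    by apply: gC; rewrite (leq_trans n1n)// leq_addr.
  have Dy : enorm (y' - y) <= c * C.
    by apply: enorm_proj_step => //; exact: ltW.
  have yX : enorm (y - X) <= dl / 2 by rewrite enormB; exact: h2.
  have cC : c * C <= dl / 2.
    rewrite -ler_pdivlMr//; apply: ltW; apply: (le_lt_trans (ler_norm _)).
    by apply: h3; rewrite (leq_trans n3n)// leq_addr.
  have := @hdl y y' X (shadowG n i) (shadowG n i.+1) (xG _).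
  move=> /(_ (le_trans yX _)) -/(_ _)/[!ler_pdivrMr]// => hF.
  have {hF} : F y' - F y <= dotv (grad F X) (y' - y) + e1 * enorm (y' - y).
    apply: hF; first by rewrite ler_pMr// ler1n.
    rewrite (le_trans (ler_enorm_triangle _ y _))// [leRHS]splitr lerD//.
    exact: le_trans Dy cC.
  have gg : enorm (g (n + i)%N + grad F X) <= e1.
    apply: ltW; apply: (le_lt_trans (ler_norm _)).
    by apply: h4; rewrite (leq_trans n4n)// leq_addr.
  have hg : dotv (grad F X) (y' - y) <=
      - dotv (g (n + i)%N) (y' - y) + e1 * enorm (y' - y).
    rewrite -lerBlDl opprK -dotvDl (addrC (grad F X)).
    by rewrite (le_trans (dotv_le_enorm _ _))// ler_wpM2r ?enorm_ge0.
  (* The obtuse angle property tested at the previous point [y] of [G]. Combined with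
     [(enorm (y' - y) - c * s) ^+ 2 >= 0], it yields the slope [2 * s]. *)
  have hD : enorm (y' - y) ^+ 2 <= c * dotv (g (n + i)%N) (y' - y).
    have := dotv_eproj_le0 (y + c *: g (n + i)%N) G_convex G_prox (shadowG n i).
    rewrite -/y -/y' (_ : y + _ - y' = c *: g (n + i)%N - (y' - y)); last first.
      by apply/colP => k; rewrite !mxE; ring.
    rewrite -(opprB y' y) dotvNr dotvDl dotvNl dotvZl -enorm_sqr; lra.
  have hs : c * (2 * s * enorm (y' - y)) <= enorm (y' - y) ^+ 2 + c * (c * s ^+ 2).
    by have := sqr_ge0 (enorm (y' - y) - c * s); lra.
  have hs' : 2 * s * enorm (y' - y) <= dotv (g (n + i)%N) (y' - y) + c * s ^+ 2.
    by rewrite -(ler_pM2l c0) (le_trans hs)// mulrDr lerD2r.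
  have tri : enorm (y' - x n) <= enorm (y' - y) + enorm (y - x n).
    exact: ler_enorm_triangle.
  have hs2 : 2 * s * enorm (y' - x n) <=
      2 * s * enorm (y' - y) + 2 * s * enorm (y - x n).
    by rewrite -mulrDr ler_wpM2l// mulr_ge0.
  have he : e1 * enorm (y' - y) <= e1 * (c * C) by rewrite ler_wpM2l// ltW.
  move=> hF; lra.
move=> jT; apply: (le_trans (key _ jT)).
rewrite (mulrDl (s ^+ 2)) addrA lerD//; first by rewrite lerD2l ler_wpM2l ?sqr_ge0.
have -> : e = 2 * C * e1 * (T + 1) by rewrite /e1; field; rewrite !gt_eqF.
apply: ler_wpM2l; first exact: mulr_ge0 (mulr_ge0 (ler0n _ 2) (ltW C0)) (ltW e10).
by rewrite (le_trans jT)// lerDl.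
Qed.

(** Transfer from the exact scheme: a tracking error costs at most [K] times itself in [F] and
    [2 * s] times itself in the distance. *)
Lemma iterate_descent T e s : 0 < e -> 0 <= T -> 0 <= s ->
  exists n0, forall n j, (n0 <= n)%N ->
  \sum_(n <= k < n + j) gam k <= T ->
  F (x (n + j)%N) <=
    F (x n) - 2 * s * enorm (x (n + j)%N - x n) + s ^+ 2 * T + e.
Proof.
move=> e0 T0 s0; have [K K0 hK] := C1_lipschitz G_compact G_convex F1.
have e2 : 0 < e / 2 by rewrite divr_gt0.
have M0 : 0 < K + 2 * s by rewrite ltr_wpDr// mulr_ge0.
have [n1 h1] := shadow_track T (divr_gt0 e2 M0).
have [n2 h2] := shadow_descent e2 T0 s0.
exists (maxn n1 n2) => n j; rewrite geq_max => /andP[n1n n2n] jT.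
have := h1 _ _ n1n jT; have := h2 _ _ n2n jT.
have := hK _ _ (shadowG n j) (xG (n + j)%N).
set u := x (n + j)%N; set y := shadow n j => hF hy hu.
have hn : 2 * s * enorm (u - x n) <= 2 * s * enorm (u - y) + 2 * s * enorm (y - x n).
  by rewrite -mulrDr ler_wpM2l ?mulr_ge0//; exact: ler_enorm_triangle.
by move: hu; rewrite ler_pdivlMr// => hu; lra.
Qed.

(** The least [j] passing [M] overshoots by one step only, and that step is at most 1. *)
Let gam_window n M : 0 <= M -> (forall k, (n <= k)%N -> gam k <= 1) ->
  exists j, M < \sum_(n <= k < n + j) gam k <= M + 1.
Proof.
move=> M0 g1.
have [j jM] : exists j, M < \sum_(n <= k < n + j) gam k.
  have [m _ hm] := proj1 (cvgryPgt (series gam)) gam_dvg (series gam n + M).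
  exists m; have := hm (n + m)%N (leq_addl _ _).
  by rewrite /= -ltrBrDl sub_series_geq// leq_addr.
have ex : exists j, M < \sum_(n <= k < n + j) gam k by exists j.
have := ex_minnP ex => -[[|i]] iM imin.
  by move: iM; rewrite addn0 big_geq// ltNge M0.
exists i.+1; rewrite iM/= sum_recr lerD//; last by rewrite g1 ?leq_addr.
by rewrite leNgt; apply/negP => /imin; rewrite ltnn.
Qed.

(** At a point that is not KKT, some [y] in [G] lies in a descent direction. As long as the iterates
    stay near [z], each step of the exact scheme reduces its squared distance to [y] by a multiple
    of [gam], which cannot last. *)
Lemma KKT_escape z : G z -> ~ KKT F G z ->
  exists r0 T, [/\ 0 < r0, 0 < T & exists n0, forall n, (n0 <= n)%N ->
    enorm (x n - z) < r0 -> exists j,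
      \sum_(n <= k < n + j) gam k <= T /\ 2 * r0 <= enorm (x (n + j)%N - z)].
Proof.
move=> Gz zKKT.
have [y Gy cpos] : exists2 y, G y & dotv (grad F z) (y - z) < 0.
  apply: contrapT => H; apply: zKKT; split => // y Gy.
  rewrite leNgt; apply/negP => h; apply: H; exists y => //.
  by move: h; rewrite -opprB dotvNl dotvNr opprK.
have [C C0 [n1 gC]] := g_bounded.
have [D D0 hD] : exists2 D, 0 < D & forall u, G u -> enorm (u - y) <= D.
  apply: (@compact_enorm_bound _ _ _ (fun u => u - y)) => //.
  by move=> u; apply: continuousB; [exact: id|exact: cst_continuous].
(* Of the slope [4 * c] towards [y], one [c] is lost to each of [g_grad], the variation of the
   gradient near [z], and the distance of the exact scheme from [z]; one [c] remains. *)
pose c := - dotv (grad F z) (y - z) / 4.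
have c0 : 0 < c by rewrite divr_gt0// oppr_gt0.
have [ra ra0 hra] := enorm_cts (@grad_continuous _ _ _ F1 z) (divr_gt0 c0 D0).
pose K := enorm (grad F z) + 1.
have K0 : 0 < K by rewrite ltr_wpDl ?enorm_ge0.
(* The exact scheme stays within [3 * r0] of [z]: [2 * r0] for the iterate and [r0] for the tracking
   error. *)
pose r0 := Num.min (ra / 2) (c / (3 * K)).
have r00 : 0 < r0 by rewrite lt_min; apply/andP; split; apply: divr_gt0 => //; exact: mulr_gt0.
have r0a : 2 * r0 <= ra.
  by have : r0 <= ra / 2; [rewrite ge_min lexx|lra].
have r0K : 3 * (K * r0) <= c.
  have : r0 <= c / (3 * K) by rewrite ge_min lexx orbT.
  by rewrite ler_pdivlMr ?mulr_gt0//; lra.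
(* The squared distance to [y] is at most [D ^+ 2] at the start and decreases at rate [c], so it
   would be negative after time [M]. *)
pose M := D ^+ 2 / c.
have M0 : 0 <= M by rewrite divr_ge0 ?sqr_ge0// ltW.
have M1 : 0 < M + 1 by rewrite ltr_wpDl.
exists r0, (M + 1); split=> //.
have [n2 h2] := cvg0_lt gam_cvg0 (divr_gt0 c0 (exprn_gt0 2 C0)).
have [n3 h3] := cvg0_lt gam_cvg0 ltr01.
have [n4 h4] := cvg0_lt g_grad (divr_gt0 c0 D0).
have [n5 h5] := shadow_track (M + 1) r00.
exists (maxn (maxn (maxn n1 n2) (maxn n3 n4)) n5) => n.
rewrite !geq_max => /andP[/andP[/andP[n1n n2n] /andP[n3n n4n]] n5n] xz.
apply: contrapT => H.
have near i : \sum_(n <= k < n + i) gam k <= M + 1 -> enorm (x (n + i)%N - z) < 2 * r0.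
  by move=> iM; rewrite ltNge; apply/negP => h; apply: H; exists i.
have [j /andP[jM jM1]] : exists j, M < \sum_(n <= k < n + j) gam k <= M + 1.
  apply: gam_window => // k nk; apply/ltW; apply: le_lt_trans (ler_norm _) _.
  by rewrite h3// (leq_trans n3n).
have key i : (i <= j)%N -> enorm (shadow n i - y) ^+ 2 <=
    D ^+ 2 - c * \sum_(n <= k < n + i) gam k.
  elim: i => [_|i IH ij].
    by rewrite addn0 big_geq// mulr0 subr0 ler_sqr ?nnegrE ?enorm_ge0 ?(ltW D0) ?hD.
  have {}IH := IH (ltnW ij).
  have iM1 : \sum_(n <= k < n + i) gam k <= M + 1.
    by rewrite (le_trans _ jM1)// gam_sum_mono// ltnW.
  have xz' := near _ iM1; have xw := h5 _ _ n5n iM1.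
  rewrite sum_recr; set w := shadow n i in IH xw *; set X := x (n + i)%N in xz' xw.
  set a := gam (n + i)%N; set gk := g (n + i)%N.
  have a0 : 0 < a by exact: gam_gt0.
  have gkC : enorm gk <= C by apply: gC; rewrite (leq_trans n1n)// leq_addr.
  have aC : a * C ^+ 2 <= c.
    rewrite -ler_pdivlMr ?exprn_gt0//; apply/ltW; apply: le_lt_trans (ler_norm _) _.
    by rewrite h2// (leq_trans n2n)// leq_addr.
  have wD : enorm (w - y) <= D by exact/hD/shadowG.
  have gg : enorm (gk + grad F X) <= c / D.
    apply/ltW; apply: le_lt_trans (ler_norm _) _.
    by rewrite h4// (leq_trans n4n)// leq_addr.
  have gX : enorm (grad F z - grad F X) <= c / D.
    by apply/ltW/hra; rewrite enormB (lt_le_trans xz').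
  have decr : dotv gk (w - y) <= - c.
    have -> : gk = (gk + grad F X) + ((grad F z - grad F X) - grad F z).
      by apply/colP => k; rewrite !mxE; ring.
    rewrite dotvDl (dotvDl _ (grad F z - grad F X)) dotvNl.
    have hb u : enorm u <= c / D -> dotv u (w - y) <= c.
      move=> uc; rewrite (le_trans (dotv_le_enorm _ _))//.
      have cD : c / D * D = c by rewrite divfK// gt_eqF.
      by rewrite -cD; apply: ler_pM; rewrite ?enorm_ge0.
    have := hb _ gg; have := hb _ gX.
    have : - dotv (grad F z) (w - y) <= - 4 * c + K * (3 * r0).
      have -> : w - y = (w - z) + (z - y) by apply/colP => k; rewrite !mxE; ring.
      rewrite dotvDr opprD addrC lerD//.
        by rewrite /c -(opprB z y) dotvNr; lra.
      rewrite -dotvNr (le_trans (dotv_le_enorm _ _))// enormN ler_pM ?enorm_ge0//.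
        by rewrite lerDl.
      have := ler_enorm_triangle w X z; rewrite (enormB w X) => /le_trans; apply.
      by move: xz' xw; lra.
    by lra.
  have -> : shadow n i.+1 = eproj G (w + a *: gk) by [].
  rewrite -{1}(eproj_id G_prox Gy).
  have := eproj_nonexpansive (w + a *: gk) y G_convex G_prox.
  rewrite -ler_sqr ?nnegrE ?enorm_ge0// => /le_trans; apply.
  rewrite addrAC enorm_sqr dotvDl !(dotvDr _ (w - y)) !(dotvZl, dotvZr).
  rewrite (dotvC (w - y) gk) -!enorm_sqr.
  have gkC2 : enorm gk ^+ 2 <= C ^+ 2.
    by rewrite ler_sqr ?nnegrE ?enorm_ge0 ?(ltW C0).
  have h6 : a * dotv gk (w - y) <= a * - c by rewrite ler_pM2l.
  have h7 : a * (a * enorm gk ^+ 2) <= a * c.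
    by rewrite ler_pM2l// (le_trans _ aC)// ler_pM2l.
  by move: IH h6 h7; lra.
have := key j (leqnn _); rewrite leNgt => /negP; apply.
apply: (@lt_le_trans _ _ 0); last exact: sqr_ge0.
by rewrite subr_lt0 mulrC -ltr_pdivrMr.
Qed.

(** The window given by [KKT_escape] moves the iterate by at least [r0] within time [T], and
    [iterate_descent] converts displacement into decrease. *)
Lemma KKT_drop z : G z -> ~ KKT F G z ->
  exists r0 dl, [/\ 0 < r0, 0 < dl & forall e, 0 < e -> exists n0,
    forall n, (n0 <= n)%N -> enorm (x n - z) < r0 -> exists j,
      F (x (n + j)%N) <= F (x n) - dl /\
      forall i, (i <= j)%N -> F (x (n + i)%N) <= F (x n) + e].
Proof.
move=> Gz /(KKT_escape Gz)[r0 [T [r00 T0 [n1 h1]]]].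
(* This slope maximizes [2 * s * r0 - s ^+ 2 * T], with value [s * r0]. Half of it pays for the
   error term, the other half is the drop. *)
pose s := r0 / T; have s0 : 0 < s by rewrite divr_gt0.
have dl0 : 0 < s * r0 / 2 by apply: divr_gt0 => //; exact: mulr_gt0.
exists r0, (s * r0 / 2); split => // e e0.
have [n2 h2] := iterate_descent dl0 (ltW T0) (ltW s0).
(* With slope 0 the estimate says that [F] rises by at most [e] anywhere in the window. *)
have [n3 h3] := iterate_descent e0 (ltW T0) (lexx 0).
exists (maxn n1 (maxn n2 n3)) => n; rewrite !geq_max => /and3P[n1n n2n n3n] xz.
have [j [jT xj]] := h1 _ n1n xz; exists j; split; last first.
  move=> i ij; have := h3 n i n3n (le_trans (gam_sum_mono n ij) jT).
  by rewrite mulr0 mul0r subr0 expr0n mul0r addr0.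
apply: (le_trans (h2 _ _ n2n jT)).
have sT : s ^+ 2 * T = s * r0 by rewrite expr2 -mulrA divfK// gt_eqF.
have : r0 <= enorm (x (n + j)%N - x n).
  have := ler_enorm_triangle (x (n + j)%N) (x n) z; lra.
by rewrite -(ler_pM2l s0); lra.
Qed.

Lemma iterate_slow e : 0 < e -> exists n0, forall n, (n0 <= n)%N ->
  enorm (x n.+1 - x n) < e.
Proof.
move=> e0; have e4 : 0 < e / 4 by rewrite divr_gt0.
have [C C0 [n1 gC]] := g_bounded.
have [n2 h2] := cvg0_lt r_cvg0 e4.
have [n3 h3] := cvg0_lt gam_cvg0 (divr_gt0 e4 C0).
have [n4 h4] := cvg0_lt (cvg_series_cvg_0 v_series) (exprn_gt0 2 e4).
exists (maxn (maxn n1 n2) (maxn n3 n4)) => n.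
rewrite !geq_max => /andP[/andP[n1n n2n] /andP[n3n n4n]].
rewrite x_step (_ : _ - x n = (gam n *: g n - gam n *: v n) + (r n - r n.+1)).
  have hr k : (n2 <= k)%N -> enorm (r k) < e / 4.
    by move=> /h2; exact: le_lt_trans (ler_norm _).
  have hg : enorm (gam n *: g n) < e / 4.
    rewrite enormZ gtr0_norm//; have := gC _ n1n => gnC.
    have := h3 _ n3n; rewrite gtr0_norm// ltr_pdivlMr//; apply: le_lt_trans.
    by rewrite ler_pM2l.
  have hv : enorm (gam n *: v n) < e / 4.
    rewrite enormZ gtr0_norm// -ltr_sqr ?nnegrE ?(ltW e4)//.
      by apply: le_lt_trans (h4 _ n4n); exact: ler_norm.
    by rewrite mulr_ge0 ?enorm_ge0// ltW.
  have := ler_enormD (gam n *: g n - gam n *: v n) (r n - r n.+1).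
  have := ler_enormB (gam n *: g n) (gam n *: v n).
  have := ler_enormB (r n) (r n.+1).
  by have := hr _ n2n; have := hr _ (leq_trans n2n (leqnSn n)); lra.
by apply/colP => i; rewrite !mxE; ring.
Qed.

(** Consider the last index with [F <= c] before each passage to [c']. A cluster point [z] of the
    iterates at these indices has [F z = c], so it is not KKT, and [KKT_drop] forces a fall below
    [c] before [c'] is reached. *)
Lemma no_upcrossing c c' : ~ (F @` KKT F G) c -> c < c' ->
  (forall n0, exists2 n, (n0 <= n)%N & F (x n) <= c) ->
  ~ (forall n0, exists2 n, (n0 <= n)%N & c' <= F (x n)).
Proof.
move=> cL cc' Hc Hc'.
have [|z Gz zc] := @subseq_cluster _ _ _ _ G_compact xG (fun n => F (x n) <= c /\
    exists m, [/\ (n < m)%N, c' <= F (x m) &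
      forall k, (n < k <= m)%N -> c < F (x k)]).
  move=> n0; have [n1 n01 xn1] := Hc n0; have [m n1m xm] := Hc' n1.
  pose P k := (k <= m)%N && (F (x k) <= c).
  have exP : exists k, P k by exists n1; rewrite /P n1m.
  have Pm k : P k -> (k <= m)%N by case/andP.
  have := ex_maxnP exP Pm => -[n /andP[nm xn] nmax].
  exists n; first by rewrite (leq_trans n01)// nmax// /P n1m.
  split => //; exists m; split => //.
    rewrite ltn_neqAle nm andbT; apply/eqP => nm'; move: xm; rewrite -nm'.
    by rewrite leNgt (le_lt_trans xn).
  move=> k /andP[nk km]; rewrite ltNge; apply/negP => xk.
  by have := nmax k; rewrite /P km xk => /(_ isT); rewrite leqNgt nk.
have Fz : F z = c.
  have Fcts := real_cts (@C1_continuous _ _ _ F1 z).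
  apply/le_anti/andP; split; apply/ler_addgt0Pr => e e0.
    have [r0 r00 hr0] := Fcts _ e0; have [n [_ [xn _] xz]] := zc _ r00 0%N.
    have := hr0 (x n); rewrite enormB => /(_ xz); rewrite ltr_norml; lra.
  (* The iterate at [n.+1] already exceeds the level [c] and, the steps being short, is close to [z]
     too; hence [c <= F z]. *)
  have [r0 r00 hr0] := Fcts _ e0; have r20 : 0 < r0 / 2 by rewrite divr_gt0.
  have [n1 h1] := iterate_slow r20.
  have [n [n1n [_ [m [nm _ xm]]] xz]] := zc _ r20 n1.
  have := hr0 (x n.+1); rewrite enormB => /(_ _)/wrap[].
    have := h1 _ n1n; have := ler_enorm_triangle (x n.+1) (x n) z; lra.
  by have := xm n.+1; rewrite ltnSn nm ltr_norml => /(_ isT); lra.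
have zL : ~ KKT F G z by move=> zL; apply: cL; exists z.
have [r0 [dl [r00 dl0 H]]] := KKT_drop Gz zL.
have e0 : 0 < (c' - c) / 2 by rewrite divr_gt0// subr_gt0.
have [n1 h1] := H _ e0.
have [n [n1n [xn [m [nm xm mid]]] xz]] := zc _ r00 n1.
have [j [xj xi]] := h1 _ n1n xz.
(* If the passage to [c'] lies within the window, it rises by more than the allowed [(c' - c) / 2].
   If not, the drop happens between [n] and [m], where [F] exceeds [c]. *)
have [mj|jm] := leqP m (n + j).
  by have := xi (m - n)%N; rewrite leq_subLR mj subnKC ?(ltnW nm)// => /(_ isT); lra.
have [j0|j0] := posnP j; first by move: xj; rewrite j0 addn0; lra.
have := mid (n + j)%N; rewrite (ltnW jm) andbT -[X in (X < _)%N]addn0 ltn_add2l j0.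
by move=> /(_ isT); lra.
Qed.

Hypothesis KKT_values : (F @` KKT F G)° = set0.

Lemma cluster_KKT z : G z -> cluster_point x z -> KKT F G z.
Proof.
move=> Gz zc; apply: contrapT => zL.
have [r0 [dl [r00 dl0 H]]] := KKT_drop Gz zL.
have Fcts := real_cts (@C1_continuous _ _ _ F1 z).
have dl4 : 0 < dl / 4 by rewrite divr_gt0.
have [r1 r10 hr1] := Fcts _ dl4.
(* Visits near [z] have [F] within [dl / 4] of [F z], and the drop [dl] takes it to at most
   [F z - 3 * dl / 4]. Both bounds of the interval come from there; [KKT_values] supplies a
   noncritical level inside. *)
have [c /andP[clo chi] cL] : exists2 c, F z - 3 * dl / 4 < c < F z - dl / 4 &
    ~ (F @` KKT F G) c.
  apply: contrapT => Hc.
  have : (F @` KKT F G)° (F z - dl / 2).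
    exists (dl / 4) => //= c; rewrite /ball/= ltr_norml => hc.
    by apply: contrapT => cL; apply: Hc; exists c => //; lra.
  by rewrite KKT_values.
have [n1 h1] := H _ dl4.
apply: (@no_upcrossing c (F z - dl / 4) cL chi).
- move=> n0; have r20 : 0 < Num.min r0 r1 by rewrite lt_min r00.
  have [n] := zc _ r20 (maxn n0 n1); rewrite geq_max => /andP[n0n n1n].
  rewrite lt_min => /andP[xr0 xr1]; have [j [xj _]] := h1 _ n1n xr0.
  exists (n + j)%N; first by rewrite (leq_trans n0n)// leq_addr.
  by have := hr1 (x n); rewrite enormB ltr_norml => /(_ xr1); lra.
- move=> n0; have [n n0n xn] := zc _ r10 n0; exists n => //.
  by have := hr1 (x n); rewrite enormB ltr_norml => /(_ xn); lra.
Qed.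

End projected_euler.

(** * Integration, filtrations and martingales *)

Section expectation.
Context {R : realType} {disp : measure_display} {T : measurableType disp}
  (P : probability T R).
Implicit Types (X Y : T -> R).

Definition rint X : Prop := P.-integrable setT (EFin \o X).
(** [fine] sends an infinite integral to 0, hence the rules below are stated under [rint]. *)
Definition Ex X : R := fine (\int[P]_w (X w)%:E).

Lemma rint_measurable X : rint X -> measurable_fun setT X.
Proof. by move=> /measurable_int /measurable_EFinP. Qed.

Lemma ExE X : rint X -> (Ex X)%:E = (\int[P]_w (X w)%:E)%E.
Proof. by move=> iX; rewrite fineK//; exact: integrable_fin_num. Qed.

Lemma rintD X Y : rint X -> rint Y -> rint (fun w => X w + Y w).
Proof. by move=> iX iY; exact: (integrableD measurableT iX iY). Qed.

Lemma rintZ (c : R) X : rint X -> rint (fun w => c * X w).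
Proof. by move=> iX; exact: (integrableZl measurableT c iX). Qed.

Lemma rintB X Y : rint X -> rint Y -> rint (fun w => X w - Y w).
Proof. by move=> iX iY; exact: (integrableB measurableT iX iY). Qed.

Lemma rint_cst (c : R) : rint (fun=> c).
Proof. exact: finite_measure_integrable_cst. Qed.

Lemma rint_sum I (s : seq I) (X : I -> T -> R) : (forall i, rint (X i)) ->
  rint (fun w => \sum_(i <- s) X i w).
Proof.
move=> iX; elim: s => [|i s IH].
  by under eq_fun do rewrite big_nil; exact: rint_cst.
by under eq_fun do rewrite big_cons; exact: rintD.
Qed.

Lemma ExD X Y : rint X -> rint Y -> Ex (fun w => X w + Y w) = Ex X + Ex Y.
Proof.
move=> iX iY; apply: EFin_inj; rewrite EFinD !ExE//; last exact: rintD.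
by rewrite -integralD.
Qed.

Lemma ExZ (c : R) X : rint X -> Ex (fun w => c * X w) = c * Ex X.
Proof.
move=> iX; apply: EFin_inj; rewrite EFinM !ExE//; last exact: rintZ.
by rewrite -integralZl.
Qed.

Lemma ExB X Y : rint X -> rint Y -> Ex (fun w => X w - Y w) = Ex X - Ex Y.
Proof.
move=> iX iY; apply: EFin_inj; rewrite EFinB !ExE//; last exact: rintB.
by rewrite -integralB.
Qed.

Lemma Ex_cst (c : R) : Ex (fun=> c) = c.
Proof.
rewrite /Ex (_ : (fun=> c%:E) = cst c%:E)// integral_cst//.
by rewrite [X in (_ * X)%E](_ : _ = 1%E) ?mule1//; exact: probability_setT.
Qed.

Lemma Ex_sum I (s : seq I) (X : I -> T -> R) : (forall i, rint (X i)) ->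
  Ex (fun w => \sum_(i <- s) X i w) = \sum_(i <- s) Ex (X i).
Proof.
move=> iX; elim: s => [|i s IH].
  by under [in LHS]eq_fun do rewrite big_nil; rewrite Ex_cst big_nil.
under [in LHS]eq_fun do rewrite big_cons.
by rewrite ExD ?big_cons ?IH//; exact: rint_sum.
Qed.

Lemma Ex_eq_ae X Y : measurable_fun setT X -> measurable_fun setT Y ->
  {ae P, forall w, X w = Y w} -> Ex X = Ex Y.
Proof.
move=> mX mY XY; congr fine; apply: ae_eq_integral => //.
- exact/measurable_EFinP.
- exact/measurable_EFinP.
- by apply: filterS XY => w /= ->.
Qed.

Lemma rint_le_ae X Y : measurable_fun setT X -> rint Y ->
  {ae P, forall w, `|X w| <= Y w} -> rint X.
Proof.
move=> mX iY XY; apply/integrableP; split; first exact/measurable_EFinP.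
have /integrableP[_] := iY; apply: le_lt_trans.
apply: ae_ge0_le_integral => //.
- by do 2 apply: measurableT_comp => //.
- by do 2 apply: measurableT_comp => //; exact: rint_measurable.
- by apply: filterS XY => w /= XYw _; rewrite lee_fin (le_trans XYw)// ler_norm.
Qed.

Lemma rint_bounded_ae X (M : R) : measurable_fun setT X ->
  {ae P, forall w, `|X w| <= M} -> rint X.
Proof. by move=> mX; apply: rint_le_ae => //; exact: rint_cst. Qed.

Lemma Ex_ge0_ae X : rint X -> {ae P, forall w, 0 <= X w} -> 0 <= Ex X.
Proof.
move=> iX X0; have mX := rint_measurable iX.
rewrite (@Ex_eq_ae _ (fun w => `|X w|))//.
- by rewrite fine_ge0// integral_ge0.
- exact: measurableT_comp.
- by apply: filterS X0 => w /ger0_norm.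
Qed.

Lemma Ex_le_ae X Y : rint X -> rint Y -> {ae P, forall w, X w <= Y w} ->
  Ex X <= Ex Y.
Proof.
move=> iX iY XY; rewrite -subr_ge0 -ExB// Ex_ge0_ae//; first exact: rintB.
by apply: filterS XY => w; rewrite subr_ge0.
Qed.

Lemma rint_indic A : measurable A -> rint (\1_A).
Proof. by move=> mA; exact: integrable_indic. Qed.

Lemma Ex_indic A : measurable A -> Ex (\1_A) = fine (P A).
Proof. by move=> mA; rewrite /Ex integral_indic// setIT. Qed.

Lemma rintM_indic A X : measurable A -> rint X -> rint (fun w => \1_A w * X w).
Proof.
move=> mA iX; have mX := rint_measurable iX.
apply: (@rint_le_ae _ (fun w => `|X w|)).
- by apply: measurable_funM => //; exact: measurable_indic.
- exact: (integrable_abse iX).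
- by apply: aeW => w /=; rewrite normrM indicE; case: (_ \in _); rewrite ?normr1 ?normr0 ?mul1r ?mul0r.
Qed.

Lemma integral_setE A X : measurable A ->
  (\int[P]_(w in A) (X w)%:E = \int[P]_w (\1_A w * X w)%:E)%E.
Proof.
move=> mA; rewrite integral_mkcond; apply: eq_integral => w _.
by rewrite patchE indicE; case: ifP => _; rewrite ?mul1r ?mul0r.
Qed.

Lemma rintM_sqr X Y : measurable_fun setT X -> measurable_fun setT Y ->
  rint (fun w => X w ^+ 2) -> rint (fun w => Y w ^+ 2) ->
  rint (fun w => X w * Y w).
Proof.
move=> mX mY iX iY; apply: (rint_le_ae _ (rintD iX iY)).
  exact: measurable_funM.
apply: aeW => w; rewrite normrM -(real_normK (num_real (X w))).
rewrite -(real_normK (num_real (Y w))).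
have := sqr_ge0 (`|X w| - `|Y w|); have : 0 <= `|X w| * `|Y w| by [].
lra.
Qed.

Lemma ae_forall_ord n (Q : 'I_n -> T -> Prop) :
  (forall j, {ae P, forall w, Q j w}) -> {ae P, forall w, forall j, Q j w}.
Proof.
move=> HQ; have : {ae P, forall w, forall m (hm : (m < n)%N), Q (Ordinal hm) w}.
  apply: ae_foralln => m; have [hm|hm] := pselect (m < n)%N.
    by apply: filterS (HQ (Ordinal hm)) => w h hm'; rewrite (bool_irrelevance hm' hm).
  by apply: aeW => w hm'.
by apply: filterS => w h [m hm]; exact: h.
Qed.

End expectation.

Import HBNNSimple.

(** * Measurability and orthogonality relative to a sub-sigma-algebra *)

Section sub_sigma_algebra.
Context {R : realType} {disp : measure_display} {T : measurableType disp}
  (P : probability T R).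
Implicit Types (F : set (set T)) (X phi : T -> R).

Definition sub_sigma F : Prop := sigma_algebra setT F /\ F `<=` measurable.

(** Stated through preimages, so that several sigma-algebras on the same [T] can be compared;
    [FmeasP] gives access to the closure properties of measurable functions. *)
Definition Fmeas F {d} {T' : measurableType d} (h : T -> T') : Prop :=
  forall B, measurable B -> F (h @^-1` B).

Lemma measurable_in F (A : set T) : sub_sigma F ->
  @measurable _ (g_sigma_algebraType F) A -> F A.
Proof.
by move=> [sF _] mA; have : <<s F>> A by []; rewrite sigma_algebra_id.
Qed.

Lemma FmeasP F d (T' : measurableType d) (h : T -> T') : sub_sigma F ->
  Fmeas F h <-> measurable_fun setT (h : g_sigma_algebraType F -> T').
Proof.
move=> sF; split => mh.
  by move=> _ B mB; rewrite setTI; apply: sub_sigma_algebra; exact: mh.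
move=> B mB; apply: measurable_in => //; rewrite -[_ @^-1` _]setTI.
exact: (mh measurableT B mB).
Qed.

Lemma Fmeas_measurable F d (T' : measurableType d) (h : T -> T') :
  sub_sigma F -> Fmeas F h -> measurable_fun setT h.
Proof. by move=> [_ sF] mh _ B mB; rewrite setTI; exact/sF/mh. Qed.

Lemma Fmeas_cst F (c : R) : sub_sigma F -> Fmeas F (fun=> c).
Proof. by move=> sF; apply/FmeasP. Qed.

Lemma FmeasD F (h k : T -> R) : sub_sigma F -> Fmeas F h -> Fmeas F k ->
  Fmeas F (fun w => h w + k w).
Proof.
move=> sF /(FmeasP _ sF) mh /(FmeasP _ sF) mk; apply/FmeasP => //.
exact: measurable_funD.
Qed.

Lemma FmeasB F (h k : T -> R) : sub_sigma F -> Fmeas F h -> Fmeas F k ->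
  Fmeas F (fun w => h w - k w).
Proof.
move=> sF /(FmeasP _ sF) mh /(FmeasP _ sF) mk; apply/FmeasP => //.
exact: measurable_funB.
Qed.

Lemma FmeasM F (h k : T -> R) : sub_sigma F -> Fmeas F h -> Fmeas F k ->
  Fmeas F (fun w => h w * k w).
Proof.
move=> sF /(FmeasP _ sF) mh /(FmeasP _ sF) mk; apply/FmeasP => //.
exact: measurable_funM.
Qed.

Lemma Fmeas_sum F I (s : seq I) (h : I -> T -> R) : sub_sigma F ->
  (forall i, Fmeas F (h i)) -> Fmeas F (fun w => \sum_(i <- s) h i w).
Proof.
move=> sF mh; elim: s => [|i s IH].
  by under eq_fun do rewrite big_nil; exact: Fmeas_cst.
by under eq_fun do rewrite big_cons; exact: FmeasD.
Qed.

Lemma Fmeas_indic F (A : set T) : sub_sigma F -> F A -> Fmeas F (\1_A : T -> R).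
Proof.
move=> sF FA; apply/FmeasP => //.
have mA : @measurable _ (g_sigma_algebraType F) A by exact: sub_sigma_algebra.
exact: measurable_indic.
Qed.

Lemma Fmeas_comp F d1 d2 (T1 : measurableType d1) (T2 : measurableType d2)
    (h : T -> T1) (g : T1 -> T2) :
  measurable_fun setT g -> Fmeas F h -> Fmeas F (g \o h).
Proof. by move=> mg mh B mB; have := mh _ (mg measurableT B mB); rewrite setTI. Qed.

Let ortho_ge0 F X phi : sub_sigma F -> rint P X ->
  (forall A, F A -> (\int[P]_(w in A) (X w)%:E = 0)%E) ->
  Fmeas F phi -> (forall w, 0 <= phi w) -> rint P (fun w => phi w * X w) ->
  (\int[P]_w (phi w * X w)%:E = 0)%E.
Proof.
move=> sF iX X0 mphi phi0 iphiX.
have mX := rint_measurable iX.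
have mphiT := Fmeas_measurable sF mphi.
have [saF FT] := sF.
pose TF := g_sigma_algebraType F.
have mphiF : measurable_fun [set: TF] (EFin \o phi : TF -> \bar R).
  exact/measurable_EFinP/(FmeasP _ sF).
(* Approximating on [TF] instead of [T] puts the level sets of [s n] in [F], where [X] integrates to
   zero. Dominated convergence concludes. *)
pose s := nnsfun_approx measurableT mphiF.
have Fs n : Fmeas F (s n : T -> R).
  move=> B mB; have := measurable_funPT (s n) measurableT B mB.
  by rewrite setTI => /(measurable_in sF).
have s0 n : (\int[P]_w (s n w * X w)%:E = 0)%E.
  have mA y : F (s n @^-1` [set y]).
    exact: Fs.
  have -> : (fun w => (s n w * X w)%:E) = (fun w =>
     \sum_(y <- fset_set (range (s n))) (y * (\1_(s n @^-1` [set y]) w * X w))%:E)%E.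
    apply/funext => w; rewrite sumEFin; congr EFin.
    rewrite fimfunE fsbig_finite//= mulr_suml; apply: eq_bigr => y _.
    by rewrite mulrA.
  rewrite integral_sum//; last first.
    move=> y; apply: rintZ; apply: rintM_indic => //; exact/FT/mA.
  rewrite big1// => y _; under eq_integral do rewrite EFinM.
  rewrite integralZl//; last by apply: rintM_indic => //; exact/FT/mA.
  by rewrite -integral_setE ?X0 ?mule0//; exact/FT/mA.
have ms n : measurable_fun [set: T] (s n).
  by move=> _ B mB; rewrite setTI; apply/FT/Fs.
have sphi n w : s n w <= phi w.
  have nd := nd_nnsfun_approx measurableT mphiF.
  have cv := cvg_nnsfun_approx measurableT mphiF (fun w _ => phi0 w) (I : setT w).
  have cv' : (s ^~ w @ \oo) --> phi w by exact: fine_cvg cv.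
  have nd' : nondecreasing_seq (s ^~ w) by move=> a b ab; exact/lefP/nd.
  have := nondecreasing_cvgn_le nd' (cvgP _ cv') n.
  by rewrite (cvg_lim (@Rhausdorff R) cv').
have is0 : (fun n => \int[P]_w (s n w * X w)%:E)%E = cst 0%E by exact/funext/s0.
suff : (fun n => \int[P]_w (s n w * X w)%:E)%E @ \oo -->
    (\int[P]_w (phi w * X w)%:E)%E.
  by rewrite is0 => /cvg_lim <-//; rewrite lim_cst.
apply: (@dominated_cvg _ T R P setT measurableT (fun n w => (s n w * X w)%:E)
  (fun w => (phi w * X w)%:E) (fun w => `|phi w * X w|%:E)) => //.
- by move=> n; apply/measurable_EFinP; exact: measurable_funM.
- move=> w _; have cv := cvg_nnsfun_approx measurableT mphiF (fun w _ => phi0 w) (I : setT w).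
  apply: cvg_EFin; first exact: nearW.
  by apply: cvgM; [exact: fine_cvg cv|exact: cvg_cst].
- exact: (integrable_abse iphiX).
- move=> n w _; rewrite lee_fin !normrM ler_wpM2r// !ger0_norm ?phi0//.
Qed.

(** The working form of conditional centring: zero integrals over the sets of [F] extend to all
    [F]-measurable test functions, through their positive and negative parts. *)
Lemma Ex_ortho F X phi : sub_sigma F -> rint P X ->
  (forall A, F A -> (\int[P]_(w in A) (X w)%:E = 0)%E) ->
  Fmeas F phi -> rint P (fun w => phi w * X w) -> Ex P (fun w => phi w * X w) = 0.
Proof.
move=> sF iX X0 mphi iphiX.
have phiF : measurable_fun setT (phi : g_sigma_algebraType F -> R) by exact/FmeasP.
have mphiX := rint_measurable iphiX.
have mX := rint_measurable iX.
have hp : Fmeas F (phi^\+) by apply/FmeasP => //; exact: measurable_funrpos.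
have hn : Fmeas F (phi^\-) by apply/FmeasP => //; exact: measurable_funrneg.
have ip : rint P (fun w => phi^\+ w * X w).
  apply: (rint_le_ae _ (integrable_abse iphiX)).
    by apply: measurable_funM => //; exact: Fmeas_measurable hp.
  apply: aeW => w /=; rewrite !normrM ler_wpM2r// /funrpos.
  by rewrite ger0_norm ?le_max ?lexx ?orbT// ge_max ler_norm normr_ge0.
have im : rint P (fun w => phi^\- w * X w).
  apply: (rint_le_ae _ (integrable_abse iphiX)).
    by apply: measurable_funM => //; exact: Fmeas_measurable hn.
  apply: aeW => w /=; rewrite !normrM ler_wpM2r// /funrneg.
  by rewrite ger0_norm ?le_max ?lexx ?orbT// ge_max -{1}normrN ler_norm normr_ge0.
have -> : (fun w => phi w * X w) = (fun w => phi^\+ w * X w - phi^\- w * X w).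
  by apply/funext => w; rewrite -mulrBl -{1}(funrposBneg phi).
rewrite ExB// /Ex !(ortho_ge0 sF)// ?subrr//.
Qed.

End sub_sigma_algebra.

(** * Almost sure convergence of series and of square-integrable martingales *)

Section almost_sure_series.
Context {R : realType} {disp : measure_display} {T : measurableType disp}
  (P : probability T R).
Implicit Types (F : set (set T)).
Local Notation Ex := (Ex P).
Local Notation rint := (rint P).

(** By monotone convergence the sum of the series is integrable, hence almost surely finite. *)
Lemma ae_cvg_series (X : nat -> T -> R) (M : R) :
  (forall k, rint (X k)) -> (forall k w, 0 <= X k w) ->
  (forall n, \sum_(0 <= k < n) Ex (X k) <= M) ->
  {ae P, forall w, cvgn (series (fun k => X k w))}.
Proof.
move=> iX X0 XM.
have mX k : measurable_fun setT (fun w => (X k w)%:E).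
  exact/measurable_EFinP/rint_measurable.
have X0' k w : (0 <= (X k w)%:E)%E by rewrite lee_fin.
pose S w := (\sum_(k <oo) (X k w)%:E)%E.
have mS : measurable_fun setT S by apply: ge0_emeasurable_sum => //.
have S0 w : (0 <= S w)%E by exact: nneseries_ge0.
have iS : P.-integrable setT S.
  apply/integrableP; split => //.
  rewrite (eq_integral S); last by move=> w _; rewrite gee0_abs.
  rewrite integral_nneseries//; apply: (@le_lt_trans _ _ M%:E); last exact: ltry.
  apply: lime_le.
    by apply: is_cvg_nneseries => k _ _; exact: integral_ge0.
  apply: nearW => n; rewrite (eq_bigr (fun k => (Ex (X k))%:E)).
    by rewrite sumEFin lee_fin.
  by move=> k _; rewrite ExE.
apply: filterS (integrable_ae measurableT iS) => w /(_ I) Sfin.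
apply: nondecreasing_is_cvgn.
  apply/nondecreasing_seqP => n; rewrite /series/= big_nat_recr//=.
  by rewrite lerDl.
exists (fine (S w)) => _ [n _ <-].
rewrite -lee_fin fineK// /series/= -sumEFin.
exact: nneseries_lim_ge.
Qed.

Section martingale.
Context (F : nat -> set (set T)) (X : nat -> T -> R) (M : R).
Hypothesis F_sigma : forall k, sub_sigma (F k).
Hypothesis F_le : forall k, F k `<=` F k.+1.
Hypothesis X_meas : forall k, Fmeas (F k.+1) (X k).
Hypothesis X_sqr : forall k, rint (fun w => X k w ^+ 2).
Hypothesis X_center : forall k A, F k A -> (\int[P]_(w in A) (X k w)%:E = 0)%E.
Hypothesis X_bound : forall n, \sum_(0 <= k < n) Ex (fun w => X k w ^+ 2) <= M.

Let S n j w : R := \sum_(n <= k < n + j) X k w.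

Let sum_recr (a : nat -> R) n j :
  \sum_(n <= k < n + j.+1) a k = \sum_(n <= k < n + j) a k + a (n + j)%N.
Proof. by rewrite addnS big_nat_recr//= leq_addr. Qed.

Let below (e : R) n j : set T := [set w | forall i, (i <= j)%N -> `|S n i w| < e].

(* Freezing the partial sums once they reach [e] turns the maximal inequality
   into a second moment computation. *)
Let stopped (e : R) n := fix stopped j w : R :=
  if j is i.+1 then stopped i w + \1_(below e n i) w * X (n + i)%N w else 0.

Let F_mono n m : (n <= m)%N -> F n `<=` F m.
Proof.
move=> nm; rewrite -(subnKC nm); elim: (m - n)%N => [|k IH]; first by rewrite addn0.
by rewrite addnS; exact: subset_trans (@F_le _).
Qed.

Let Fmeas_mono n m (h : T -> R) : (n <= m)%N -> Fmeas (F n) h -> Fmeas (F m) h.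
Proof. by move=> nm mh B mB; exact/(F_mono nm)/mh. Qed.

Let S_meas n j : Fmeas (F (n + j)%N) (S n j).
Proof.
elim: j => [|j IH].
  rewrite /S; under eq_fun do rewrite addn0 big_geq//; exact: Fmeas_cst.
rewrite /S; under eq_fun do rewrite sum_recr.
apply: FmeasD => //; last by rewrite addnS; exact: X_meas.
by apply: Fmeas_mono IH; rewrite leq_add2l.
Qed.

Let below_meas e n j : F (n + j)%N (below e n j).
Proof.
have mS k : F (n + k)%N [set w | `|S n k w| < e].
  have mabs : measurable_fun [set: R] (fun x : R => `|x|) by exact: normr_measurable.
  have := Fmeas_comp mabs (@S_meas n k) (measurable_itv `]-oo, e[).
  by rewrite /preimage/=; under eq_fun do rewrite in_itv.
elim: j => [|j IH].
  rewrite (_ : below e n 0 = [set w | `|S n 0%N w| < e]); first exact: mS.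
  apply/seteqP; split => w /=; first exact.
  by move=> h i; rewrite leqn0 => /eqP ->.
rewrite (_ : below e n j.+1 = below e n j `&` [set w | `|S n j.+1 w| < e]).
  have sF := F_sigma (n + j.+1)%N; apply: (measurable_in sF).
  apply: measurableI; apply: sub_sigma_algebra; last exact: mS.
  by apply: F_mono IH; rewrite leq_add2l.
apply/seteqP; split => w /= => [h|[h1 h2] i].
  by split => [i ij|]; apply: h => //; exact: leq_trans (leqnSn j).
by rewrite leq_eqVlt => /predU1P[->//|]; exact: h1.
Qed.

Let stoppedS e n j w : stopped e n j.+1 w =
  stopped e n j w + \1_(below e n j) w * X (n + j)%N w.
Proof. by []. Qed.

(** Up to the first exit nothing is frozen; afterwards the value is the one reached at the exit,
    which is at least [e]. *)
Let stoppedE e n j w : 0 < e ->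
  (below e n j w -> stopped e n j w = S n j w) /\
  (~ below e n j w -> e <= `|stopped e n j w|).
Proof.
move=> e0; elim: j => [|j [IH1 IH2]].
  have S0 : S n 0 w = 0 by rewrite /S addn0 big_geq.
  split => [_|]; first by rewrite S0.
  by case => i; rewrite leqn0 => /eqP ->; rewrite S0 normr0.
have SS : S n j.+1 w = S n j w + X (n + j)%N w by rewrite /S sum_recr.
rewrite stoppedS indicE; case: (pselect (below e n j w)) => [bj|bj].
  rewrite mem_set// mul1r IH1// -SS; split => // nb.
  rewrite leNgt; apply/negP => h; apply: nb => i.
  by rewrite leq_eqVlt => /predU1P[->//|]; exact: bj.
rewrite memNset// mul0r addr0; split => [b|_]; last exact: IH2.
by exfalso; apply: bj => i ij; apply: b; exact: leq_trans (leqnSn j).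
Qed.

Let X_measT k : measurable_fun setT (X k).
Proof. exact: Fmeas_measurable (X_meas k). Qed.

Let X_int k : rint (X k).
Proof.
apply: (rint_le_ae _ (rintD (rint_cst P 1) (X_sqr k))) => //.
by apply: aeW => w; rewrite -(real_normK (num_real (X k w))); have := sqr_ge0 (`|X k w| - 1); have := normr_ge0 (X k w); lra.
Qed.

Let stopped_sqr e n j : Fmeas (F (n + j)%N) (stopped e n j) /\
  rint (fun w => stopped e n j w ^+ 2) /\
  Ex (fun w => stopped e n j w ^+ 2) <=
  \sum_(n <= k < n + j) Ex (fun w => X k w ^+ 2).
Proof.
elim: j => [|j [mV [iV IH]]].
  split; first exact: Fmeas_cst.
  split; first by apply: (@rint_cst _ _ _ _ (0 ^+ 2)).
  by rewrite addn0 big_geq// (@Ex_cst _ _ _ _ (0 ^+ 2)) expr0n.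
set V := stopped e n j in mV iV IH *; set B := below e n j.
set Xj := X (n + j)%N.
have FB : F (n + j)%N B := below_meas e n j.
have mB : measurable B by exact: (F_sigma (n + j)).2.
have mVT : measurable_fun setT V by exact: Fmeas_measurable mV.
have m1B : measurable_fun setT (\1_B : T -> R) by exact: measurable_indic.
have F1V : Fmeas (F (n + j)%N) (fun w => \1_B w * V w).
  by apply: FmeasM => //; exact: Fmeas_indic.
have iVX : rint (fun w => V w * Xj w) by exact: rintM_sqr (X_sqr _).
have i1VX : rint (fun w => \1_B w * V w * Xj w).
  by under eq_fun do rewrite -mulrA; exact: rintM_indic.
have i1X2 : rint (fun w => \1_B w * Xj w ^+ 2) by exact: rintM_indic mB (X_sqr _).
have sqrE : (fun w => stopped e n j.+1 w ^+ 2) = (fun w =>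
    V w ^+ 2 + (2 * (\1_B w * V w * Xj w) + \1_B w * Xj w ^+ 2)).
  apply/funext => w; rewrite stoppedS -/V -/B -/Xj indicE.
  by case: (_ \in _) => /=; rewrite ?mul1r ?mul0r; ring.
split.
  apply: FmeasD => //; first by apply: Fmeas_mono mV; rewrite leq_add2l.
  apply: FmeasM => //; last by rewrite addnS; exact: X_meas.
  by apply: Fmeas_mono (Fmeas_indic _ FB) => //; rewrite leq_add2l.
rewrite sqrE; split; first by apply: rintD => //; apply: rintD => //; exact: rintZ.
rewrite ExD//; last by apply: rintD => //; exact: rintZ.
rewrite ExD//; last exact: rintZ.
rewrite ExZ// (Ex_ortho (F_sigma (n + j)) (X_int _) (X_center (k := n + j)) F1V)//.
rewrite mulr0 add0r sum_recr lerD//; apply: Ex_le_ae => //.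
apply: aeW => w; rewrite indicE; case: (_ \in _) => /=; rewrite ?mul1r ?mul0r ?sqr_ge0//.
Qed.

(** Kolmogorov's maximal inequality, obtained as Chebyshev's inequality for the stopped sum. *)
Let cheb e n j : 0 < e -> e ^+ 2 * fine (P (~` below e n j)) <=
  \sum_(n <= k < n + j) Ex (fun w => X k w ^+ 2).
Proof.
move=> e0; have [_ [iV]] := stopped_sqr e n j; apply: le_trans.
have mB : measurable (~` below e n j).
  by apply: measurableC; exact: (F_sigma (n + j)).2.
rewrite -Ex_indic// -ExZ; last exact: rint_indic.
apply: Ex_le_ae => //; first exact/rintZ/rint_indic.
apply: aeW => w; rewrite indicE; have [_ h] := stoppedE n j w e0.
have [/set_mem/= wB|_] := boolP (w \in _); last by rewrite mulr0 sqr_ge0.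
rewrite mulr1 -(real_normK (num_real (stopped e n j w))).
by rewrite ler_sqr ?nnegrE ?(ltW e0)// h.
Qed.

Let exit_negligible (e : R) : 0 < e ->
  P.-negligible [set w | forall n, exists j, e <= `|S n j w|].
Proof.
move=> e0; pose E n := \bigcup_j ~` below e n j.
have mbj n j : measurable (~` below e n j).
  by apply: measurableC; exact: (F_sigma (n + j)).2.
have mE n : measurable (E n) by exact: bigcupT_measurable.
pose a k := Ex (fun w => X k w ^+ 2).
have a0 k : 0 <= a k by apply: Ex_ge0_ae => //; apply: aeW => w; exact: sqr_ge0.
have ca : cvgn (series a).
  apply: nondecreasing_is_cvgn; last by exists M => _ [n _ <-]; exact: X_bound.
  by apply/nondecreasing_seqP => n; rewrite /series/= big_nat_recr//= lerDl.
have PE (c : R) : 0 < c -> exists n, (P (E n) <= (c)%:E)%E.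
  move=> c0; have c1 : 0 < c * e ^+ 2 by rewrite mulr_gt0 ?exprn_gt0.
  (* With zero step sizes every window qualifies, so this is the Cauchy criterion for the second
     moments. *)
  have [n0 h0] := @window_negligible_series _ (fun=> 0) a a0 ca 0 _ c1.
  exists n0.
  have cvgE : P (~` below e n0 j) @[j --> \oo] --> P (E n0).
    apply: nondecreasing_cvg_mu; [exact: mbj|exact: mE|].
    move=> j k jk; apply/subsetPset => w /= nb b; apply: nb => i ij.
    by apply: b; exact: leq_trans jk.
  rewrite -(cvg_lim _ cvgE)//; apply: lime_le; first by apply/cvg_ex; exists (P (E n0)).
  apply: nearW => j; rewrite -[P _]fineK ?fin_num_measure// lee_fin.
  have e2 : 0 < e ^+ 2 by rewrite exprn_gt0.
  rewrite -(ler_pM2l e2) (le_trans (cheb n0 j e0))// mulrC h0//.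
  by rewrite big1.
exists (\bigcap_n E n); split.
- exact: bigcapT_measurable.
- apply/eqP; rewrite eq_le measure_ge0 andbT; apply/lee_addgt0Pr => c c0.
  rewrite add0e; have [n En] := PE c c0; apply: le_trans En.
  apply: le_measure; [apply/mem_set|exact/mem_set/mE|exact: bigcap_inf].
  exact: bigcapT_measurable.
- move=> w /= h n _; have [j ej] := h n; exists j => //= b.
  by have := b j (leqnn _); rewrite ltNge ej.
Qed.

(** The negligible events for the countably many levels [1 / (i + 1)] are discarded together; what
    remains is the Cauchy property. *)
Lemma ae_cvg_martingale : {ae P, forall w, cvgn (series (fun k => X k w))}.
Proof.
have H : {ae P, forall w, forall i, ~ forall n, exists j, i.+1%:R^-1 <= `|S n j w|}.
  apply: ae_foralln => i.
  have := @exit_negligible i.+1%:R^-1; rewrite invr_gt0 ltr0n => /(_ isT).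
  by apply: negligibleS => w /= /contrapT.
apply: filterS H => w H; apply/cauchy_cvgP/cauchy_seriesP => e e0.
have e20 : 0 < e / 2 by rewrite divr_gt0.
have [i ie] : exists i, i.+1%:R^-1 < e / 2.
  have [i _ h] := @near_infty_natSinv_lt R (PosNum e20).
  by exists i; apply: h => /=.
have [n hn] : exists n, forall j, `|S n j w| < e / 2.
  have /existsNP[n hn] := H i; exists n => j; rewrite ltNge; apply/negP => h.
  by apply: hn; exists j; rewrite (le_trans _ h)// ltW.
exists ([set m | (n <= m)%N], [set m | (n <= m)%N]) => /=.
  by split; exists n.
case=> m1 m2 /= [nm1 nm2].
have [m12|m21] := leqP m1 m2; last by rewrite big_geq ?normr0// ltnW.
have := hn (m1 - n)%N; have := hn (m2 - n)%N; rewrite /S !subnKC//.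
rewrite [\sum_(n <= k < m2) _](@big_cat_nat _ _ _ m1)//=.
set u := \sum_(n <= k < m1) _; set v := \sum_(m1 <= k < m2) _ => uv u1.
have := ler_normD (u + v) (- u); rewrite addrAC subrr add0r normrN; lra.
Qed.

End martingale.
End almost_sure_series.

(** * Stacked vectors and gossip matrices *)

Section matrix_measurability.
Context {R : realType}.

Lemma open_mx_measurable m n (U : set 'M[R]_(m, n)) : open U -> measurable U.
Proof. by move=> oU; exact: sub_sigma_algebra. Qed.

Lemma continuous_mx_measurable m n (h : 'M[R]_(m, n) -> R) :
  continuous h -> measurable_fun setT h.
Proof.
move=> /continuousP ch; apply: (measurability _ (RGenOpens.measurableE R)).
move=> _ [_ [a [b ->] <-]]; rewrite setTI; apply: open_mx_measurable.
exact/ch/interval_open.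
Qed.

Lemma continuous_mxmx_measurable m n m' n' (h : 'M[R]_(m, n) -> 'M[R]_(m', n')) :
  continuous h -> measurable_fun setT h.
Proof.
move=> /continuousP ch; apply: (measurability (@open 'M[R]_(m', n'))) => //.
by move=> _ [U oU <-]; rewrite setTI; apply: open_mx_measurable; exact: ch.
Qed.

Lemma coord_mx_measurable m n i j :
  measurable_fun setT (fun M : 'M[R]_(m, n) => M i j).
Proof. by apply: continuous_mx_measurable; exact: coord_continuous. Qed.

(* An open set of matrices is the countable union of the boxes with rational
   centers and radii [1 / k] that it contains. *)
Lemma measurable_mx_coord d (T : measurableType d) m n (h : T -> 'M[R]_(m, n)) :
  (forall i j, measurable_fun setT (fun w => h w i j)) -> measurable_fun setT h.
Proof.
move=> mh; apply: (measurability (@open 'M[R]_(m, n))) => //.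
move=> _ [U oU <-]; rewrite setTI.
pose box (ck : 'M[rat]_(m, n) * nat) : set 'M[R]_(m, n) :=
  [set M | forall i j, `|ratr (ck.1 i j) - M i j| < ck.2.+1%:R^-1].
pose V ck := if `[< box ck `<=` U >] then h @^-1` box ck else set0.
have -> : h @^-1` U = \bigcup_ck V ck.
  apply/seteqP; split => [w Uw|w [ck _]]; last first.
    by rewrite /V; case: asboolP => // bU; exact: bU.
  have [e /= e0 he] : exists2 e : R, 0 < e & ball (h w) e `<=` U.
    by apply/nbhs_ballP; exact: open_nbhs_nbhs.
  have e20 : 0 < e / 2 by rewrite divr_gt0.
  have [k ke] : exists k, k.+1%:R^-1 < e / 2.
    have [k _ hk] := @near_infty_natSinv_lt R (PosNum e20).
    by exists k; apply: hk => /=.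
  have k0 : 0 < k.+1%:R^-1 :> R by rewrite invr_gt0.
  have Hc (ij : 'I_m * 'I_n) : exists c : rat,
      `|ratr c - h w ij.1 ij.2| < k.+1%:R^-1 :> R.
    have [q] := @rat_in_itvoo R (h w ij.1 ij.2) (h w ij.1 ij.2 + k.+1%:R^-1)
      ltac:(by rewrite ltrDl).
    rewrite in_itv/= => /andP[q1 q2]; exists q.
    by rewrite gtr0_norm ?subr_gt0// ltrBlDl.
  have [c hc] := choice Hc.
  exists (\matrix_(i, j) c (i, j), k) => //; rewrite /V.
  have boxw : box (\matrix_(i, j) c (i, j), k) (h w).
    by move=> i j; rewrite /= mxE; exact: (hc (i, j)).
  case: asboolP => // nU; exfalso; apply: nU => M hM; apply: he.
  split => // i j; have := boxw i j; have := hM i j.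
  rewrite /ball/= mxE => h1 h2.
  have := ler_normD (h w i j - ratr (c (i, j))) (ratr (c (i, j)) - M i j).
  rewrite addrA subrK (distrC (h w i j) (ratr _)) => /le_lt_trans; apply.
  by rewrite [ltRHS]splitr ltrD// (lt_trans _ ke).
apply: countable_bigcupT_measurable; first exact: countableP.
move=> ck.
rewrite /V; case: asboolP => // _.
have -> : h @^-1` box ck = \bigcap_(ij in [set: 'I_m * 'I_n])
    [set w | `|ratr (ck.1 ij.1 ij.2) - h w ij.1 ij.2| < ck.2.+1%:R^-1].
  by apply/seteqP; split => [w hw [i j] _|w hw i j]; [exact: hw|exact: (hw (i, j))].
apply: fin_bigcap_measurable => // -[i j] _ /=.
have mg : measurable_fun [set: T] (fun w => `|ratr (ck.1 i j) - h w i j| : R).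
  apply: measurableT_comp; first exact: normr_measurable.
  by apply: measurable_funB => //; exact: mh.
have := mg measurableT `]-oo, (ck.2.+1%:R^-1)[%classic (measurable_itv _).
rewrite setTI; congr measurable; apply/seteqP; split => w /=; by rewrite in_itv.
Qed.

Lemma measurable_coord_mx d (T : measurableType d) m n (h : T -> 'M[R]_(m, n)) i j :
  measurable_fun setT h -> measurable_fun setT (fun w => h w i j).
Proof.
by move=> mh; apply: (measurableT_comp (f := fun M : 'M[R]_(m, n) => M i j)) => //; exact: coord_mx_measurable.
Qed.

Lemma measurable_mulmx d (T : measurableType d) m n p
    (h : T -> 'M[R]_(m, n)) (k : T -> 'M[R]_(n, p)) :
  measurable_fun setT h -> measurable_fun setT k ->
  measurable_fun setT (fun w => h w *m k w).
Proof.
move=> mh mk; apply: measurable_mx_coord => i j.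
under eq_fun do rewrite mxE.
apply: measurable_sum => l; apply: measurable_funM; exact: measurable_coord_mx.
Qed.

End matrix_measurability.

Lemma dotv_suml {R : realType} n I (s : seq I) (u : I -> 'cV[R]_n) v :
  dotv (\sum_(i <- s) u i) v = \sum_(i <- s) dotv (u i) v.
Proof.
elim: s => [|i s IH]; first by rewrite !big_nil dotvC dotv0r.
by rewrite !big_cons dotvDl IH.
Qed.

Lemma ler_enorm_bigsum {R : realType} n I (s : seq I) (u : I -> 'cV[R]_n) :
  enorm (\sum_(i <- s) u i) <= \sum_(i <- s) enorm (u i).
Proof.
elim: s => [|i s IH]; first by rewrite !big_nil enorm0.
by rewrite !big_cons (le_trans (ler_enormD _ _))// lerD2l.
Qed.

(** * Blocks, means and disagreements *)

Section block_algebra.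
Context {R : realType} {N d : nat}.
Implicit Types (x y z : 'cV[R]_(N * d)) (G : set 'cV[R]_d) (W : 'M[R]_N).

Lemma blockD x y i : block (x + y) i = block x i + block y i.
Proof. by apply/colP => k; rewrite !mxE. Qed.

Lemma blockN x i : block (- x) i = - block x i.
Proof. by apply/colP => k; rewrite !mxE. Qed.

Lemma blockZ (c : R) x i : block (c *: x) i = c *: block x i.
Proof. by apply/colP => k; rewrite !mxE. Qed.

Lemma block_ext x y : (forall i, block x i = block y i) -> x = y.
Proof.
move=> xy; apply/colP => k; case: (mxtens_indexP k) => i l.
by have /colP/(_ l) := xy i; rewrite !mxE.
Qed.

Lemma block_stack (u : 'I_N -> 'cV[R]_d) i : block (stack u) i = u i.
Proof. by apply/colP => k; rewrite !mxE mxtens_indexK. Qed.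

Lemma block_consensus (u : 'cV[R]_d) (i : 'I_N) : block (consensus u) i = u.
Proof.
apply/colP => k; rewrite !mxE mxtens_indexK/= mul1r.
by congr (u _ _); apply/ord1.
Qed.

Lemma sum_mxtens (a : 'I_(N * d) -> R) :
  \sum_j a j = \sum_i \sum_k a (mxtens_index (i, k)).
Proof.
rewrite pair_big; rewrite (reindex (@mxtens_index N d))/=.
  by apply: eq_bigr => -[i k].
by exists (@mxtens_unindex N d) => i _; rewrite (mxtens_indexK, mxtens_unindexK).
Qed.

Lemma block_tens W x i :
  block ((W *t (1%:M : 'M[R]_d)) *m x) i = \sum_j W i j *: block x j.
Proof.
apply/colP => k; rewrite !mxE sum_mxtens summxE; apply: eq_bigr => j _.
rewrite !mxE (bigD1 k)//= big1 => [|l lk].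
  by rewrite tensmxE !mxE eqxx mulr1 addr0.
by rewrite tensmxE !mxE eq_sym (negbTE lk) mulr0 mul0r.
Qed.

Lemma dotv_block x y : dotv x y = \sum_i dotv (block x i) (block y i).
Proof.
rewrite dotvE sum_mxtens; apply: eq_bigr => i _; rewrite dotvE.
by apply: eq_bigr => k _; rewrite !mxE.
Qed.

Lemma block_meanD x y : block_mean (x + y) = block_mean x + block_mean y.
Proof.
rewrite /block_mean -scalerDr -big_split/=; congr (_ *: _).
by apply: eq_bigr => i _; exact: blockD.
Qed.

Lemma block_meanN x : block_mean (- x) = - block_mean x.
Proof.
rewrite /block_mean -scalerN -sumrN; congr (_ *: _).
by apply: eq_bigr => i _; exact: blockN.
Qed.

Lemma block_meanZ (c : R) x : block_mean (c *: x) = c *: block_mean x.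
Proof.
rewrite /block_mean [RHS]scalerA mulrC -scalerA; congr (_ *: _).
rewrite scaler_sumr.
by apply: eq_bigr => i _; exact: blockZ.
Qed.

(** For [N > 0], the orthogonal projection onto the complement of the consensus subspace. *)
Definition disagr x := x - consensus (block_mean x).

Lemma block_disagr x i : block (disagr x) i = block x i - block_mean x.
Proof. by rewrite blockD blockN block_consensus. Qed.

Lemma disagrD x y : disagr (x + y) = disagr x + disagr y.
Proof.
apply: block_ext => i; rewrite blockD !block_disagr blockD block_meanD.
by rewrite opprD addrACA.
Qed.

Hypothesis N_gt0 : (0 < N)%N.

Let N_neq0 : N%:R != 0 :> R.
Proof. by rewrite pnatr_eq0 -lt0n. Qed.

Lemma sum_blockE x : \sum_i block x i = N%:R *: block_mean x.
Proof. by rewrite /block_mean scalerA mulfV// scale1r. Qed.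

Lemma dotv_consensus x (u : 'cV[R]_d) :
  dotv x (@consensus R N d u) = N%:R * dotv (block_mean x) u.
Proof.
rewrite dotv_block -dotvZl -sum_blockE dotv_suml.
by apply: eq_bigr => i _; rewrite block_consensus.
Qed.

Lemma enorm_disagr x : enorm (disagr x) <= enorm x.
Proof.
rewrite -ler_sqr ?nnegrE ?enorm_ge0// !enorm_sqr /disagr.
rewrite !dotv_lin (dotvC _ x) !dotv_consensus.
have -> : @block_mean R N d (consensus (block_mean x)) = block_mean x.
  rewrite {1}/block_mean; under eq_bigr do rewrite block_consensus.
  by rewrite sumr_const card_ord -(scaler_nat N (block_mean x)) scalerA mulVf// scale1r.
have : 0 <= N%:R * dotv (block_mean x) (block_mean x).
  by rewrite mulr_ge0// dotvv_ge0.
lra.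
Qed.

Lemma enorm_block x i : enorm (block x i) <= enorm x.
Proof.
rewrite -ler_sqr ?nnegrE ?enorm_ge0// !enorm_sqr [leRHS]dotv_block (bigD1 i)//=.
by rewrite lerDl sumr_ge0// => j _; exact: dotvv_ge0.
Qed.

Lemma enorm_block_mean x : enorm (block_mean x) <= enorm x.
Proof.
rewrite enormZ ger0_norm ?invr_ge0// ler_pdivrMl ?ltr0n//.
apply: (@le_trans _ _ (\sum_i enorm (block x i))).
  elim/big_ind2: _ => [|a b c e ab ce|//]; first by rewrite enorm0.
  by rewrite (le_trans (ler_enormD _ _))// lerD.
apply: (@le_trans _ _ (\sum_(i < N) enorm x)).
  by apply: ler_sum => i _; exact: enorm_block.
by rewrite sumr_const card_ord mulr_natl.
Qed.

(* A convex combination [u] of points of [G] is its own projection, since the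
   obtuse angle inequality can be averaged. *)
Lemma segment_closed_sum G (a : 'I_N -> R) (u : 'I_N -> 'cV[R]_d) :
  segment_closed G -> proximinal G -> (forall i, 0 <= a i) -> \sum_i a i = 1 ->
  (forall i, G (u i)) -> G (\sum_i a i *: u i).
Proof.
move=> Gc Gp a0 a1 Gu; set w := \sum_i _; set p := eproj G w.
suff -> : w = p by exact: eproj_in.
apply/eqP; rewrite -subr_eq0 -dotvv_eq0; apply/eqP/le_anti.
rewrite dotvv_ge0 andbT.
have -> : dotv (w - p) (w - p) = \sum_i a i * dotv (w - p) (u i - p).
  under eq_bigr do rewrite dotvC -dotvZl; rewrite -dotv_suml.
  congr (dotv _ _); rewrite {1}/w; under [RHS]eq_bigr do rewrite scalerBr.
  by rewrite sumrB -scaler_suml a1 scale1r.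
by apply: sumr_le0 => i _; rewrite mulr_ge0_le0//; exact: dotv_eproj_le0.
Qed.

Lemma set_power_convex G : segment_closed G -> segment_closed (@set_power R N d G).
Proof. by move=> Gc x y t Gx Gy t01 i; rewrite blockD !blockZ; exact: Gc. Qed.

(** Squared distances add up over the blocks, so nearest points may be chosen blockwise. *)
Lemma set_power_proximinal G : proximinal G -> proximinal (@set_power R N d G).
Proof.
move=> Gp x; exists (stack (fun i => eproj G (block x i))); split.
  by move=> i; rewrite block_stack; exact: eproj_in.
move=> z Gz; rewrite -ler_sqr ?nnegrE ?enorm_ge0// !enorm_sqr !dotv_block.
apply: ler_sum => i _; rewrite !(blockD, blockN) block_stack -!enorm_sqr.
by rewrite ler_sqr ?nnegrE ?enorm_ge0//; have [_] := eprojP (block x i) Gp; apply.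
Qed.

Lemma block_mean_in G x : segment_closed G -> proximinal G -> set_power G x ->
  G (block_mean x).
Proof.
move=> Gc Gp Gx; rewrite /block_mean scaler_sumr; apply: segment_closed_sum => //.
by rewrite sumr_const card_ord -[_ *+ N]mulr_natl mulfV.
Qed.

Lemma row_sumE W : W *m (const_mx 1 : 'cV[R]_N) = const_mx 1 ->
  forall i, \sum_j W i j = 1.
Proof.
move=> W1 i; have /colP/(_ i) := W1; rewrite !mxE => <-.
by apply: eq_bigr => j _; rewrite mxE mulr1.
Qed.

Lemma set_power_tens G W x : segment_closed G -> proximinal G ->
  (forall i j, 0 <= W i j) -> W *m (const_mx 1 : 'cV[R]_N) = const_mx 1 ->
  set_power G x -> set_power G ((W *t (1%:M : 'M[R]_d)) *m x).
Proof.
move=> Gc Gp W0 W1 Gx i; rewrite block_tens.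
by apply: segment_closed_sum => //; exact: row_sumE.
Qed.

Lemma block_mean_tensE W x :
  block_mean ((W *t (1%:M : 'M[R]_d)) *m x) - block_mean x =
  N%:R^-1 *: \sum_j ((\sum_i W i j) - 1) *: block x j.
Proof.
rewrite /block_mean -scalerBr; congr (_ *: _).
under eq_bigr do rewrite block_tens.
rewrite exchange_big/= -sumrB; apply: eq_bigr => j _.
by rewrite scalerBl scale1r scaler_suml.
Qed.

(** Rows summing to 1 make the column defects sum to 0, so the mean can be subtracted from every
    block. Gossip therefore moves the mean only in proportion to the disagreement, which makes this
    noise square summable. *)
Lemma block_mean_tens W x : W *m (const_mx 1 : 'cV[R]_N) = const_mx 1 ->
  block_mean ((W *t (1%:M : 'M[R]_d)) *m x) - block_mean x =
  N%:R^-1 *: \sum_j ((\sum_i W i j) - 1) *: block (disagr x) j.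
Proof.
move=> W1; have c0 : \sum_j ((\sum_i W i j) - 1) = 0.
  rewrite sumrB exchange_big/= (eq_bigr (fun=> 1)) ?subrr// => i _.
  exact: row_sumE.
rewrite block_mean_tensE; congr (_ *: _).
under [RHS]eq_bigr do rewrite block_disagr scalerBr.
by rewrite [RHS]sumrB -[X in _ = _ - X]scaler_suml c0 scale0r subr0.
Qed.

Definition centering : 'M[R]_N :=
  1%:M - N%:R^-1 *: ((const_mx 1 : 'cV[R]_N) *m (const_mx 1 : 'rV[R]_N)).

(** Blocks separate the agents, layers the coordinates: on each layer the Kronecker product with the
    identity acts as [W] itself. *)
Definition layer x k : 'cV[R]_N := \col_i x (mxtens_index (i, k)) ord0.

Lemma layer_tens W x k : layer ((W *t (1%:M : 'M[R]_d)) *m x) k = W *m layer x k.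
Proof.
apply/colP => i; have := block_tens W x i => /colP/(_ k).
rewrite !mxE summxE => ->; apply: eq_bigr => j _; by rewrite !mxE.
Qed.

Lemma centering_layer x k : centering *m layer x k = layer (disagr x) k.
Proof.
apply/colP => i; have /colP/(_ k) := block_disagr x i.
rewrite /centering mulmxBl mul1mx -scalemxAl -mulmxA !mxE => ->.
rewrite big_ord1 !mxE mul1r summxE; congr (_ - _ * _).
by apply: eq_bigr => j _; rewrite !mxE mul1r.
Qed.

Lemma centering_tr : centering^T = centering.
Proof.
by rewrite /centering linearB linearZ/= trmx1 trmx_mul !trmx_const.
Qed.

Lemma centering1 : centering *m (const_mx 1 : 'cV[R]_N) = 0.
Proof.
rewrite /centering mulmxBl mul1mx -scalemxAl -mulmxA.
apply/colP => i; rewrite !mxE big_ord1 !mxE.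
under eq_bigr do rewrite !mxE mulr1.
by rewrite mul1r sumr_const card_ord mulVf// subrr.
Qed.

Lemma dotv_mul_tr m n (A : 'M[R]_(m, n)) u v : dotv u (A *m v) = dotv (A^T *m u) v.
Proof. by rewrite /dotv trmx_mul trmxK mulmxA. Qed.

Lemma centering_idem : centering *m centering = centering.
Proof.
rewrite {2}/centering mulmxBr mulmx1 -scalemxAr mulmxA centering1 mul0mx.
by rewrite scaler0 subr0.
Qed.

Lemma dotv_layer x y : dotv x y = \sum_k dotv (layer x k) (layer y k).
Proof.
rewrite dotvE sum_mxtens exchange_big/=; apply: eq_bigr => k _; rewrite dotvE.
by apply: eq_bigr => i _; rewrite !mxE.
Qed.

(** The right side is linear in the entries of the matrix whose expectation defines [rho], so it can
    be averaged entry by entry. *)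
Lemma disagr_tens W x :
  dotv (disagr ((W *t (1%:M : 'M[R]_d)) *m x)) (disagr ((W *t 1%:M) *m x)) =
  \sum_k dotv (layer x k) (W^T *m centering *m W *m layer x k).
Proof.
rewrite dotv_layer; apply: eq_bigr => k _; rewrite -!centering_layer !layer_tens.
rewrite dotv_mul_tr centering_tr mulmxA centering_idem.
by rewrite -!mulmxA [RHS]dotv_mul_tr trmxK dotvC.
Qed.

End block_algebra.

(** * Scalar recursions and summability *)

Section real_sequences.
Context {R : realType}.

(* Telescoping: [n ^ - b - (n + 1) ^ - b >= b * (n + 1) ^ - (1 + b)]. *)
Lemma powR_series_bound (b : R) : 0 < b ->
  forall m, \sum_(1 <= n < m) n%:R `^ (- (1 + b)) <= 1 + b^-1.
Proof.
move=> b0.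
have step (n : nat) : (0 < n)%N ->
    b * n.+1%:R `^ (- (1 + b)) <= n%:R `^ (- b) - n.+1%:R `^ (- b).
  move=> n0; have n0R : 0 < n%:R :> R by rewrite ltr0n.
  have n1R : 0 < n.+1%:R :> R by rewrite ltr0n.
  have n1b : 0 < n.+1%:R `^ (- b) by rewrite powR_gt0.
  have -> : n.+1%:R `^ (- (1 + b)) = n.+1%:R `^ (- b) / n.+1%:R.
    rewrite opprD addrC powRD; last first.
      by apply/implyP => _; rewrite gt_eqF.
    by rewrite powR_inv1// ltW.
  have -> : n%:R `^ (- b) = n.+1%:R `^ (- b) * (n%:R / n.+1%:R) `^ (- b).
    rewrite -powRM; [|exact: ltW|by apply: divr_ge0; exact: ltW].
    by congr (_ `^ _); rewrite mulrCA mulfV ?mulr1// pnatr_eq0.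
  rewrite -[X in _ <= _ - X]mulr1 -mulrBr mulrCA ler_pM2l//.
  have rp : 0 < n%:R / n.+1%:R :> R by rewrite divr_gt0.
  (* For [r = n / (n + 1)]: [r ^ - b = exp (- b * ln r) >= 1 - b * ln r], and
     [ln r <= - 1 / (n + 1)]. *)
  rewrite lerBrDr addrC -[(n%:R / n.+1%:R) `^ _]lnK ?posrE ?powR_gt0// ln_powR.
  apply: le_trans (expR_ge1Dx _); rewrite lerD2l mulNr -mulrN ler_pM2l//.
  have := @le_ln1Dx R (- n.+1%:R^-1).
  rewrite ltrN2 invf_lt1// ltr1n ltnS n0 => /(_ isT) h.
  rewrite lerNr; apply: le_trans h; rewrite le_eqVlt; apply/orP; left; apply/eqP.
  congr (ln _); rewrite -[in X in X / _](addnK 1%N n) addn1 natrB// mulrBl mul1r.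
  by rewrite mulfV// gt_eqF.
have key m : \sum_(1 <= n < m.+1) n%:R `^ (- (1 + b)) <=
    1 + b^-1 - (if m is 0%N then 0 else b^-1 * m%:R `^ (- b)).
  elim: m => [|[|m] IH].
  - by rewrite big_geq// subr0 addr_ge0 ?invr_ge0 ?ltW.
  - by rewrite big_nat1 !powR1 mulr1 addrK.
  - rewrite big_nat_recr//= (le_trans (lerD IH (lexx _)))//.
    by have := step m.+1 isT; rewrite -ler_pdivlMl// mulrBr; lra.
case=> [|m]; first by rewrite big_geq// addr_ge0 ?invr_ge0 ?ltW.
apply: (le_trans (key m)); rewrite gerBl; case: m {key} => // m.
by rewrite mulr_ge0 ?invr_ge0 ?powR_ge0 ?ltW.
Qed.

Lemma limn_einf_gt0 (u : nat -> R) : (0 < limn_einf (EFin \o u))%E ->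
  exists2 c, 0 < c & exists n0, forall n, (n0 <= n)%N -> c <= u n.
Proof.
rewrite limn_einf_lim => u0.
have [n0 en0] : exists n0, (0 < einfs (EFin \o u) n0)%E.
  apply: contrapT => H; move: u0; apply/negP; rewrite -leNgt.
  apply: lime_le; first exact: is_cvg_einfs.
  by apply: nearW => n; rewrite leNgt; apply/negP => h; apply: H; exists n.
have [c c0 cu] : exists2 c : R, 0 < c & (c%:E <= einfs (EFin \o u) n0)%E.
  move: en0; case: (einfs _ _) => [r|_|//]; last by exists 1 => //; rewrite leey.
  by rewrite lte_fin => r0; exists r.
exists c => //; exists n0 => n n0n.
rewrite -lee_fin (le_trans cu)//; apply: ereal_inf_lbound.
by exists n.
Qed.

Let sum_truncate (A : nat -> R) m n0 : (forall n, 0 <= A n) ->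
  \sum_(1 <= n < m) (if (n < n0)%N then A n else 0) <= \sum_(0 <= n < n0) A n.
Proof.
move=> A0.
have key : \sum_(1 <= n < m) (if (n < n0)%N then A n else 0) <=
    \sum_(0 <= n < minn m n0) A n.
  elim: m => [|[|m] IH].
  - by rewrite big_geq// sumr_ge0.
  - by rewrite big_geq// sumr_ge0.
  rewrite big_nat_recr//=; case: ltnP => h.
    rewrite (minn_idPl h) [leRHS]big_nat_recr//= lerD2r (le_trans IH)//.
    by rewrite (minn_idPl (ltnW h)).
  by rewrite addr0 (le_trans IH)// (minn_idPr h) (minn_idPr (leq_trans h _)).
rewrite (le_trans key)// [leRHS](@big_cat_nat _ _ _ (minn m n0))//= ?geq_minr//.
by rewrite lerDl sumr_ge0.
Qed.

Section contraction_recursion.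
Context (U gam rho : nat -> R) (alpha M : R).
Hypothesis alpha_gt : 1 / 2 < alpha.
Hypothesis gam_gt0 : forall n, (0 < n)%N -> 0 < gam n.
Hypothesis rho_ge0 : forall n, (0 < n)%N -> 0 <= rho n.
Hypothesis M_ge0 : 0 <= M.
Hypothesis gam_lim : n%:R `^ alpha * gam n @[n --> \oo] --> (0 : R).
Hypothesis rho_lim : n%:R * (1 - rho n) @[n --> \oo] --> +oo.
Hypothesis rho_gam :
  (0 < limn_einf (fun n => ((1 - rho n) / (n%:R `^ alpha * gam n))%:E))%E.
Hypothesis U_ge0 : forall n, 0 <= U n.
Hypothesis U_rec : forall n a, (0 < n)%N -> 0 < a ->
  U n.+1 <= rho n.+1 * ((1 + a) * U n + (1 + a^-1) * (gam n.+1 ^+ 2 * M)).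

(** Capping at 1 keeps the growth [(1 + 1 / m) ^ (2 * beta)] of the weights below [(1 + 1 / m) ^ 2],
    while [2 * beta > 1] preserves summability. *)
Let beta := Num.min alpha 1.

Let beta_gt : 1 / 2 < beta.
Proof. by rewrite lt_min alpha_gt; lra. Qed.

Let beta_le1 : beta <= 1.
Proof. by rewrite ge_min lexx orbT. Qed.

Let b_gt0 : 0 < 2 * beta - 1.
Proof. by have := beta_gt; lra. Qed.

(** The bound 12 ensures [3 / m <= a / 2] for [a = (1 - rho m.+1) / 2]: the weights then grow more
    slowly than the recursion contracts. *)
Let eventual : exists2 c, 0 < c & exists n0, forall n, (n0 <= n)%N ->
  [/\ (0 < n)%N, n%:R `^ beta * gam n <= 1,
      c * (n%:R `^ beta * gam n) <= (1 - rho n) / 2 &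
      12 <= n%:R * ((1 - rho n) / 2)].
Proof.
have [c c0 [n1 h1]] := limn_einf_gt0 rho_gam.
have [n2 h2] := cvg0_lt gam_lim (@ltr01 R).
have [n3 _ h3] := proj1 (cvgryPge _) rho_lim (24 : R).
exists (c / 2); first by rewrite divr_gt0.
exists (maxn (maxn n1 n2) (maxn n3 1)) => n.
rewrite !geq_max => /andP[/andP[n1n n2n] /andP[n3n n0]].
have n0R : 1 <= n%:R :> R by rewrite ler1n.
have gn := gam_gt0 n0.
have le_ab : n%:R `^ beta * gam n <= n%:R `^ alpha * gam n.
  by rewrite ler_pM2r// ler_powR// ge_min lexx.
have pos : 0 < n%:R `^ alpha * gam n by rewrite mulr_gt0// powR_gt0// (lt_le_trans ltr01).
split => //.
- by rewrite (le_trans le_ab)// ltW// (le_lt_trans (ler_norm _))// h2.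
- rewrite mulrAC ler_pM2r ?invr_gt0//.
  apply: (le_trans (_ : _ <= c * (n%:R `^ alpha * gam n))); first by rewrite ler_pM2l.
  by have := h1 _ n1n; rewrite ler_pdivlMr.
- by rewrite mulrA ler_pdivlMr//; have := h3 _ n3n; rewrite /=; lra.
Qed.

(** The weighted sequence [n ^ (2 * beta) * U n] is bounded. Taking for the free parameter half the
    spectral gap, [a = (1 - rho) / 2], leaves a contraction factor [1 - a] and a noise factor at
    most [1 / a]. *)
Lemma contraction_summable : exists2 K, 0 <= K & forall m,
  \sum_(1 <= n < m) U n <= K /\ \sum_(1 <= n < m) gam n ^+ 2 <= K.
Proof.
have [c c0 [n0 H]] := eventual.
pose p (n : nat) : R := n%:R `^ (2 * beta).
have p_gt0 n : (0 < n)%N -> 0 < p n by move=> n1; rewrite powR_gt0// ltr0n.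
have pE n : p n = (n%:R `^ beta) ^+ 2.
  by rewrite -powR_mulrn ?powR_ge0// -powRrM mulrC.
(* The first entry starts the induction. The second bounds the noise by [a * B / 2], exactly what
   the factor [1 - a / 2] frees. *)
pose B := Num.max (p n0 * U n0) (2 * M / c ^+ 2).
have B0 : 0 <= B by rewrite le_max mulr_ge0 ?powR_ge0.
have pU n : (n0 <= n)%N -> p n * U n <= B.
  move=> n0n; rewrite -(subnKC n0n); elim: (n - n0)%N => [|k IH].
    by rewrite addn0 le_max lexx.
  rewrite addnS; set m := (n0 + k)%N in IH *.
  have [m0 _ _ _] : [/\ (0 < m)%N, _, _ & _] := H _ (leq_addr _ _).
  have [_ g1 ga na] := H m.+1 (leq_trans (leq_addr k n0) (leqnSn _)).
  set a := (1 - rho m.+1) / 2 in ga na.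
  have a0 : 0 < a.
    have : 0 < m.+1%:R * a by rewrite (lt_le_trans _ na).
    by rewrite pmulr_rgt0// ltr0n.
  have rhoE : rho m.+1 = 1 - 2 * a by rewrite /a; field.
  have a12 : a <= 1 / 2 by have := rho_ge0 (ltn0Sn m); rewrite rhoE; lra.
  clearbody a; have := U_rec m0 a0.
  have pm1 := p_gt0 _ (ltn0Sn m); have pm := p_gt0 _ m0.
  have mR : 0 < m%:R :> R by rewrite ltr0n.
  set q := gam m.+1 ^+ 2 * M.
  have q0 : 0 <= q by rewrite mulr_ge0 ?sqr_ge0.
  have hq : p m.+1 * q <= a * a * (M / c ^+ 2).
    rewrite /q mulrA pE -exprMn.
    have h : m.+1%:R `^ beta * gam m.+1 <= a / c by rewrite ler_pdivlMr// mulrC.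
    have h0 : 0 <= m.+1%:R `^ beta * gam m.+1.
      by rewrite mulr_ge0 ?powR_ge0// ltW// gam_gt0.
    rewrite (_ : a * a * _ = (a / c) ^+ 2 * M); last by field; rewrite gt_eqF.
    rewrite ler_wpM2r// ler_sqr ?nnegrE//; apply: divr_ge0; exact: ltW.
  have hp : p m.+1 <= (1 + 3 / m%:R) * p m.
    have -> : p m.+1 = p m * (m.+1%:R / m%:R) `^ (2 * beta).
      rewrite /p -powRM ?divr_ge0//; congr (_ `^ _).
      by rewrite mulrCA mulfV ?mulr1// gt_eqF.
    rewrite mulrC ler_pM2r//.
    have r1 : 1 <= m.+1%:R / m%:R :> R by rewrite ler_pdivlMr// mul1r ler_nat.
    apply: (@le_trans _ _ ((m.+1%:R / m%:R) `^ 2)).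
      by rewrite ler_powR//; have := beta_le1; lra.
    rewrite powR_mulrn; last by rewrite divr_ge0.
    rewrite -natr1 mulrDl mulfV ?gt_eqF// mul1r.
    have i0 : 0 < m%:R^-1 :> R by rewrite invr_gt0.
    have i1 : m%:R^-1 <= 1 :> R by rewrite invf_le1// ler1n.
    have i2 : m%:R^-1 * m%:R^-1 <= m%:R^-1 :> R by rewrite ler_piMr// ltW.
    by lra.
  have h3 : 3 / m%:R <= a / 2.
    rewrite ler_pdivrMr//; have : m.+1%:R * a <= 2 * m%:R * a.
      by rewrite ler_pM2r// -natrM ler_nat mul2n -addnn -addn1 leq_add2l.
    by lra.
  have Bc : M / c ^+ 2 <= B / 2.
    have : 2 * M / c ^+ 2 <= B by rewrite le_max lexx orbT.
    by lra.
  rewrite rhoE => hU.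
  have hU' : U m.+1 <= (1 - a) * U m + a^-1 * q.
    apply: (le_trans hU).
    have -> : (1 - 2 * a) * ((1 + a) * U m + (1 + a^-1) * q) =
        ((1 - a) * U m + a^-1 * q) - (2 * (a * a) * U m + (1 + 2 * a) * q).
      by field; rewrite gt_eqF.
    have aa : 0 <= a * a := mulr_ge0 (ltW a0) (ltW a0).
    by rewrite gerBl; apply: addr_ge0; apply: mulr_ge0 => //; lra.
  have : p m.+1 * U m.+1 <= (1 - a) * (p m.+1 * U m) + a^-1 * (p m.+1 * q).
    rewrite (mulrCA (1 - a)) (mulrCA a^-1) -mulrDr ler_pM2l//.
  have : a^-1 * (p m.+1 * q) <= a * (M / c ^+ 2).
    by rewrite mulrC ler_pdivrMr// mulrAC.
  have : (1 - a) * (p m.+1 * U m) <= (1 - a / 2) * (p m * U m).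
    have h4 : (1 - a) * (1 + 3 / m%:R) <= 1 - a / 2.
      have : 0 <= a * (3 / m%:R) by rewrite mulr_ge0 ?(ltW a0)// divr_ge0// ltW.
      by lra.
    have h5 : p m.+1 * U m <= (1 + 3 / m%:R) * (p m * U m).
      by rewrite mulrA ler_wpM2r.
    have h6 : (1 - a) * (p m.+1 * U m) <= (1 - a) * ((1 + 3 / m%:R) * (p m * U m)).
      by rewrite ler_wpM2l//; lra.
    by rewrite (le_trans h6)// mulrA ler_wpM2r// mulr_ge0// ltW.
  have : (1 - a / 2) * (p m * U m) <= (1 - a / 2) * B by rewrite ler_wpM2l//; lra.
  have : a * (M / c ^+ 2) <= a * (B / 2) by rewrite ler_pM2l.
  by lra.
have pinv n : (0 < n)%N -> n%:R `^ (- (1 + (2 * beta - 1))) = (p n)^-1.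
  by move=> n1; rewrite addrC subrK powRN.
pose K0 := \sum_(0 <= n < n0) (U n + gam n ^+ 2).
pose K1 := 1 + (2 * beta - 1)^-1.
have K10 : 0 <= K1 by apply: addr_ge0 => //; rewrite invr_ge0 ltW.
have K00 : 0 <= K0 by apply: sumr_ge0 => i _; apply: addr_ge0 => //; exact: sqr_ge0.
have B1 : 0 <= B + 1 by exact: addr_ge0.
have K1E := powR_series_bound b_gt0; rewrite -/K1 in K1E.
clearbody B K1.
exists (K0 + (B + 1) * K1); first by apply: addr_ge0 => //; exact: mulr_ge0.
have bnd (A : nat -> R) : (forall n, 0 <= A n <= U n + gam n ^+ 2) ->
    (forall n, (n0 <= n)%N -> (0 < n)%N -> A n <= (B + 1) * (p n)^-1) ->
    forall m, \sum_(1 <= n < m) A n <= K0 + (B + 1) * K1.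
  move=> A0 hA m.
  apply: (@le_trans _ _ (\sum_(1 <= n < m) ((if (n < n0)%N then A n else 0) +
      (B + 1) * n%:R `^ (- (1 + (2 * beta - 1)))))).
    rewrite ler_sum_nat// => n /andP[n1 _]; rewrite pinv//.
    have i0 : 0 <= (B + 1) * (p n)^-1.
      by rewrite mulr_ge0 ?addr_ge0 ?invr_ge0// ltW// p_gt0.
    by case: ltnP => h; [rewrite lerDl|rewrite add0r hA].
  rewrite big_split/= -mulr_sumr lerD//; last first.
    by rewrite ler_wpM2l.
  apply: (le_trans (sum_truncate _ _ (fun n => proj1 (andP (A0 n))))).
  by apply: ler_sum => n _; have /andP[] := A0 n.
move=> m; split; apply: bnd => //.
- by move=> n; rewrite U_ge0 lerDl sqr_ge0.
- move=> n n0n n1; rewrite ler_pdivlMr ?p_gt0// mulrC.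
  by have := pU _ n0n; lra.
- by move=> n; rewrite sqr_ge0 lerDr U_ge0.
- move=> n n0n n1; rewrite ler_pdivlMr ?p_gt0// mulrC.
  rewrite pE -exprMn (le_trans (_ : _ <= 1))// ?lerDr//.
  have [_ h _ _] := H _ n0n.
  by rewrite expr_le1// mulr_ge0 ?powR_ge0// ltW// gam_gt0.
Qed.

End contraction_recursion.
End real_sequences.

(** * Conditioning *)

Section conditional_expectation.
Context {R : realType} {disp : measure_display} {T : measurableType disp}
  (P : probability T R).
Implicit Types (F : set (set T)) (X Z phi : T -> R).
Local Notation Ex := (Ex P).
Local Notation rint := (rint P).

Lemma sub_sigma_generated (S : set (set T)) : S `<=` measurable ->
  sub_sigma <<s S >>.
Proof.
move=> SM; split; first exact: smallest_sigma_algebra.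
by apply: smallest_sub => //; exact: sigma_algebra_measurable.
Qed.

Lemma cond_exp_eqP F X Z : cond_exp_eq P F X Z -> rint X /\
  exists Z0, [/\ Fmeas F Z0, rint Z0,
    forall A, F A -> (\int[P]_(w in A) (X w)%:E = \int[P]_(w in A) (Z0 w)%:E)%E
    & {ae P, forall w, Z0 w = Z w}].
Proof.
move=> [iX [Z0 [FZ iZ XZ ZZ]]]; split => //; exists Z0; split => // B mB.
by apply: FZ; exists B => //; rewrite setTI.
Qed.

Lemma integral_set_Ex A X : measurable A -> rint X ->
  (\int[P]_(w in A) (X w)%:E)%E = (Ex (fun w => \1_A w * X w))%:E.
Proof.
by move=> mA iX; rewrite ExE; [exact: integral_setE|exact: rintM_indic].
Qed.

Lemma integral_setB A X Z : measurable A -> rint X -> rint Z ->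
  (\int[P]_(w in A) (X w)%:E = \int[P]_(w in A) (Z w)%:E)%E <->
  (\int[P]_(w in A) (X w - Z w)%:E = 0)%E.
Proof.
move=> mA iX iZ; have iXZ := rintB iX iZ.
rewrite !integral_set_Ex//.
have -> : (fun w => \1_A w * (X w - Z w)) = (fun w => \1_A w * X w - \1_A w * Z w).
  by apply/funext => w; rewrite mulrBr.
rewrite ExB; [|exact: rintM_indic|exact: rintM_indic].
split => h; first by rewrite (EFin_inj h) subrr.
by congr EFin; apply/eqP; rewrite -subr_eq0; apply/eqP; exact: EFin_inj h.
Qed.

(** Uniqueness of conditional expectations: testing against the sign [phi] of [X] gives [|X|]
    expectation 0. *)
Lemma Fmeas_ae0 F X : sub_sigma F -> Fmeas F X -> rint X ->
  (forall A, F A -> (\int[P]_(w in A) (X w)%:E = 0)%E) ->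
  {ae P, forall w, X w = 0}.
Proof.
move=> sF mX iX X0; have mXT := Fmeas_measurable sF mX.
have FI (i : interval R) : F (X @^-1` [set` i]) by apply: mX; exact: measurable_itv.
pose A := X @^-1` `]0, +oo[%classic; pose B := X @^-1` `]-oo, 0[%classic.
pose phi w := \1_A w - \1_B w : R.
have mphi : Fmeas F phi.
  by apply: FmeasB => //; apply: Fmeas_indic => //; exact: FI.
have XE w : phi w * X w = `|X w|.
  rewrite /phi !indicE /A /B; case: (ltgtP (X w) 0) => h.
  - rewrite memNset/=; last by rewrite in_itv/= andbT; apply/negP; rewrite -leNgt ltW.
    by rewrite mem_set/= ?in_itv//= sub0r mulN1r ltr0_norm.
  - rewrite mem_set/= ?in_itv/= ?andbT// memNset/=; last first.
      by rewrite in_itv/=; apply/negP; rewrite -leNgt ltW.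
    by rewrite subr0 mul1r gtr0_norm.
  - by rewrite h normr0 mulr0.
have iabs : rint (fun w => `|X w|) by exact: (integrable_abse iX).
have := Ex_ortho sF iX X0 mphi; rewrite (funext XE) => /(_ iabs) E0.
have := ExE iabs; rewrite E0 => /esym.
have -> : (fun w => (`|X w|)%:E) = (fun w => `|(X w)%:E|)%E by [].
move=> /(ae_eq_integral_abs _ measurableT _).1 h.
have {}h := h (proj2 (measurable_EFinP _ _) mXT).
by apply: filterS h => w /(_ I) [].
Qed.

(* Conditioning on [F] leaves the law of [X1] unchanged; conditional
   independence then makes [X1] independent of [F] and [X2] taken together. *)
Section independence.
Context {d1 d2 : measure_display} {T1 : measurableType d1} {T2 : measurableType d2}
  (F : set (set T)) (X1 : T -> T1) (X2 : T -> T2).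
Hypothesis F_sigma : sub_sigma F.
Hypotheses (mX1 : measurable_fun setT X1) (mX2 : measurable_fun setT X2).
Hypothesis X1_indep : indep_of P F X1.
Hypothesis X12 : cond_indep P F X1 X2.

(** The generators are stable under intersection, so independence need only be checked on them. *)
Definition joint_history : set (set T) :=
  <<s [set D | exists B C, [/\ measurable B, F C & D = X2 @^-1` B `&` C]] >>.

Let mpre1 A : measurable A -> measurable (X1 @^-1` A).
Proof. by move=> mA; rewrite -[_ @^-1` _]setTI; exact: mX1. Qed.

Let mpre2 A : measurable A -> measurable (X2 @^-1` A).
Proof. by move=> mA; rewrite -[_ @^-1` _]setTI; exact: mX2. Qed.

Lemma joint_history_sub_sigma : sub_sigma joint_history.
Proof.
apply: sub_sigma_generated => _ [B [C [mB FC ->]]].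
by apply: measurableI; [exact: mpre2|exact: F_sigma.2].
Qed.

Lemma joint_history_sub : F `<=` joint_history.
Proof.
move=> C FC; apply: sub_sigma_algebra; exists setT, C; split => //.
by rewrite preimage_setT setTI.
Qed.

Lemma joint_history_meas : Fmeas joint_history X2.
Proof.
move=> B mB; apply: sub_sigma_algebra; exists B, setT; split => //.
  by have [sF _] := F_sigma; have [+ +] := sF => F0 /(_ _ F0); rewrite setD0.
by rewrite setIT.
Qed.

Let indep_rect A B C : measurable A -> measurable B -> F C ->
  P (X1 @^-1` A `&` (X2 @^-1` B `&` C)) =
  (P (X1 @^-1` A) * P (X2 @^-1` B `&` C))%E.
Proof.
move=> mA mB FC; have mC : measurable C := F_sigma.2 _ FC.
have [ZA [ZB []]] := X12 mA mB.
move=> /cond_exp_eqP[_ [YA [mYA iYA YAE YAZ]]].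
move=> /cond_exp_eqP[_ [YB [mYB iYB YBE YBZ]]].
move=> /cond_exp_eqP[_ [Y [mY iY YE YZ]]].
pose a := fine (P (X1 @^-1` A)).
have aE : a%:E = P (X1 @^-1` A) by rewrite fineK// fin_num_measure//; exact: mpre1.
have integral_ind S D : measurable S -> measurable D ->
    (\int[P]_(w in D) (\1_S w)%:E = P (S `&` D))%E.
  by move=> mS mD; rewrite integral_indic.
(* Since [X1] is independent of [F], the constant [a] is a version of the conditional probability,
   and versions agree almost surely. *)
have YAa : {ae P, forall w, YA w - a = 0}.
  apply: (Fmeas_ae0 F_sigma).
  - by apply: FmeasB => //; exact: Fmeas_cst.
  - by apply: rintB => //; exact: rint_cst.
  - move=> D FD; have mD : measurable D := F_sigma.2 _ FD.
    apply/integral_setB => //; first exact: rint_cst.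
    rewrite -YAE// integral_ind//; last exact: mpre1.
    by rewrite X1_indep// integral_cst// aE.
have YE' : {ae P, forall w, Y w = a * YB w}.
  apply: filterS3 YAa YAZ (filterI YBZ YZ) => w ha hA [hB hY].
  by move/eqP: ha; rewrite subr_eq0 => /eqP <-; rewrite hY hA hB.
rewrite setIA -integral_ind//; last first.
  by apply: measurableI; [exact: mpre1|exact: mpre2].
rewrite YE// integral_set_Ex//.
rewrite (@Ex_eq_ae _ _ _ _ _ (fun w => a * (\1_C w * YB w))).
- rewrite ExZ; last exact: rintM_indic.
  rewrite EFinM aE -integral_set_Ex// -YBE// integral_ind//; exact: mpre2.
- by apply: measurable_funM; [exact: measurable_indic|exact: rint_measurable iY].
- apply: measurable_funM => //; apply: measurable_funM.
    exact: measurable_indic.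
  exact: rint_measurable iYB.
- by apply: filterS YE' => w ->; rewrite mulrCA.
Qed.

Let indep_joint A D : measurable A -> joint_history D ->
  P (X1 @^-1` A `&` D) = (P (X1 @^-1` A) * P D)%E.
Proof.
move=> mA; have mX1A := mpre1 mA; move: D.
pose H : set (set T) := [set D | measurable D /\
  P (X1 @^-1` A `&` D) = (P (X1 @^-1` A) * P D)%E].
suff : joint_history `<=` H by move=> h D /h[].
apply: lambda_system_subset => //.
- move=> _ _ [B [C [mB FC ->]]] [B' [C' [mB' FC' ->]]].
  exists (B `&` B'), (C `&` C'); split; first exact: measurableI.
    apply: (measurable_in F_sigma); apply: measurableI; exact: sub_sigma_algebra.
  by rewrite preimage_setI setIACA.
- split => //.
  + by split => //; rewrite setIT [X in _ = (_ * X)%E](_ : _ = 1%E) ?mule1//; exact: probability_setT.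
  + move=> D E ED [mD hD] [mE hE]; split; first exact: measurableD.
    have mXD : measurable (X1 @^-1` A `&` D) by exact: measurableI.
    rewrite setIDA measureD//; last by rewrite ltey_eq fin_num_measure.
    rewrite -setIA (setIidr ED).
    transitivity (P (X1 @^-1` A) * P D - P (X1 @^-1` A) * P E)%E.
      by congr (_ - _)%E.
    rewrite -muleBr ?fin_num_measure// ?fin_num_adde_defr ?fin_num_measure//.
    congr (_ * _)%E; rewrite measureD// ?(setIidr ED)//.
    by rewrite ltey_eq fin_num_measure.
  + move=> D nd hD; have mD i : measurable (D i) by have [] := hD i.
    have mUD : measurable (\bigcup_i D i) by exact: bigcupT_measurable.
    split => //.
    have c1 : P (X1 @^-1` A `&` D i) @[i --> \oo] --> P (X1 @^-1` A `&` \bigcup_i D i).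
      rewrite setI_bigcupr; apply: nondecreasing_cvg_mu.
      * by move=> i; exact: measurableI.
      * by apply: bigcupT_measurable => i; exact: measurableI.
      * by move=> i j ij; apply/subsetPset; apply: setIS; apply/subsetPset/nd.
    have c2 : (P (X1 @^-1` A) * P (D i))%E @[i --> \oo] -->
        (P (X1 @^-1` A) * P (\bigcup_i D i))%E.
      apply: cvgeZl; first by rewrite fin_num_measure.
      exact: nondecreasing_cvg_mu.
    have e : (fun i => P (X1 @^-1` A `&` D i)) = (fun i => (P (X1 @^-1` A) * P (D i))%E).
      by apply/funext => i; have [] := hD i.
    by move: c1; rewrite e => c1; exact: (cvg_unique _ c1 c2).
- move=> _ [B [C [mB FC ->]]]; split; last exact: indep_rect.
  by apply: measurableI; [exact: mpre2|exact: F_sigma.2].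
Qed.

(** The roles are exchanged in order to reuse [Ex_ortho]: the centred indicator of [D] is orthogonal
    to every integrable function of [X1], which spares a second approximation of [psi]. *)
Lemma indep_center (psi : T1 -> R) : measurable_fun setT psi ->
  rint (psi \o X1) -> forall D, joint_history D ->
  (\int[P]_(w in D) (psi (X1 w) - Ex (psi \o X1))%:E = 0)%E.
Proof.
move=> mpsi ipsi D JD; have mD : measurable D := joint_history_sub_sigma.2 _ JD.
have sX1 : sub_sigma (g_sigma_algebra_preimage X1).
  split; first exact/sigma_algebra_preimage/sigma_algebra_measurable.
  by move=> _ [B mB <-]; rewrite setTI; exact: mpre1.
pose X' w : R := \1_D w - fine (P D).
have iX' : rint X' by apply: rintB; [exact: rint_indic|exact: rint_cst].
have PDfin : (fine (P D))%:E = P D by rewrite fineK// fin_num_measure.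
have ortho' : Ex (fun w => psi (X1 w) * X' w) = 0.
  apply: (Ex_ortho sX1) => //.
  - move=> _ [A mA <-]; rewrite setTI; apply/integral_setB => //.
    + exact: mpre1.
    + exact: rint_indic.
    + exact: rint_cst.
    rewrite integral_indic//; last exact: mpre1.
    rewrite setIC integral_cst; last exact: mpre1.
    by rewrite PDfin muleC; exact: indep_joint.
  - move=> B mB; exists (psi @^-1` B); last by rewrite setTI.
    by rewrite -[X in measurable X]setTI; exact: mpsi.
  - apply: (@rint_le_ae _ _ _ _ _ (fun w => 2 * `|psi (X1 w)|)).
    + apply: measurable_funM; first exact: (rint_measurable ipsi).
      exact: (rint_measurable iX').
    + apply: rintZ; exact: (integrable_abse ipsi).
    + apply: aeW => w; rewrite normrM mulrC ler_wpM2r//.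
      rewrite (le_trans (ler_normB _ _))// (_ : 2 = 1 + 1)// lerD//.
      by rewrite indicE; case: (_ \in _); rewrite ?normr1 ?normr0.
    by rewrite ger0_norm ?fine_ge0// -lee_fin PDfin probability_le1.
apply/integral_setB => //; first exact: rint_cst.
rewrite integral_cst// integral_set_Ex//.
transitivity (Ex (psi \o X1) * fine (P D))%:E; last by rewrite EFinM PDfin.
congr EFin.
move: ortho'.
have -> : (fun w => psi (X1 w) * X' w) =
    (fun w => \1_D w * psi (X1 w) - fine (P D) * psi (X1 w)).
  by apply/funext => w; rewrite /X' mulrBr mulrC [X in _ - X]mulrC.
rewrite ExB; [|exact: rintM_indic|exact: rintZ].
by rewrite ExZ// => /eqP; rewrite subr_eq0 => /eqP ->; rewrite mulrC.
Qed.

Lemma indep_Ex (psi : T1 -> R) phi : measurable_fun setT psi ->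
  rint (psi \o X1) -> Fmeas joint_history phi -> rint phi ->
  rint (fun w => phi w * psi (X1 w)) ->
  Ex (fun w => phi w * psi (X1 w)) = Ex phi * Ex (psi \o X1).
Proof.
move=> mpsi ipsi mphi iphi iphipsi.
set c := Ex (psi \o X1).
have ic : rint (fun w => c * phi w) by exact: rintZ.
have e : (fun w => phi w * (psi (X1 w) - c)) = (fun w => phi w * psi (X1 w) - c * phi w).
  by apply/funext => w; rewrite mulrBr (mulrC c).
have := Ex_ortho joint_history_sub_sigma (rintB ipsi (rint_cst P c))
  (indep_center mpsi ipsi) mphi.
rewrite e => /(_ (rintB iphipsi ic)); rewrite ExB// ExZ// => /eqP.
by rewrite subr_eq0 => /eqP ->; rewrite mulrC.
Qed.

End independence.
End conditional_expectation.

(** * Moments computed from conditional laws *)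

Section conditional_law.
Context {R : realType} {disp : measure_display} {T : measurableType disp}
  (P : probability T R) {d2 : measure_display} {T2 : measurableType d2}.
Context (F : set (set T)) (Y : T -> T2) (nu : T -> probability T2 R).
Hypothesis F_sigma : sub_sigma F.
Hypothesis mY : measurable_fun setT Y.
Hypothesis Y_law : forall A, measurable A ->
  cond_prob_eq P F (Y @^-1` A) (fun w => fine (nu w A)).
Local Notation Ex := (Ex P).
Local Notation rint := (rint P).

Let simpleE (s : {nnsfun T2 >-> R}) y : s y =
  \sum_(c <- fset_set (range s)) c * \1_(s @^-1` [set c]) y.
Proof. by rewrite fimfunE fsbig_finite. Qed.

Let mpre A : measurable A -> measurable (Y @^-1` A).
Proof. by move=> mA; rewrite -[_ @^-1` _]setTI; exact: mY. Qed.

Let ms (s : {nnsfun T2 >-> R}) (c : R) : measurable (s @^-1` [set c]).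
Proof. by []. Qed.

Lemma rint_simple (s : {nnsfun T2 >-> R}) : rint (s \o Y).
Proof.
have -> : s \o Y = fun w => \sum_(c <- fset_set (range s)) c * \1_(Y @^-1` (s @^-1` [set c])) w.
  by apply/funext => w; rewrite /= simpleE.
by apply: rint_sum => c; apply: rintZ; apply: rint_indic; exact: mpre.
Qed.

(** [nu] is a bare family, with no measurability in [w]. For simple functions its integrals still
    agree almost surely with an [F]-measurable [H], by linearity over the finitely many values. *)
Lemma cond_simple (s : {nnsfun T2 >-> R}) : exists H : T -> R,
  [/\ Fmeas F H, rint H,
     forall A, F A -> (\int[P]_(w in A) (s (Y w) - H w)%:E = 0)%E &
     {ae P, forall w, (H w)%:E = (\int[nu w]_y (s y)%:E)%E}].
Proof.
have HZ (c : R) : exists Z, [/\ Fmeas F Z, rint Z,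
    forall A, F A -> (\int[P]_(w in A) (\1_(Y @^-1` (s @^-1` [set c])) w)%:E =
                      \int[P]_(w in A) (Z w)%:E)%E
    & {ae P, forall w, Z w = fine (nu w (s @^-1` [set c]))}].
  by have /cond_exp_eqP[_ [Z hZ]] := Y_law (ms s c); exists Z.
have [Z {}HZ] := choice HZ.
pose r := fset_set (range s) : seq R.
exists (fun w => \sum_(c <- r) c * Z c w); split.
- apply: Fmeas_sum => // c; apply: FmeasM => //; first exact: Fmeas_cst.
  by have [] := HZ c.
- by apply: rint_sum => c; apply: rintZ; have [] := HZ c.
- move=> A FA; have mA := F_sigma.2 _ FA.
  have i1 c : rint (fun w => \1_A w * (\1_(Y @^-1` (s @^-1` [set c])) w - Z c w)).
    apply: rintM_indic => //; apply: rintB; last by have [] := HZ c.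
    by apply: rint_indic; exact: mpre.
  rewrite integral_setE//.
  have -> : (fun w => (\1_A w * (s (Y w) - \sum_(c <- r) c * Z c w))%:E) =
    (fun w => (\sum_(c <- r) c * (\1_A w * (\1_(Y @^-1` (s @^-1` [set c])) w - Z c w)))%:E).
    apply/funext => w; congr EFin; rewrite simpleE -sumrB mulr_sumr.
    by apply: eq_bigr => c _; rewrite -mulrBr mulrCA.
  rewrite -ExE; last by apply: rint_sum => c; exact: rintZ.
  rewrite Ex_sum; last by move=> c; exact: rintZ.
  rewrite big1// => c _; rewrite ExZ//.
  suff -> : Ex (fun w => \1_A w * (\1_(Y @^-1` (s @^-1` [set c])) w - Z c w)) = 0.
    by rewrite mulr0.
  have [_ iZ hZ _] := HZ c.
  apply: EFin_inj; rewrite ExE// -integral_setE//.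
  by apply/integral_setB => //; [apply: rint_indic; exact: mpre|exact: hZ].
- have : {ae P, forall w, forall i : nat, Z (nth 0 r i) w =
      fine (nu w (s @^-1` [set nth 0 r i]))}.
    by apply: ae_foralln => i; have [] := HZ (nth 0 r i).
  apply: filterS => w hw; rewrite integralT_nnsfun sintegralE fsbig_finite//=.
  rewrite -sumEFin big_seq [RHS]big_seq; apply: eq_bigr => c cr.
  rewrite EFinM; congr (_ * _)%E.
  have := hw (index c r); rewrite nth_index// => ->.
  by rewrite fineK// fin_num_measure.
Qed.

Section nonnegative_functional.
Context (phi : T2 -> R) (C : R).
Hypothesis mphi : measurable_fun setT phi.
Hypothesis phi0 : forall y, 0 <= phi y.
Hypothesis phi_law : {ae P, forall w, (\int[nu w]_y (phi y)%:E <= C%:E)%E}.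

Let mphi' : measurable_fun setT (EFin \o phi).
Proof. exact/measurable_EFinP. Qed.

Let s := nnsfun_approx measurableT mphi'.

Let s_cvg y : (fun n => (s n y)%:E) @ \oo --> (phi y)%:E.
Proof. exact: (cvg_nnsfun_approx measurableT mphi' (fun w _ => phi0 w) (I : setT y)). Qed.

Let s_nd y : nondecreasing_seq (fun n => s n y).
Proof. by move=> a b ab; exact/lefP/nd_nnsfun_approx. Qed.

Let s_le n y : s n y <= phi y.
Proof.
have cv' : EFin \o s ^~ y @ \oo --> (EFin \o phi) y := @s_cvg y.
have cv : s ^~ y @ \oo --> phi y by exact: fine_cvg cv'.
have := nondecreasing_cvgn_le (@s_nd y) (cvgP _ cv) n.
by rewrite (cvg_lim (@Rhausdorff R) cv).
Qed.

Lemma law_simple_le (t : {nnsfun T2 >-> R}) : (forall y, t y <= phi y) ->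
  {ae P, forall w, (\int[nu w]_y (t y)%:E <= C%:E)%E}.
Proof.
move=> tphi; apply: filterS phi_law => w; apply: le_trans.
by apply: ge0_le_integral => //; try exact/measurable_EFinP; move=> y _; rewrite lee_fin.
Qed.

Let Ex_s n : Ex (s n \o Y) <= C.
Proof.
have [H [mH iH H0 HE]] := cond_simple (s n).
have [sF _] := F_sigma.
have FT : F setT by move: sF => [F0 /(_ _ F0)]; rewrite setD0.
have /eqP := H0 _ FT; rewrite -ExE; last by apply: rintB => //; exact: rint_simple.
rewrite ExB//; last exact: rint_simple.
rewrite eqe subr_eq0 => /eqP ->; rewrite -(Ex_cst P C); apply: Ex_le_ae => //.
  exact: rint_cst.
have := law_simple_le (s_le n); apply: filterS2 HE => w hw hl.
by rewrite -lee_fin hw.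
Qed.

Let int_cvg : (\int[P]_w (s n (Y w))%:E)%E @[n --> \oo] -->
  (\int[P]_w (phi (Y w))%:E)%E.
Proof.
have mcv : forall n, measurable_fun setT (fun w => (s n (Y w))%:E).
  by move=> n; apply/measurable_EFinP; exact: rint_measurable (rint_simple (s n)).
have -> : (\int[P]_w (phi (Y w))%:E = \int[P]_w limn (fun n => (s n (Y w))%:E))%E.
  by apply: eq_integral => w _; rewrite (cvg_lim _ (@s_cvg (Y w))).
apply: cvg_monotone_convergence => //.
- by move=> n w _; rewrite lee_fin.
- by move=> w _ a b ab; rewrite lee_fin s_nd.
Qed.

Let mphiY : measurable_fun setT (phi \o Y).
Proof. exact: measurableT_comp. Qed.

Lemma rint_law : rint (phi \o Y).
Proof.
apply/integrableP; split; first exact/measurable_EFinP.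
rewrite (eq_integral (fun w => (phi (Y w))%:E)); last first.
  by move=> w _; rewrite /= ger0_norm.
rewrite -(cvg_lim _ int_cvg)//.
apply: le_lt_trans (ltry C); apply: lime_le.
  by apply/cvg_ex; eexists; exact: int_cvg.
apply: nearW => n; rewrite -ExE ?lee_fin; first exact: Ex_s.
exact: rint_simple.
Qed.

Lemma Ex_law_le : Ex (phi \o Y) <= C.
Proof.
rewrite -lee_fin ExE; last exact: rint_law.
rewrite -(cvg_lim _ int_cvg)//; apply: lime_le.
  by apply/cvg_ex; eexists; exact: int_cvg.
apply: nearW => n; rewrite -ExE ?lee_fin; first exact: Ex_s.
exact: rint_simple.
Qed.

(** At a small cost in mean, [phi] is replaced by a simple function, to which [cond_simple]
    applies. *)
Lemma law_simple_approx e : 0 < e -> exists2 t : {nnsfun T2 >-> R},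
  forall y, t y <= phi y & Ex (fun w => phi (Y w) - t (Y w)) <= e.
Proof.
move=> e0; have cv : Ex (s n \o Y) @[n --> \oo] --> Ex (phi \o Y).
  apply: fine_cvg; rewrite ExE; last exact: rint_law.
  exact: int_cvg.
have /cvgrPdist_lt/(_ _ e0)[n _ /(_ n (leqnn _)) hn] := cv.
exists (s n) => //; rewrite ExB; [|exact: rint_law|exact: rint_simple].
by rewrite ltW// (le_lt_trans (ler_norm _)).
Qed.

End nonnegative_functional.
End conditional_law.

(** * The consensus algorithm *)

Section spectral_bound.
Context {R : realType}.

Let mx_bound m n (A : 'M[R]_(m, n)) x : enorm x <= 1 ->
  enorm (A *m x) <= \sum_i \sum_j `|A i j|.
Proof.
move=> x1; rewrite (le_trans (ler_enorm_sum _))// ler_sum// => i _.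
rewrite mxE (le_trans (ler_norm_sum _ _ _))// ler_sum// => j _.
by rewrite normrM ler_piMr// (le_trans (ler_coord_enorm _ _)).
Qed.

Let unit_bound m n (A : 'M[R]_(m, n)) x : enorm x <= 1 ->
  enorm (A *m x) <= spectral_norm A.
Proof.
move=> x1; apply: ub_le_sup; last by exists x.
by exists (\sum_i \sum_j `|A i j|) => _ [y /= y1 <-]; exact: mx_bound.
Qed.

Lemma spectral_norm_ge0 m n (A : 'M[R]_(m, n)) : 0 <= spectral_norm A.
Proof.
by rewrite (le_trans (enorm_ge0 (A *m 0)))// unit_bound// enorm0.
Qed.

Lemma ler_spectral_norm m n (A : 'M[R]_(m, n)) x :
  enorm (A *m x) <= spectral_norm A * enorm x.
Proof.
have [->|x0] := eqVneq x 0; first by rewrite mulmx0 !enorm0 mulr0.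
have nx : 0 < enorm x by rewrite lt_def enorm_eq0 x0 enorm_ge0.
have -> : A *m x = enorm x *: (A *m ((enorm x)^-1 *: x)).
  by rewrite -scalemxAr scalerA mulfV ?scale1r// gt_eqF.
rewrite enormZ gtr0_norm// mulrC ler_pM2r// unit_bound// enormZ.
by rewrite ger0_norm ?invr_ge0 ?enorm_ge0// mulVf// gt_eqF.
Qed.

(** A symmetric matrix that kills the all-ones vector is unchanged by centring on either side, so
    its quadratic form only sees the disagreement. *)
Lemma layer_quad N d (A : 'M[R]_N) (x : 'cV[R]_(N * d)) : A^T = A ->
  A *m (const_mx 1 : 'cV[R]_N) = 0 ->
  \sum_k dotv (layer x k) (A *m layer x k) <=
  spectral_norm A * dotv (disagr x) (disagr x).
Proof.
move=> Asym A1; have AC : A *m centering = A.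
  by rewrite /centering mulmxBr mulmx1 -scalemxAr mulmxA A1 mul0mx scaler0 subr0.
rewrite dotv_layer mulr_sumr; apply: ler_sum => k _; rewrite -centering_layer.
set c := layer x k.
have -> : dotv c (A *m c) = dotv (A *m (centering *m c)) (centering *m c).
  by rewrite mulmxA AC -{1}AC -mulmxA dotv_mul_tr Asym.
rewrite (le_trans (dotv_le_enorm _ _))// -enorm_sqr expr2 mulrA.
by rewrite ler_wpM2r ?enorm_ge0// ler_spectral_norm.
Qed.

End spectral_bound.

Section matrix_sub_sigma.
Context {R : realType} {disp : measure_display} {T : measurableType disp}.
Context (F : set (set T)) (F_sigma : sub_sigma F).

Lemma Fmeas_mx m n (h : T -> 'M[R]_(m, n)) :
  (forall i j, Fmeas F (fun w => h w i j)) -> Fmeas F h.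
Proof.
by move=> mh; apply/FmeasP => //; apply: measurable_mx_coord => i j; apply/FmeasP.
Qed.

Lemma Fmeas_coord m n (h : T -> 'M[R]_(m, n)) i j :
  Fmeas F h -> Fmeas F (fun w => h w i j).
Proof.
by move=> /(FmeasP _ F_sigma) mh; apply/FmeasP => //; exact: measurable_coord_mx.
Qed.

Lemma Fmeas_mulmx m n p (h : T -> 'M[R]_(m, n)) (k : T -> 'M[R]_(n, p)) :
  Fmeas F h -> Fmeas F k -> Fmeas F (fun w => h w *m k w).
Proof.
move=> /(FmeasP _ F_sigma) mh /(FmeasP _ F_sigma) mk; apply/FmeasP => //.
exact: measurable_mulmx.
Qed.

Lemma Fmeas_addmx m n (h k : T -> 'M[R]_(m, n)) :
  Fmeas F h -> Fmeas F k -> Fmeas F (fun w => h w + k w).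
Proof.
move=> mh mk; apply: Fmeas_mx => i j.
by under eq_fun do rewrite mxE; apply: FmeasD => //; exact: Fmeas_coord.
Qed.

Lemma Fmeas_scalemx m n (c : R) (h : T -> 'M[R]_(m, n)) :
  Fmeas F h -> Fmeas F (fun w => c *: h w).
Proof.
move=> mh; apply: Fmeas_mx => i j; under eq_fun do rewrite mxE.
by apply: FmeasM => //; [exact: Fmeas_cst|exact: Fmeas_coord].
Qed.

Lemma Fmeas_tens N d (h : T -> 'M[R]_N) :
  Fmeas F h -> Fmeas F (fun w => h w *t (1%:M : 'M[R]_d)).
Proof.
move=> mh; apply: Fmeas_mx => i j; under eq_fun do rewrite mxE.
by apply: FmeasM => //; [exact: Fmeas_coord|exact: Fmeas_cst].
Qed.

Lemma Fmeas_block_mean N d (h : T -> 'cV[R]_(N * d)) k :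
  Fmeas F h -> Fmeas F (fun w => block_mean (h w) k ord0).
Proof.
move=> mh; rewrite /block_mean; under eq_fun do rewrite mxE summxE.
apply: FmeasM => //; first exact: Fmeas_cst.
apply: Fmeas_sum => // i; under eq_fun do rewrite mxE; exact: Fmeas_coord.
Qed.

End matrix_sub_sigma.

(** * Moment and almost sure estimates along the algorithm *)

Section consensus_algorithm.
Context {R : realType} {N d : nat} (N_gt0 : (0 < N)%N)
  {disp : measure_display} {Omega : measurableType disp} (P : probability Omega R)
  (gamma : nat -> R) (theta0 : {RV P >-> 'cV[R]_(N * d)})
  (Y : nat -> {RV P >-> 'cV[R]_(N * d)}) (W : nat -> {RV P >-> 'M[R]_N})
  (mu : 'cV[R]_(N * d) -> probability 'cV[R]_(N * d) R)
  (G : set 'cV[R]_d) (theta : nat -> Omega -> 'cV[R]_(N * d)) (rho : nat -> R).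
Hypothesis theta_init : forall w, theta 0%N w = theta0 w.
Hypothesis theta_step : forall n w, theta n.+1 w =
  (W n.+1 w *t (1%:M : 'M[R]_d)) *m
    eproj (set_power G) (theta n w + gamma n.+1 *: Y n.+1 w).
Hypothesis rho_def : forall n, rho n = spectral_norm (expectation_mx P (fun w =>
  (W n w)^T *m (centering : 'M[R]_N) *m W n w)).
Hypothesis W_ge0 : forall n, (0 < n)%N ->
  {ae P, forall w, forall i j, 0 <= W n w i j}.
Hypothesis W_row : forall n, (0 < n)%N ->
  {ae P, forall w, W n w *m (const_mx 1 : 'cV[R]_N) = const_mx 1}.
Hypothesis W_col : forall n, (0 < n)%N ->
  (const_mx 1 : 'rV[R]_N) *m expectation_mx P (W n) = const_mx 1.
Hypothesis WY_cond_indep : forall n, (0 < n)%N ->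
  cond_indep P (history theta0 Y W n) (W n.+1) (Y n.+1).
Hypothesis W_indep : forall n, (0 < n)%N ->
  indep_of P (history theta0 Y W n) (W n.+1).
Hypothesis Y_law : forall n, (0 < n)%N ->
  forall A : set 'cV[R]_(N * d), measurable A ->
  cond_prob_eq P (history theta0 Y W n) (Y n.+1 @^-1` A)
    (fun w => fine (mu (theta n w) A)).
Hypothesis mu_moment : (ereal_sup
  [set \int[mu x]_y ((enorm y) ^+ 2)%:E | x in set_power G] < +oo)%E.
Hypothesis gamma_gt0 : forall n, (0 < n)%N -> 0 < gamma n.
Hypotheses (G_neq0 : G !=set0) (G_compact : compact G) (G_convex : segment_closed G).

Local Notation Ex := (Ex P).
Local Notation rint := (rint P).
Local Notation GN := (@set_power R N d G).
Local Notation F n := (history theta0 Y W n).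

Let G_prox : proximinal G. Proof. exact: compact_proximinal. Qed.
Let GN_prox : proximinal GN. Proof. exact: set_power_proximinal. Qed.
Let GN_convex : segment_closed GN. Proof. exact: set_power_convex. Qed.

Lemma history_sub_sigma n : sub_sigma (F n).
Proof.
apply: sub_sigma_generated => A [|[k _ []]] [B mB <-]; rewrite setTI;
  exact: measurable_funPTI.
Qed.

Lemma history_le n : F n `<=` F n.+1.
Proof.
apply: sub_sigma_algebra2 => A [h|[k /= /andP[k0 kn] h]]; first by left.
by right; exists k => //=; rewrite k0 (leq_trans kn).
Qed.

Lemma theta0_meas : Fmeas (F 0) theta0.
Proof.
by move=> B mB; apply: sub_sigma_algebra; left; exists B => //; rewrite setTI.
Qed.

Lemma Y_meas n : Fmeas (F n.+1) (Y n.+1).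
Proof.
move=> B mB; apply: sub_sigma_algebra; right; exists n.+1; first by rewrite /= leqnn.
by left; exists B => //; rewrite setTI.
Qed.

Lemma W_meas n : Fmeas (F n.+1) (W n.+1).
Proof.
move=> B mB; apply: sub_sigma_algebra; right; exists n.+1; first by rewrite /= leqnn.
by right; exists B => //; rewrite setTI.
Qed.

Definition half_step n w := eproj GN (theta n w + gamma n.+1 *: Y n.+1 w).

Lemma half_step_in n w : GN (half_step n w).
Proof. exact: eproj_in. Qed.

Let half_step_Fmeas F' n : sub_sigma F' -> Fmeas F' (theta n) ->
  Fmeas F' (Y n.+1) -> Fmeas F' (half_step n).
Proof.
move=> sF mt mY; apply: (Fmeas_comp (g := eproj GN)
  (h := fun w => theta n w + gamma n.+1 *: Y n.+1 w)).
  by apply: continuous_mxmx_measurable; exact: eproj_continuous.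
by apply: Fmeas_addmx => //; exact: Fmeas_scalemx.
Qed.

Lemma theta_meas n : Fmeas (F n) (theta n).
Proof.
have sF := history_sub_sigma.
elim: n => [|n IH].
  by rewrite (_ : theta 0%N = theta0); [exact: theta0_meas|exact/funext].
rewrite (_ : theta n.+1 = fun w => (W n.+1 w *t (1%:M : 'M[R]_d)) *m half_step n w);
  last exact/funext/theta_step.
apply: Fmeas_mulmx => //; first by apply: Fmeas_tens => //; exact: W_meas.
apply: half_step_Fmeas => //; last exact: Y_meas.
by move=> B mB; apply: history_le; exact: IH.
Qed.

Lemma half_step_meas n : Fmeas (F n.+1) (half_step n).
Proof.
apply: half_step_Fmeas; [exact: history_sub_sigma| |exact: Y_meas].
by move=> B mB; apply: history_le; exact: theta_meas.
Qed.

(** What is known just before the gossip of step [n.+1]: [half_step n] is measurable for it and, for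
    [n > 0], [W n.+1] is independent of it. *)
Local Notation J n := (joint_history (F n) (Y n.+1)).

Let J_sigma n : sub_sigma (J n).
Proof. by apply: joint_history_sub_sigma; [exact: history_sub_sigma|exact: measurable_funPT]. Qed.

Lemma half_step_joint n : Fmeas (J n) (half_step n).
Proof.
apply: half_step_Fmeas => //.
  by move=> B mB; apply: joint_history_sub; exact: theta_meas.
apply: joint_history_meas; exact: history_sub_sigma.
Qed.

(** The starting point is arbitrary, hence [n.+1]; projecting and then averaging with row-stochastic
    weights keeps each block in the convex set [G]. *)
Lemma theta_in : {ae P, forall w, forall n, GN (theta n.+1 w)}.
Proof.
apply: ae_foralln => n; apply: filterS2 (W_ge0 (ltn0Sn n)) (W_row (ltn0Sn n)).
move=> w w0 w1; rewrite theta_step; apply: set_power_tens => //.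
exact: (half_step_in n w).
Qed.

Lemma W_le1 n : (0 < n)%N -> {ae P, forall w, forall i j, `|W n w i j| <= 1}.
Proof.
move=> n0; apply: filterS2 (W_ge0 n0) (W_row n0) => w w0 w1 i j.
rewrite ger0_norm// -(row_sumE w1 i) (bigD1 j)//= lerDl.
by rewrite sumr_ge0.
Qed.

Lemma GN_bounded : exists2 K, 0 < K & forall x, GN x ->
  enorm x <= K /\ forall j, `|x j ord0| <= K.
Proof.
have cid : continuous (fun x : 'cV[R]_d => x) by move=> x; exact: id.
have [K K0 hK] := compact_enorm_bound G_compact cid.
exists (\sum_(j < N * d) K + K).
  by rewrite ltr_wpDl// sumr_ge0// => j _; exact: ltW.
move=> x Gx; have hx j : `|x j ord0| <= K.
  case: (mxtens_indexP j) => i k; have := hK _ (Gx i).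
  by apply: le_trans; rewrite (le_trans _ (ler_coord_enorm _ k))// mxE.
split.
  rewrite (le_trans (ler_enorm_sum x))//.
  apply: (@le_trans _ _ (\sum_(j < N * d) K)); first exact: ler_sum.
  by rewrite lerDl ltW.
by move=> j; rewrite (le_trans (hx j))// lerDr sumr_ge0// => i _; exact: ltW.
Qed.

Lemma moment_bound : exists2 M, 0 <= M & forall x, GN x ->
  (\int[mu x]_y ((enorm y) ^+ 2)%:E <= M%:E)%E.
Proof.
have [g Gg] := G_neq0.
pose S := [set \int[mu x]_y ((enorm y) ^+ 2)%:E | x in GN]%E.
have Sub x : GN x -> (\int[mu x]_y ((enorm y) ^+ 2)%:E <= ereal_sup S)%E.
  by move=> Gx; apply: ereal_sup_ubound; exists x.
have GNg : GN (consensus g) by move=> i; rewrite block_consensus.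
have S0 : (0 <= ereal_sup S)%E.
  by apply: le_trans (Sub _ GNg); apply: integral_ge0 => y _; rewrite lee_fin sqr_ge0.
exists (fine (ereal_sup S)); first exact: fine_ge0.
by move=> x /Sub; rewrite fineK// ge0_fin_numE.
Qed.

Lemma enorm_sqr_measurable : measurable_fun setT (fun y : 'cV[R]_(N * d) => enorm y ^+ 2).
Proof.
apply: (measurable_funX 2).
by apply: continuous_mx_measurable; exact: enorm_continuous.
Qed.

Let theta_in_at n : (0 < n)%N -> {ae P, forall w, GN (theta n w)}.
Proof. by case: n => // n _; apply: filterS theta_in => w; apply. Qed.

Lemma Y_moment M : (forall x, GN x -> (\int[mu x]_y ((enorm y) ^+ 2)%:E <= M%:E)%E) ->
  forall n, (0 < n)%N -> rint (fun w => enorm (Y n.+1 w) ^+ 2) /\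
    Ex (fun w => enorm (Y n.+1 w) ^+ 2) <= M.
Proof.
move=> hM n n0.
have law : {ae P, forall w, (\int[mu (theta n w)]_y ((enorm y) ^+ 2)%:E <= M%:E)%E}.
  by apply: filterS (theta_in_at n0) => w; exact: hM.
have sF := history_sub_sigma n; have mYn : measurable_fun setT (Y n.+1) by [].
have p0 (y : 'cV[R]_(N * d)) : 0 <= enorm y ^+ 2 by exact: sqr_ge0.
split; first exact: (rint_law sF mYn (Y_law n0) enorm_sqr_measurable p0 law).
exact: (Ex_law_le sF mYn (Y_law n0) enorm_sqr_measurable p0 law).
Qed.

Lemma enorm_sqr_Fmeas F' (h : Omega -> 'cV[R]_(N * d)) : sub_sigma F' ->
  Fmeas F' h -> Fmeas F' (fun w => enorm (h w) ^+ 2).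
Proof. by move=> _ mh; exact: (Fmeas_comp enorm_sqr_measurable mh). Qed.

Lemma disagr_continuous : continuous (@disagr R N d).
Proof.
move=> x A /enorm_ball[e e0 h]; apply/enorm_ball; exists e => // y xy; apply: h.
have -> : disagr x - disagr y = disagr (x - y).
  rewrite -[in LHS](subrK y x) disagrD addrK//.
by rewrite (le_lt_trans (enorm_disagr N_gt0 _)).
Qed.

Lemma disagr_sqr_Fmeas F' (h : Omega -> 'cV[R]_(N * d)) : sub_sigma F' ->
  Fmeas F' h -> Fmeas F' (fun w => enorm (disagr (h w)) ^+ 2).
Proof.
move=> sF mh; apply: enorm_sqr_Fmeas => //.
apply: (Fmeas_comp (g := @disagr R N d)) => //.
by apply: continuous_mxmx_measurable; exact: disagr_continuous.
Qed.

Let bounded_disagr_rint (h : Omega -> 'cV[R]_(N * d)) : Fmeas measurable h ->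
  {ae P, forall w, GN (h w)} -> rint (fun w => enorm (disagr (h w)) ^+ 2).
Proof.
move=> mh hG; have [K K0 hK] := GN_bounded.
have sM : sub_sigma (@measurable _ Omega).
  by split; [exact: sigma_algebra_measurable|].
apply: (@rint_bounded_ae _ _ _ _ _ (K ^+ 2)).
  by apply: (Fmeas_measurable sM); exact: disagr_sqr_Fmeas.
apply: filterS hG => w /hK[hw _]; rewrite ger0_norm ?sqr_ge0//.
rewrite ler_sqr ?nnegrE ?enorm_ge0 ?(ltW K0)//.
exact: le_trans (enorm_disagr N_gt0 _) hw.
Qed.

Lemma disagr_theta_rint n : (0 < n)%N ->
  rint (fun w => enorm (disagr (theta n w)) ^+ 2).
Proof.
move=> n0; apply: bounded_disagr_rint; last exact: theta_in_at.
by move=> B mB; apply: (history_sub_sigma n).2; exact: theta_meas.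
Qed.

Lemma disagr_half_rint n : rint (fun w => enorm (disagr (half_step n w)) ^+ 2).
Proof.
apply: bounded_disagr_rint; last by apply: aeW => w; exact: half_step_in.
by move=> B mB; apply: (history_sub_sigma n.+1).2; exact: half_step_meas.
Qed.

Let quadE (A : 'M[R]_N) (x : 'cV[R]_(N * d)) :
  \sum_k dotv (layer x k) (A *m layer x k) =
  \sum_k \sum_i \sum_j (layer x k i ord0 * layer x k j ord0) * A i j.
Proof.
apply: eq_bigr => k _; rewrite dotvE; apply: eq_bigr => i _.
by rewrite [X in _ * X]mxE mulr_sumr; apply: eq_bigr => j _; rewrite mulrA mulrAC.
Qed.

Let psi i j (A : 'M[R]_N) : R := (A^T *m (centering : 'M[R]_N) *m A) i j.

Let psi_measurable i j : measurable_fun setT (psi i j).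
Proof.
have mid : measurable_fun setT (fun A : 'M[R]_N => A) by exact: measurable_id.
apply: measurable_coord_mx; apply: measurable_mulmx => //.
apply: measurable_mulmx => //; apply: measurable_mx_coord => k l.
by under eq_fun do rewrite mxE; exact: coord_mx_measurable.
Qed.

Let psi_rint n i j : (0 < n)%N -> rint (psi i j \o W n).
Proof.
move=> n0; apply: (@rint_bounded_ae _ _ _ _ _
  (\sum_l \sum_m `|(centering : 'M[R]_N) m l|)).
  exact: measurableT_comp.
apply: filterS (W_le1 n0) => w w1; rewrite /= /psi mxE.
rewrite (le_trans (ler_norm_sum _ _ _))// ler_sum// => l _.
rewrite normrM (le_trans (ler_piMr _ (w1 l j)))// mxE.
rewrite (le_trans (ler_norm_sum _ _ _))// ler_sum// => m _.
by rewrite normrM mxE ler_piMl.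
Qed.

Let phi_meas n (a b : 'I_(N * d)) :
  Fmeas (J n) (fun w => half_step n w a ord0 * half_step n w b ord0).
Proof.
by apply: FmeasM => //; apply: Fmeas_coord => //; exact: half_step_joint.
Qed.

Let bounded_rint (F' : set (set Omega)) (h : Omega -> R) (K : R) : sub_sigma F' ->
  Fmeas F' h -> (forall w, `|h w| <= K) -> rint h.
Proof.
move=> sF mh hK; apply: (@rint_bounded_ae _ _ _ _ _ K); last exact: aeW.
exact: Fmeas_measurable mh.
Qed.

Let bounded_rintM (F' : set (set Omega)) (h X : Omega -> R) (K : R) : sub_sigma F' ->
  Fmeas F' h -> (forall w, `|h w| <= K) -> rint X -> rint (fun w => h w * X w).
Proof.
move=> sF mh hK iX; apply: (@rint_le_ae _ _ _ _ _ (fun w => K * `|X w|)).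
- apply: measurable_funM; last exact: (rint_measurable iX).
  exact: Fmeas_measurable mh.
- by apply: rintZ; exact: (integrable_abse iX).
- by apply: aeW => w; rewrite normrM ler_wpM2r.
Qed.

Let expectation_mxE m n (X : Omega -> 'M[R]_(m, n)) i j :
  expectation_mx P X i j = Ex (fun w => X w i j).
Proof. by rewrite mxE /Ex; congr fine; rewrite unlock. Qed.

(** The squared disagreement expands into products of a coordinate pair before gossip and an entry
    of a function of [W n.+1]. Independence from [J n] replaces each entry by its mean, and the
    spectral norm bounds the resulting form. *)
Lemma disagr_contract n : (0 < n)%N ->
  Ex (fun w => enorm (disagr (theta n.+1 w)) ^+ 2) <=
  rho n.+1 * Ex (fun w => enorm (disagr (half_step n w)) ^+ 2).
Proof.
move=> n0; have [K K0 hK] := GN_bounded.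
have sF := history_sub_sigma n.
have mWn : measurable_fun setT (W n.+1) by [].
have mYn : measurable_fun setT (Y n.+1) by [].
pose A := expectation_mx P (fun w =>
  (W n.+1 w)^T *m (centering : 'M[R]_N) *m W n.+1 w).
pose phi k i j w := layer (half_step n w) k i ord0 * layer (half_step n w) k j ord0.
have phi_bound k i j w : `|phi k i j w| <= K * K.
  have [_ h] := hK _ (half_step_in n w).
  by rewrite normrM !mxE ler_pM.
have phiJ k i j : Fmeas (J n) (phi k i j).
  have -> : phi k i j = (fun w => half_step n w (mxtens_index (i, k)) ord0 *
      half_step n w (mxtens_index (j, k)) ord0).
    by apply/funext => w; rewrite /phi !mxE.
  exact: phi_meas.
have iphi k i j : rint (phi k i j) by exact: bounded_rint (phiJ _ _ _) _.
have ipsi i j : rint (psi i j \o W n.+1) by exact: psi_rint.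
have iphipsi k i j : rint (fun w => phi k i j w * psi i j (W n.+1 w)).
  exact: (bounded_rintM (J_sigma n) (phiJ k i j) (phi_bound k i j) (ipsi i j)).
have AE i j : A i j = Ex (psi i j \o W n.+1) by rewrite expectation_mxE.
have -> : Ex (fun w => enorm (disagr (theta n.+1 w)) ^+ 2) =
    Ex (fun w => \sum_k dotv (layer (half_step n w) k) (A *m layer (half_step n w) k)).
  have -> : (fun w => enorm (disagr (theta n.+1 w)) ^+ 2) =
      (fun w => \sum_k \sum_i \sum_j phi k i j w * psi i j (W n.+1 w)).
    apply/funext => w; rewrite enorm_sqr theta_step -/(half_step n w).
    by rewrite (disagr_tens N_gt0) quadE.
  have -> : (fun w => \sum_k dotv (layer (half_step n w) k) (A *m layer (half_step n w) k))
      = (fun w => \sum_k \sum_i \sum_j A i j * phi k i j w).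
    apply/funext => w; rewrite quadE; apply: eq_bigr => k _; apply: eq_bigr => i _.
    by apply: eq_bigr => j _; rewrite mulrC.
  rewrite Ex_sum; last by move=> k; apply: rint_sum => i; exact: rint_sum.
  rewrite Ex_sum; last first.
    by move=> k; apply: rint_sum => i; apply: rint_sum => j; exact: rintZ.
  apply: eq_bigr => k _.
  rewrite Ex_sum; last by move=> i; exact: rint_sum.
  rewrite Ex_sum; last by move=> i; apply: rint_sum => j; exact: rintZ.
  apply: eq_bigr => i _; rewrite !Ex_sum//; last by move=> j; exact: rintZ.
  apply: eq_bigr => j _; rewrite ExZ// AE mulrC.
  exact: (indep_Ex sF mWn mYn (W_indep n0) (WY_cond_indep n0)).
have iquad : rint (fun w =>
    \sum_k dotv (layer (half_step n w) k) (A *m layer (half_step n w) k)).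
  under eq_fun do rewrite quadE.
  apply: rint_sum => k; apply: rint_sum => i; apply: rint_sum => j.
  by under eq_fun do rewrite mulrC; apply: rintZ; exact: iphi.
rewrite -ExZ; last exact: disagr_half_rint.
apply: Ex_le_ae => //; first by apply: rintZ; exact: disagr_half_rint.
apply: aeW => w; rewrite rho_def -/A enorm_sqr; apply: layer_quad.
  apply/matrixP => i j; rewrite mxE !AE; congr (Ex _); apply/funext => w' /=.
  set Q := W n.+1 w'; rewrite /psi -[in LHS](trmxK (Q^T *m _ *m _)) mxE.
  by rewrite !trmx_mul trmxK centering_tr mulmxA.
(* Almost surely [W n.+1] fixes the all-ones vector, which [centering] kills; taking expectations,
   [A] kills it as well. *)
apply/colP => i; rewrite !mxE.
under eq_bigr do rewrite AE mxE mulr1.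
rewrite -Ex_sum; last by move=> j; exact: ipsi.
transitivity (Ex (fun=> 0)); last exact: Ex_cst.
apply: Ex_eq_ae => //.
  by apply: (@rint_measurable _ _ _ P); apply: rint_sum => j; exact: ipsi.
apply: filterS (W_row (ltn0Sn n)) => w' w1.
transitivity (((W n.+1 w')^T *m (centering : 'M[R]_N) *m W n.+1 w' *m
    (const_mx 1 : 'cV[R]_N)) i ord0).
  by rewrite [RHS]mxE; apply: eq_bigr => j _; rewrite [const_mx 1 j _]mxE mulr1.
by rewrite -mulmxA w1 -mulmxA (centering1 N_gt0) mulmx0 mxE.
Qed.

Lemma half_step_near n : (0 < n)%N -> {ae P, forall w,
  enorm (half_step n w - theta n w) <= gamma n.+1 * enorm (Y n.+1 w)}.
Proof.
move=> n0; apply: filterS (theta_in_at n0) => w Gw.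
by apply: enorm_proj_step => //; apply/ltW/gamma_gt0.
Qed.

(** Young's inequality with a free weight [a], to be matched later with the spectral gap; a fixed
    weight could outweigh a contraction factor tending to 1. *)
Lemma disagr_half_le n a : (0 < n)%N -> 0 < a -> {ae P, forall w,
  enorm (disagr (half_step n w)) ^+ 2 <=
  (1 + a) * enorm (disagr (theta n w)) ^+ 2 +
  (1 + a^-1) * (gamma n.+1 ^+ 2 * enorm (Y n.+1 w) ^+ 2)}.
Proof.
move=> n0 a0; apply: filterS (half_step_near n0) => w hw.
have := disagrD (half_step n w - theta n w) (theta n w); rewrite subrK => ->.
set u := disagr (half_step n w - theta n w); set v := disagr _.
have hu : enorm u <= gamma n.+1 * enorm (Y n.+1 w).
  exact: le_trans (enorm_disagr N_gt0 _) hw.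
rewrite -exprMn.
have : enorm (u + v) <= gamma n.+1 * enorm (Y n.+1 w) + enorm v.
  by rewrite (le_trans (ler_enormD _ _))// lerD2r.
have y0 : 0 <= gamma n.+1 * enorm (Y n.+1 w).
  by rewrite (le_trans _ hu)// enorm_ge0.
move: y0 (enorm_ge0 v) (enorm_ge0 (u + v)).
move: (gamma n.+1 * _) (enorm v) (enorm (u + v)) => y x t y0 x0 t0 h.
apply: (@le_trans _ _ ((y + x) ^+ 2)).
  by rewrite ler_sqr ?nnegrE// addr_ge0.
rewrite -subr_ge0.
have -> : (1 + a) * x ^+ 2 + (1 + a^-1) * y ^+ 2 - (y + x) ^+ 2 =
    a^-1 * (a * x - y) ^+ 2 by field; rewrite gt_eqF.
by rewrite mulr_ge0 ?sqr_ge0// invr_ge0 ltW.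
Qed.

Lemma disagr_recursion M n a :
  (forall x, GN x -> (\int[mu x]_y ((enorm y) ^+ 2)%:E <= M%:E)%E) ->
  (0 < n)%N -> 0 < a ->
  Ex (fun w => enorm (disagr (theta n.+1 w)) ^+ 2) <=
  rho n.+1 * ((1 + a) * Ex (fun w => enorm (disagr (theta n w)) ^+ 2) +
              (1 + a^-1) * (gamma n.+1 ^+ 2 * M)).
Proof.
move=> hM n0 a0; have [iY YM] := Y_moment hM n0.
rewrite (le_trans (disagr_contract n0))//.
rewrite ler_wpM2l//; first by rewrite rho_def spectral_norm_ge0.
have iD := disagr_theta_rint n0.
have iD' := rintZ (1 + a) iD.
have iY' := rintZ (1 + a^-1) (rintZ (gamma n.+1 ^+ 2) iY).
apply: le_trans (Ex_le_ae (disagr_half_rint n) (rintD iD' iY') (disagr_half_le n0 a0)) _.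
rewrite ExD// !ExZ//; last exact: rintZ.
rewrite lerD2l ler_wpM2l//; first by rewrite addr_ge0// invr_ge0 ltW.
by rewrite ler_wpM2l// sqr_ge0.
Qed.

Section almost_sure_behaviour.
Context (alpha : R).
Hypothesis alpha_gt : 1 / 2 < alpha.
Hypothesis gamma_lim : n%:R `^ alpha * gamma n @[n --> \oo] --> (0 : R).
Hypothesis rho_lim : n%:R * (1 - rho n) @[n --> \oo] --> +oo.
Hypothesis rho_gamma :
  (0 < limn_einf (fun n => ((1 - rho n) / (n%:R `^ alpha * gamma n))%:E))%E.

(** Conditional hypotheses and membership in the product of copies of [G] start at index 1. The
    chain is therefore observed from [theta 1], whose next step uses [gamma 2]. *)
Let gam k := gamma k.+2.
Let D k w := enorm (disagr (theta k.+1 w)) ^+ 2.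

Let gam_gt0 k : 0 < gam k. Proof. exact: gamma_gt0. Qed.

Let D_rint k : rint (D k). Proof. exact: disagr_theta_rint. Qed.

Let D_ge0 k w : 0 <= D k w. Proof. exact: sqr_ge0. Qed.

Lemma disagr_summable : exists2 K, 0 <= K & forall n,
  \sum_(0 <= k < n) Ex (D k) <= K /\ \sum_(0 <= k < n) gam k ^+ 2 <= K.
Proof.
have [M M0 hM] := moment_bound.
have U0 n : 0 <= Ex (fun w => enorm (disagr (theta n w)) ^+ 2).
  by rewrite fine_ge0//; apply: integral_ge0 => w _; rewrite lee_fin sqr_ge0.
have rho0 n : (0 < n)%N -> 0 <= rho n by rewrite rho_def spectral_norm_ge0.
have [K K0 hK] := contraction_summable alpha_gt gamma_gt0 rho0 M0 gamma_lim rho_lim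
  rho_gamma U0 (fun n a n0 a0 => disagr_recursion hM n0 a0).
exists K => // n; split.
  by have [+ _] := hK n.+1; rewrite big_add1.
have [_] := hK n.+2; rewrite big_add1/= big_nat_recl//=; apply: le_trans.
by rewrite lerDr sqr_ge0.
Qed.

Let Y2 k w := enorm (Y k.+2 w) ^+ 2.

Let Y2_rint k : rint (Y2 k).
Proof. by have [M _ hM] := moment_bound; have [] := Y_moment hM (ltn0Sn k). Qed.

Let Y2_le : exists2 M, 0 <= M & forall k, Ex (Y2 k) <= M.
Proof.
have [M M0 hM] := moment_bound; exists M => // k.
by have [] := Y_moment hM (ltn0Sn k).
Qed.

Lemma ae_disagr_series : {ae P, forall w, cvgn (series (fun k => D k w))}.
Proof.
have [K K0 hK] := disagr_summable.
by apply: (@ae_cvg_series _ _ _ _ _ K) => // n; have [] := hK n.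
Qed.

Lemma ae_step_series :
  {ae P, forall w, cvgn (series (fun k => (gam k * enorm (Y k.+2 w)) ^+ 2))}.
Proof.
have [K K0 hK] := disagr_summable; have [M M0 hM] := Y2_le.
have e k : (fun w => (gam k * enorm (Y k.+2 w)) ^+ 2) = (fun w => gam k ^+ 2 * Y2 k w).
  by apply/funext => w; rewrite exprMn.
apply: (@ae_cvg_series _ _ _ _ (fun k w => (gam k * enorm (Y k.+2 w)) ^+ 2) (K * M)).
- by move=> k; rewrite e; exact: rintZ.
- by move=> k w; exact: sqr_ge0.
move=> n; apply: (@le_trans _ _ (\sum_(0 <= k < n) gam k ^+ 2 * M)).
  by apply: ler_sum => k _; rewrite e ExZ// ler_wpM2l// sqr_ge0.
by rewrite -mulr_suml ler_wpM2r//; have [] := hK n.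
Qed.

(** The common criterion for the observation noise, the gossip noise and the sizes of the
    observations; [disagr_summable] bounds the total variance. *)
Let martingale (X : nat -> Omega -> R) (a b : R) : 0 <= a -> 0 <= b ->
  (forall k, Fmeas (F k.+2) (X k)) ->
  (forall k, rint (fun w => X k w ^+ 2)) ->
  (forall k A, F k.+1 A -> (\int[P]_(w in A) (X k w)%:E = 0)%E) ->
  (forall k, Ex (fun w => X k w ^+ 2) <= a * gam k ^+ 2 + b * Ex (D k)) ->
  {ae P, forall w, cvgn (series (fun k => X k w))}.
Proof.
move=> a0 b0 mX iX X0 hX; have [K K0 hK] := disagr_summable.
apply: (@ae_cvg_martingale _ _ _ _ (fun k => F k.+1) X (a * K + b * K)) => //.
- by move=> k; exact: history_sub_sigma.
- by move=> k; exact: history_le.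
move=> n; apply: (@le_trans _ _
    (\sum_(0 <= k < n) (a * gam k ^+ 2 + b * Ex (D k)))).
  by apply: ler_sum => k _; exact: hX.
have [h1 h2] := hK n.
by rewrite big_split/= -!mulr_sumr lerD// ler_wpM2l.
Qed.

Let sqrB_le (x y : R) : (x - y) ^+ 2 <= 2 * x ^+ 2 + 2 * y ^+ 2.
Proof. by have := sqr_ge0 (x + y); lra. Qed.

Section gradient_noise.
Context (f : 'I_N -> 'cV[R]_d -> R).
Hypothesis f_C1 : forall i, C1_on setT (f i).
Hypothesis Y_mean : forall n, (0 < n)%N -> forall j : 'I_(N * d),
  cond_exp_eq P (history theta0 Y W n) (fun w => Y n.+1 w j ord0)
    (fun w => (- stack (fun i => grad (f i) (block (theta n w) i))) j ord0).

Lemma grad_bounded : exists2 K, 0 < K & forall i x, G x -> enorm (grad (f i) x) <= K.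
Proof.
have h i : exists K, 0 < K /\ forall x, G x -> enorm (grad (f i) x) <= K.
  by have [K K0 hK] := compact_enorm_bound G_compact (grad_continuous (f_C1 i)); exists K.
have [K hK] := choice h; exists (\sum_i K i + 1).
  by rewrite ltr_wpDl// sumr_ge0// => i _; have [/ltW] := hK i.
move=> i x Gx; have [Ki hi] := hK i; rewrite (le_trans (hi _ Gx))//.
rewrite (bigD1 i)//= -addrA lerDl addr_ge0// sumr_ge0// => j _.
by have [/ltW] := hK j.
Qed.

(** The increments are first built with [F]-measurable versions [Z k] of the conditional means,
    which almost surely equal the negative gradients for all [k] at once. *)
Lemma ae_gradient_noise : {ae P, forall w, forall j : 'I_(N * d), cvgn (series (fun k =>
  gam k * (Y k.+2 w + stack (fun i => grad (f i) (block (theta k.+1 w) i))) j ord0))}.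
Proof.
have [Kg Kg0 hg] := grad_bounded; have [M M0 hM] := Y2_le.
suff H (j : 'I_(N * d)) : {ae P, forall w, cvgn (series (fun k => gam k *
    (Y k.+2 w + stack (fun i => grad (f i) (block (theta k.+1 w) i))) j ord0))}.
  exact: ae_forall_ord.
have hZ k : exists Z, [/\ Fmeas (F k.+1) Z, rint Z,
    forall A, F k.+1 A -> (\int[P]_(w in A) (Y k.+2 w j ord0)%:E =
                           \int[P]_(w in A) (Z w)%:E)%E
    & {ae P, forall w, Z w =
        (- stack (fun i => grad (f i) (block (theta k.+1 w) i))) j ord0}].
  by have /cond_exp_eqP[_ [Z h]] := Y_mean (ltn0Sn k) j; exists Z.
have [Z {}hZ] := choice hZ.
have iYj k : rint (fun w => Y k.+2 w j ord0).
  by have /cond_exp_eqP[] := Y_mean (ltn0Sn k) j.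
have mZ k : Fmeas (F k.+2) (Z k).
  by have [h _ _ _] := hZ k; move=> B mB; apply: history_le; exact: h.
have mYj k : Fmeas (F k.+2) (fun w => Y k.+2 w j ord0).
  by apply: Fmeas_coord; [exact: history_sub_sigma|exact: Y_meas].
have ZK k : {ae P, forall w, `|Z k w| <= Kg}.
  have [_ _ _ h] := hZ k; apply: filterS2 h (theta_in_at (ltn0Sn k)) => w -> Gw.
  rewrite mxE normrN; case: (mxtens_indexP j) => i l; rewrite mxE mxtens_indexK/=.
  exact: le_trans (ler_coord_enorm _ _) (hg _ _ (Gw i)).
have iZ2 k : rint (fun w => Z k w ^+ 2).
  apply: (@rint_bounded_ae _ _ _ _ _ (Kg ^+ 2)).
    apply: (measurable_funX 2).
    exact: (Fmeas_measurable (history_sub_sigma k.+2) (mZ k)).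
  apply: filterS (ZK k) => w h; rewrite normrX ler_sqr ?nnegrE ?(ltW Kg0)//.
have hYj k w : Y k.+2 w j ord0 ^+ 2 <= Y2 k w.
  rewrite -(real_normK (num_real (Y k.+2 w j ord0))).
  by rewrite ler_sqr ?nnegrE ?enorm_ge0// ler_coord_enorm.
have mYjT k : measurable_fun setT (fun w => Y k.+2 w j ord0) := rint_measurable (iYj k).
have iYj2 k : rint (fun w => Y k.+2 w j ord0 ^+ 2).
  apply: (rint_le_ae (measurable_funX 2 (mYjT k)) (Y2_rint k)).
  by apply: aeW => w; rewrite ger0_norm ?sqr_ge0.
pose X k w := gam k * (Y k.+2 w j ord0 - Z k w).
have iYZ k : rint (fun w => gam k ^+ 2 * (2 * Y k.+2 w j ord0 ^+ 2 + 2 * Z k w ^+ 2)).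
  by apply: rintZ; apply: rintD; exact: rintZ.
have X2 k w : X k w ^+ 2 <= gam k ^+ 2 * (2 * Y k.+2 w j ord0 ^+ 2 + 2 * Z k w ^+ 2).
  by rewrite exprMn ler_wpM2l ?sqr_ge0.
have mX k : Fmeas (F k.+2) (X k).
  have sF := history_sub_sigma k.+2.
  by apply: FmeasM => //; [exact: Fmeas_cst|exact: FmeasB].
have iX2 k : rint (fun w => X k w ^+ 2).
  apply: (rint_le_ae _ (iYZ k)).
    apply: (measurable_funX 2).
    exact: (Fmeas_measurable (history_sub_sigma k.+2) (mX k)).
  by apply: aeW => w; rewrite ger0_norm ?sqr_ge0.
have HX : {ae P, forall w, cvgn (series (fun k => X k w))}.
  apply: (martingale (a := 2 * M + 2 * Kg ^+ 2) (b := 0)) => //.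
  - by rewrite addr_ge0// mulr_ge0// sqr_ge0.
  - move=> k A FA; have mA := (history_sub_sigma k.+1).2 _ FA.
    have [_ iZ hA _] := hZ k.
    under eq_integral do rewrite EFinM.
    rewrite integralZl//; last exact: (integrableS measurableT mA _ (rintB (iYj k) iZ)).
    by rewrite (integral_setB mA (iYj k) iZ).1 ?mule0//; exact: hA.
  - move=> k; rewrite mul0r addr0.
    apply: (le_trans (Ex_le_ae (iX2 k) (iYZ k) (aeW _ (X2 k)))).
    rewrite ExZ; last by apply: rintD; exact: rintZ.
    rewrite mulrC ler_wpM2r ?sqr_ge0// ExD; [|exact: rintZ|exact: rintZ].
    rewrite !ExZ// lerD// ler_wpM2l//.
      by rewrite (le_trans _ (hM k))//; apply: Ex_le_ae => //; exact: aeW.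
    rewrite -(Ex_cst P (Kg ^+ 2)); apply: Ex_le_ae => //; first exact: rint_cst.
    apply: filterS (ZK k) => w h.
    by rewrite -(real_normK (num_real (Z k w))) ler_sqr ?nnegrE ?(ltW Kg0).
have HZ : {ae P, forall w, forall k, Z k w =
    (- stack (fun i => grad (f i) (block (theta k.+1 w) i))) j ord0}.
  by apply: ae_foralln => k; have [] := hZ k.
apply: filterS2 HX HZ => w + hZw.
rewrite (_ : (fun k => X k w) = (fun k => gam k *
  (Y k.+2 w + stack (fun i => grad (f i) (block (theta k.+1 w) i))) j ord0))//.
by apply/funext => k; rewrite /X hZw !mxE opprK.
Qed.

End gradient_noise.

Let psi1 (l : 'I_N) (A : 'M[R]_N) : R := \sum_i A i l.

Let psi1_measurable l : measurable_fun setT (psi1 l).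
Proof. by apply: measurable_sum => i; exact: coord_mx_measurable. Qed.

Let psi1_rint n l : (0 < n)%N -> rint (psi1 l \o W n).
Proof.
move=> n0; apply: (@rint_bounded_ae _ _ _ _ _ N%:R).
  exact: measurableT_comp.
apply: filterS (W_le1 n0) => w w1; rewrite /= /psi1.
rewrite (le_trans (ler_norm_sum _ _ _))//.
rewrite (le_trans (ler_sum _ (fun i _ => w1 i l)))//.
by rewrite sumr_const card_ord.
Qed.

Let psi1_mean n l : (0 < n)%N -> Ex (psi1 l \o W n) = 1.
Proof.
move=> n0; have iW i : rint (fun w => W n w i l).
  apply: (@rint_bounded_ae _ _ _ _ _ 1).
    by apply: measurable_coord_mx; exact: measurable_funPT.
  by apply: filterS (W_le1 n0) => w; apply.
have /matrixP/(_ ord0 l) := W_col n0; rewrite mxE [RHS]mxE => <-.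
rewrite /psi1 (_ : _ \o _ = fun w => \sum_i W n w i l)// Ex_sum//.
by apply: eq_bigr => i _; rewrite expectation_mxE mxE mul1r.
Qed.

Lemma ae_gossip_noise : {ae P, forall w, forall j : 'I_d, cvgn (series (fun k =>
  (block_mean (theta k.+2 w) - block_mean (half_step k.+1 w)) j ord0))}.
Proof.
have [K K0 hK] := GN_bounded; have [M M0 hM] := Y2_le.
suff H (j : 'I_d) : {ae P, forall w, cvgn (series (fun k =>
    (block_mean (theta k.+2 w) - block_mean (half_step k.+1 w)) j ord0))}.
  exact: ae_forall_ord.
pose X k w := (block_mean (theta k.+2 w) - block_mean (half_step k.+1 w)) j ord0.
pose z k l w := half_step k.+1 w (mxtens_index (l, j)) ord0.
have sF k := history_sub_sigma k.
(* The raw coordinates [z] are bounded and known before gossip, which suits the centring argument;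
   the size estimate [XB] uses disagreements instead. *)
have XE k w : X k w = N%:R^-1 * \sum_l z k l w * (psi1 l (W k.+2 w) - 1).
  rewrite /X theta_step -/(half_step k.+1 w) block_mean_tensE.
  rewrite [LHS]mxE summxE; congr (_ * _); apply: eq_bigr => l _.
  by rewrite /z !mxE mulrC.
have zK k l w : `|z k l w| <= K by have [_] := hK _ (half_step_in k.+1 w); apply.
have zJ k l : Fmeas (J k.+1) (z k l).
  by apply: Fmeas_coord => //; exact: half_step_joint.
have iz k l : rint (z k l) by exact: (bounded_rint (J_sigma k.+1) (zJ k l) (zK k l)).
have ip k l : rint (fun w => psi1 l (W k.+2 w) - 1).
  by apply: rintB; [exact: psi1_rint|exact: rint_cst].
have izp k l : rint (fun w => z k l w * (psi1 l (W k.+2 w) - 1)).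
  exact: (bounded_rintM (J_sigma k.+1) (zJ k l) (zK k l) (ip k l)).
have iX k : rint (X k).
  have -> : X k = (fun w => N%:R^-1 * \sum_l z k l w * (psi1 l (W k.+2 w) - 1)).
    exact: funext (XE k).
  by apply: rintZ; apply: rint_sum => l; exact: izp.
have mX k : Fmeas (F k.+2) (X k).
  have -> : X k = (fun w => block_mean (theta k.+2 w) j ord0 -
      block_mean (half_step k.+1 w) j ord0).
    by apply/funext => w; rewrite /X [LHS]mxE; congr (_ + _); rewrite [LHS]mxE.
  apply: FmeasB => //; apply: Fmeas_block_mean => //; first exact: theta_meas.
  exact: half_step_meas.
pose B k w := 2 * D k w + 2 * (gam k ^+ 2 * Y2 k w).
have iB k : rint (fun w => N.+1%:R ^+ 2 * B k w).
  by apply: rintZ; apply: rintD; apply: rintZ => //; exact: rintZ.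
(* Entries being at most 1, a column sum differs from 1 by at most [N.+1]. The factors 2 in [B] come
   from [disagr_half_le] with weight 1. *)
have XB k : {ae P, forall w, X k w ^+ 2 <= N.+1%:R ^+ 2 * B k w}.
  apply: filterS3 (W_row (ltn0Sn k.+1)) (W_le1 (ltn0Sn k.+1))
    (disagr_half_le (ltn0Sn k) ltr01) => w w1 wle hD.
  have {}hD : enorm (disagr (half_step k.+1 w)) ^+ 2 <= B k w.
    by apply: le_trans hD _; rewrite invr1 (_ : 1 + 1 = 2)// -exprMn.
  have : `|X k w| <= N.+1%:R * enorm (disagr (half_step k.+1 w)).
    rewrite (le_trans (ler_coord_enorm _ _))// theta_step -/(half_step k.+1 w).
    rewrite block_mean_tens// enormZ ger0_norm ?invr_ge0// ler_pdivrMl ?ltr0n//.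
    apply: (le_trans (ler_enorm_bigsum _ _)).
    apply: (@le_trans _ _ (\sum_(l < N) N.+1%:R * enorm (disagr (half_step k.+1 w)))).
      apply: ler_sum => l _; rewrite enormZ ler_pM ?enorm_ge0//; last exact: enorm_block.
      rewrite (le_trans (ler_normB _ _))// normr1 -natr1 lerD2r.
      rewrite (le_trans (ler_norm_sum _ _ _))//.
      rewrite (le_trans (ler_sum _ (fun i _ => wle i l)))//.
      by rewrite sumr_const card_ord.
    by rewrite sumr_const card_ord -[_ *+ N]mulr_natl.
  move=> hX; rewrite -(real_normK (num_real (X k w))).
  apply: (@le_trans _ _ ((N.+1%:R * enorm (disagr (half_step k.+1 w))) ^+ 2)).
    by rewrite ler_sqr ?nnegrE ?mulr_ge0 ?enorm_ge0.
  by rewrite exprMn ler_wpM2l ?sqr_ge0.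
have iX2 k : rint (fun w => X k w ^+ 2).
  apply: (rint_le_ae _ (iB k)).
    by apply: (measurable_funX 2); exact: rint_measurable (iX k).
  by apply: filterS (XB k) => w; rewrite ger0_norm ?sqr_ge0.
apply: (martingale (X := X) (a := N.+1%:R ^+ 2 * (2 * M)) (b := N.+1%:R ^+ 2 * 2)) => //.
- by apply: mulr_ge0; [exact: sqr_ge0|exact: mulr_ge0].
- move=> k A FA; have mA := (sF k.+1).2 _ FA.
  rewrite integral_set_Ex//.
  have JA : Fmeas (J k.+1) (\1_A : Omega -> R).
    by apply: Fmeas_indic => //; exact: joint_history_sub.
  have AzK l w : `|\1_A w * z k l w| <= K.
    rewrite normrM (le_trans _ (zK k l w))// ler_piMl// indicE.
    by case: (_ \in _); rewrite ?normr1 ?normr0.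
  have AzJ l : Fmeas (J k.+1) (fun w => \1_A w * z k l w) by exact: FmeasM.
  have -> : (fun w => \1_A w * X k w) = (fun w => N%:R^-1 *
      \sum_l (\1_A w * z k l w * psi1 l (W k.+2 w) - \1_A w * z k l w)).
    apply/funext => w; rewrite XE mulrCA; congr (_ * _); rewrite mulr_sumr.
    by apply: eq_bigr => l _; rewrite mulrA mulrBr mulr1.
  have iAz l : rint (fun w => \1_A w * z k l w) by exact: (bounded_rint (J_sigma k.+1)).
  have iAzp l : rint (fun w => \1_A w * z k l w * psi1 l (W k.+2 w)).
    by apply: (bounded_rintM (J_sigma k.+1) (AzJ l) (AzK l)); exact: psi1_rint.
  rewrite ExZ; last by apply: rint_sum => l; exact: rintB.
  rewrite Ex_sum; last by move=> l; exact: rintB.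
  rewrite big1 ?mulr0// => l _; rewrite ExB//.
  have mWn : measurable_fun setT (W k.+2) by [].
  have mYn : measurable_fun setT (Y k.+2) by [].
  rewrite (indep_Ex (sF k.+1) mWn mYn (W_indep (ltn0Sn k)) (WY_cond_indep (ltn0Sn k))
    (psi1_measurable l) (psi1_rint l (ltn0Sn k.+1)) (AzJ l) (iAz l) (iAzp l)).
  by rewrite psi1_mean// mulr1 subrr.
- move=> k; apply: (le_trans (Ex_le_ae (iX2 k) (iB k) (XB k))).
  rewrite ExZ; last by apply: rintD; apply: rintZ => //; exact: rintZ.
  have -> : N.+1%:R ^+ 2 * (2 * M) * gam k ^+ 2 + N.+1%:R ^+ 2 * 2 * Ex (D k) =
    N.+1%:R ^+ 2 * (2 * Ex (D k) + 2 * (gam k ^+ 2 * M)) by ring.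
  rewrite ler_wpM2l ?sqr_ge0// ExD; [|exact: rintZ|by apply: rintZ; exact: rintZ].
  rewrite !ExZ//; last exact: rintZ.
  by rewrite lerD2l ler_wpM2l// ler_wpM2l ?sqr_ge0.
Qed.

(** [enorm (Y k.+2 w)] is split into the error of a simple approximation, a martingale increment and
    a conditional mean. The first two have convergent weighted series, whose bounded partial sums
    give the random [kappa]; the last is at most [A = M + 1], as [|y| <= |y| ^ 2 + 1]. *)
Lemma ae_window : exists2 A, 0 <= A & {ae P, forall w, exists kappa, forall n j,
  \sum_(n <= k < n + j) gam k * enorm (Y k.+2 w) <=
  A * \sum_(n <= k < n + j) gam k + kappa}.
Proof.
have [M M0 hM] := moment_bound; exists (M + 1); first by rewrite addr_ge0.
pose phi (y : 'cV[R]_(N * d)) : R := enorm y.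
have mphi : measurable_fun setT phi.
  by apply: continuous_mx_measurable; exact: enorm_continuous.
have phi0 y : 0 <= phi y by exact: enorm_ge0.
have muphi x : GN x -> (\int[mu x]_y (phi y)%:E <= (M + 1)%:E)%E.
  move=> /hM hx.
  have le1 : (\int[mu x]_y (phi y)%:E <= \int[mu x]_y ((enorm y ^+ 2)%:E + 1%:E))%E.
    apply: ge0_le_integral => //.
    - by move=> y _; rewrite lee_fin.
    - exact/measurable_EFinP.
    - by apply: emeasurable_funD => //; apply/measurable_EFinP; exact: enorm_sqr_measurable.
    - move=> y _; rewrite -EFinD lee_fin /phi.
      by have := sqr_ge0 (enorm y - 1); have := enorm_ge0 y; lra.
  apply: (le_trans le1); rewrite ge0_integralD//; last 2 first.
  - by move=> y _; rewrite lee_fin sqr_ge0.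
  - by apply/measurable_EFinP; exact: enorm_sqr_measurable.
  rewrite EFinD; apply: leeD => //.
  rewrite integral_cst//= mul1e.
  by rewrite [X in (X <= _)%E](_ : _ = 1%E)//; exact: probability_setT.
have law k : {ae P, forall w, (\int[mu (theta k.+1 w)]_y (phi y)%:E <= (M + 1)%:E)%E}.
  by apply: filterS (theta_in_at (ltn0Sn k)) => w; exact: muphi.
have sF k := history_sub_sigma k.
have mYn n : measurable_fun setT (Y n) by [].
(* The accuracy [2 ^- k] is summable, so the approximation errors form a convergent series for any
   bounded [gam]. *)
have pow0 k : 0 < (2 : R) ^- k by rewrite invr_gt0 exprn_gt0.
have hs k := law_simple_approx (sF k.+1) (mYn k.+2) (Y_law (ltn0Sn k)) mphi phi0
  (law k) (pow0 k).
have /choice[s {}hs] : forall k, exists s : {nnsfun 'cV[R]_(N * d) >-> R},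
    (forall y, s y <= phi y) /\
    Ex (fun w => phi (Y k.+2 w) - s (Y k.+2 w)) <= 2 ^- k.
  by move=> k; have [t t1 t2] := hs k; exists t.
have /choice[H hH] : forall k, exists H : Omega -> R, [/\ Fmeas (F k.+1) H, rint H,
     forall A, F k.+1 A -> (\int[P]_(w in A) (s k (Y k.+2 w) - H w)%:E = 0)%E &
     {ae P, forall w, (H w)%:E = (\int[mu (theta k.+1 w)]_y (s k y)%:E)%E}].
  by move=> k; exact: (cond_simple (sF k.+1) (mYn k.+2) (Y_law (ltn0Sn k)) (s k)).
have H_le k : {ae P, forall w, 0 <= H k w <= M + 1}.
  have [_ _ _ hk] := hH k; have [sphi _] := hs k.
  apply: filterS2 hk (law_simple_le mphi (law k) sphi) => w h1 h2.
  rewrite -!lee_fin h1 h2 andbT; apply: integral_ge0 => y _; rewrite lee_fin//.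
have iphi k : rint (fun w => phi (Y k.+2 w)).
  exact: (rint_law (sF k.+1) (mYn k.+2) (Y_law (ltn0Sn k)) mphi phi0 (law k)).
have is_ k : rint (fun w => s k (Y k.+2 w)).
  by apply: rint_simple; exact: mYn.
have [Kb _ gam_bound] : exists2 Kb, 0 <= Kb & forall k, gam k <= Kb.
  have [K K0 hK] := disagr_summable; exists (K + 1); first by rewrite addr_ge0.
  move=> k; have [_] := hK k.+1; rewrite big_nat_recr//=.
  have : 0 <= \sum_(0 <= i < k) gam i ^+ 2 by apply: sumr_ge0 => i _; exact: sqr_ge0.
  by have := sqr_ge0 (gam k - 1); lra.
have tail : {ae P, forall w, cvgn (series (fun k =>
    gam k * (phi (Y k.+2 w) - s k (Y k.+2 w))))}.
  apply: (@ae_cvg_series _ _ _ _ (fun k w =>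
      gam k * (phi (Y k.+2 w) - s k (Y k.+2 w))) (Kb * 2)).
  - by move=> k; apply: rintZ; exact: rintB.
  - move=> k w; have [h _] := hs k.
    by rewrite mulr_ge0 ?(ltW (gam_gt0 k))// subr_ge0.
  - move=> n; apply: (@le_trans _ _ (\sum_(0 <= k < n) Kb * 2 ^- k)).
      apply: ler_sum => k _; rewrite ExZ; last exact: rintB.
      have [h1 h2] := hs k; rewrite ler_pM ?(ltW (gam_gt0 k))//.
      apply: Ex_ge0_ae; first exact: rintB.
      by apply: aeW => w; rewrite subr_ge0.
    rewrite -mulr_sumr ler_wpM2l//.
      by rewrite (le_trans (ltW (gam_gt0 0)) (gam_bound 0%N)).
    suff -> : \sum_(0 <= k < n) (2 : R) ^- k = 2 - 2 * 2 ^- n.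
      by rewrite gerBl mulr_ge0 ?(ltW (pow0 n)).
    elim: n => [|n IH]; first by rewrite big_geq// expr0 invr1; ring.
    by rewrite big_nat_recr//= IH exprS invfM; field; rewrite expf_neq0.
have mart : {ae P, forall w, cvgn (series (fun k => gam k * (s k (Y k.+2 w) - H k w)))}.
  have [M' M'0 hM'] := Y2_le.
  pose X k w := gam k * (s k (Y k.+2 w) - H k w).
  pose B k w := gam k ^+ 2 * (2 * Y2 k w + 2 * (M + 1) ^+ 2).
  have iB k : rint (B k).
    by apply: rintZ; apply: rintD; [exact: rintZ|exact: rint_cst].
  have mX k : Fmeas (F k.+2) (X k).
    have [mH _ _ _] := hH k.
    apply: FmeasM => //; first exact: Fmeas_cst.
    apply: FmeasB => //; last by move=> C mC; apply: history_le; exact: mH.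
    by apply: (Fmeas_comp (g := s k)) => //; exact: Y_meas.
  have XB k : {ae P, forall w, X k w ^+ 2 <= B k w}.
    apply: filterS (H_le k) => w /andP[h0 h1]; have [sphi _] := hs k.
    rewrite exprMn ler_wpM2l ?sqr_ge0//; apply: (le_trans (sqrB_le _ _)).
    rewrite lerD// ler_wpM2l//.
      by rewrite ler_sqr ?nnegrE// ?enorm_ge0//; exact: sphi.
    by rewrite ler_sqr ?nnegrE// addr_ge0.
  have iX2 k : rint (fun w => X k w ^+ 2).
    apply: (rint_le_ae _ (iB k)).
      by apply: (measurable_funX 2); exact: (Fmeas_measurable (sF k.+2) (mX k)).
    by apply: filterS (XB k) => w; rewrite ger0_norm ?sqr_ge0.
  apply: (martingale (X := X) (a := 2 * M' + 2 * (M + 1) ^+ 2) (b := 0)) => //.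
  - by rewrite addr_ge0// mulr_ge0// sqr_ge0.
  - move=> k A FA; have mA := (sF k.+1).2 _ FA; have [_ iH hA _] := hH k.
    under eq_integral do rewrite EFinM.
    rewrite integralZl//; last exact: (integrableS measurableT mA _ (rintB (is_ k) iH)).
    by rewrite hA// mule0.
  - move=> k; rewrite mul0r addr0.
    apply: (le_trans (Ex_le_ae (iX2 k) (iB k) (XB k))).
    rewrite ExZ; last by apply: rintD; [exact: rintZ|exact: rint_cst].
    rewrite mulrC ler_wpM2r ?sqr_ge0// ExD; [|exact: rintZ|exact: rint_cst].
    by rewrite Ex_cst ExZ// lerD2r ler_wpM2l.
have HM : {ae P, forall w, forall k, 0 <= H k w <= M + 1} by exact: ae_foralln.
apply: filterS3 tail mart HM => w /cvg_seq_bounded/(@pinfty_ex_gt0 _)[B1 B10 hB1]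
  /cvg_seq_bounded/(@pinfty_ex_gt0 _)[B2 B20 hB2] hH0.
(* A window sum is a difference of two partial sums, hence the factors 2. *)
exists (2 * B1 + 2 * B2) => n j.
have split3 : \sum_(n <= k < n + j) gam k * enorm (Y k.+2 w) =
    \sum_(n <= k < n + j) gam k * (phi (Y k.+2 w) - s k (Y k.+2 w)) +
    \sum_(n <= k < n + j) gam k * (s k (Y k.+2 w) - H k w) +
    \sum_(n <= k < n + j) gam k * H k w.
  rewrite -!big_split/=; apply: eq_bigr => k _; rewrite -!mulrDr.
  by rewrite addrA !subrK.
have win (a : nat -> R) B : (forall m, `|series a m| <= B) ->
    \sum_(n <= k < n + j) a k <= 2 * B.
  move=> ha; have -> : \sum_(n <= k < n + j) a k = series a (n + j)%N - series a n.
    by rewrite sub_series_geq// leq_addr.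
  have := ha (n + j)%N; have := ha n; rewrite !ler_norml => /andP[? ?] /andP[? ?]; lra.
rewrite split3 addrC lerD//.
  rewrite mulr_sumr; apply: ler_sum => k _; rewrite mulrC ler_wpM2r ?(ltW (gam_gt0 k))//.
  by have /andP[] := hH0 k.
by apply: lerD; apply: win => m; [exact: hB1|exact: hB2].
Qed.

End almost_sure_behaviour.

End consensus_algorithm.

(** * Sample paths *)

Section convergence_to_sets.
Context {R : realType} {n : nat}.
Implicit Types (u : nat -> 'cV[R]_n) (A : set 'cV[R]_n).

(** The shift [m] discards the initial terms, where the path need not lie in the constraint set. *)
Lemma cvg_to_setI u A m : (forall e, 0 < e -> exists n0, forall k, (n0 <= k)%N ->
    exists2 a, A a & enorm (u (k + m)%N - a) < e) -> cvg_to_set u A.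
Proof.
move=> H.
have d0 k : (0 <= edistv (u k) A)%E.
  by apply: le_ereal_inf_tmp => _ [a _ <-]; rewrite lee_fin enorm_ge0.
have de e : 0 < e -> exists n0, forall k, (n0 <= k)%N -> (edistv (u k) A < e%:E)%E.
  move=> e0; have [n0 h0] := H _ e0; exists (n0 + m)%N => k n0k.
  have mk : (m <= k)%N by rewrite (leq_trans _ n0k)// leq_addl.
  have [|a Aa ha] := h0 (k - m)%N; first by rewrite leq_subRL// addnC.
  rewrite subnK// in ha.
  apply: (@le_lt_trans _ _ (enorm (u k - a))%:E); last by rewrite lte_fin.
  by apply: ereal_inf_lbound; exists a.
have fin k e : (edistv (u k) A < e%:E)%E -> edistv (u k) A \is a fin_num.
  by move=> h; rewrite ge0_fin_numE// (lt_trans h)// ltry.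
apply/fine_cvgP; split.
  by have [n0 h0] := de _ ltr01; exists n0 => // k /h0; exact: fin.
apply/cvgrPdist_lt => e e0; have [n0 h0] := de _ e0; exists n0 => // k /= n0k.
have hk := h0 _ n0k; rewrite sub0r normrN ger0_norm ?fine_ge0//.
by rewrite -lte_fin fineK//; exact: fin hk.
Qed.

End convergence_to_sets.

Section regularity.
Context {R : realType} {d : nat}.

Lemma convex_sublevel p (q : 'I_p -> 'cV[R]_d -> R) :
  (forall j, convex_function [set: 'cV[R]_d] (q j)) ->
  segment_closed [set x | forall j, q j x <= 0].
Proof.
move=> hq x y t Gx Gy /andP[t0 t1] j.
have := hq j (Itv01 t0 t1) x y (in_setT x) (in_setT y).
move=> /le_trans; apply; rewrite convRE/=.
have := Gx j; have := Gy j => hy hx.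
rewrite -[leRHS]addr0 lerD// mulr_ge0_le0//.
by rewrite subr_ge0.
Qed.

Lemma C1_average N (f : 'I_N -> 'cV[R]_d -> R) (F : 'cV[R]_d -> R) :
  (forall i, C1_on setT (f i)) -> (forall x, F x = N%:R^-1 * \sum_i f i x) ->
  C1_on setT F /\ forall x, grad F x = N%:R^-1 *: \sum_i grad (f i) x.
Proof.
move=> f1 FE.
have FF : F = N%:R^-1 \*: (\sum_(i < N) f i).
  by apply/funext => x; rewrite FE /= fct_sumE.
have df i x : differentiable (f i) x by have [] := f1 i x I.
have dS x : differentiable (\sum_(i < N) f i) x by exact: differentiable_sum.
have gE x : grad F x = N%:R^-1 *: \sum_i grad (f i) x.
  apply/colP => k; rewrite mxE FF deriveZ; last exact: diff_derivable.
  rewrite derive_sum; last by move=> i; exact: diff_derivable.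
  by rewrite [RHS]mxE summxE; congr (_ * _); apply: eq_bigr => i _; rewrite mxE.
split => // x _; split.
  by rewrite FF; exact: differentiableZ.
rewrite (_ : grad F = fun x => N%:R^-1 *: \sum_i grad (f i) x); last exact/funext.
have gc i : {for x, continuous (grad (f i))} by have [] := f1 i x I.
apply: continuousZl_tmp.
elim: (index_enum _) => [|i s IH].
  rewrite (_ : (fun z => _) = fun=> 0); first exact: cst_continuous.
  by apply/funext => z; rewrite big_nil.
rewrite (_ : (fun z => _) = (fun z => grad (f i) z + \sum_(j <- s) grad (f j) z)).
  by apply: continuousD; [exact: gc|exact: IH].
by apply/funext => z; rewrite big_cons.
Qed.

End regularity.

Section series_facts.
Context {R : realType}.

Lemma cvg_series_lin (c : R) (a b : nat -> R) : cvgn (series a) ->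
  cvgn (series b) -> cvgn (series (fun k => c * a k + b k)).
Proof. by move=> ca cb; apply: is_cvg_seriesD => //; exact: is_cvg_seriesZ. Qed.

Lemma cvg_series_sum I (s : seq I) (a : I -> nat -> R) :
  (forall i, cvgn (series (a i))) -> cvgn (series (fun k => \sum_(i <- s) a i k)).
Proof.
move=> ca; elim: s => [|i s IH].
  have -> : series (fun k => \sum_(i <- [::]) a i k) = cst 0.
    by apply/funext => n; rewrite /series/= big1// => k _; rewrite big_nil.
  exact: is_cvg_cst.
rewrite (_ : (fun k => _) = (fun k => 1 * a i k + \sum_(j <- s) a j k)).
  exact: cvg_series_lin.
by apply/funext => k; rewrite big_cons mul1r.
Qed.

(** The tails [r k] of the series put the noise in the telescoping form required by the projected
    scheme. *)
Lemma series_remainder n (e : nat -> 'cV[R]_n) :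
  (forall j, cvgn (series (fun k => e k j ord0))) ->
  exists r : nat -> 'cV[R]_n, (forall k, e k = r k - r k.+1) /\
    enorm (r k) @[k --> \oo] --> (0 : R).
Proof.
move=> ce; pose s j := series (fun k => e k j ord0).
exists (fun k => \col_j (limn (s j) - s j k)); split.
  move=> k; apply/colP => j; rewrite !mxE /s /series/= big_nat_recr//=.
  by move: (limn _) (\sum_(0 <= i < k) _) (e k j ord0) => a b c; ring.
have sj j : `|limn (s j) - s j k| @[k --> \oo] --> (0 : R).
  rewrite -[X in _ --> X](@normr0 _ R); apply: cvg_norm.
  by rewrite -[X in _ --> X](subrr (limn (s j))); apply: cvgB; [exact: cvg_cst|exact: ce].
have sum0 : \sum_j `|limn (s j) - s j k| @[k --> \oo] --> (0 : R).
  rewrite -[X in _ --> X](@big1 _ 0 +%R _ (index_enum 'I_n) xpredT (fun=> 0))//.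
  elim: (index_enum _) => [|i t IH].
    rewrite big_nil (_ : (fun k => _) = fun=> 0); first exact: cvg_cst.
    by apply/funext => k; rewrite big_nil.
  rewrite big_cons (_ : (fun k => _) =
    fun k => `|limn (s i) - s i k| + \sum_(j <- t) `|limn (s j) - s j k|).
    by apply: cvgD; [exact: sj|exact: IH].
  by apply/funext => k; rewrite big_cons.
apply: (squeeze_cvgr _ (cvg_cst 0) sum0); apply: nearW => k.
rewrite enorm_ge0/= (le_trans (ler_enorm_sum _))//.
by apply: ler_sum => j _; rewrite mxE.
Qed.

End series_facts.

(** * Deterministic analysis of one sample path *)

Section sample_path.
Context {R : realType} {N d : nat} (N_gt0 : (0 < N)%N).
Context (f : 'I_N -> 'cV[R]_d -> R) (fbar : 'cV[R]_d -> R) (G : set 'cV[R]_d).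
Hypothesis f_C1 : forall i, C1_on setT (f i).
Hypothesis fbar_def : forall x, fbar x = N%:R^-1 * \sum_i f i x.
Hypotheses (G_neq0 : G !=set0) (G_compact : compact G) (G_convex : segment_closed G).
Hypothesis KKT_values : (fbar @` KKT fbar G)° = set0.
Context (th y z : nat -> 'cV[R]_(N * d)) (gam : nat -> R) (A kappa : R).
Hypothesis thG : forall k, set_power G (th k).
Hypothesis zE : forall k, z k = eproj (set_power G) (th k + gam k *: y k).
Hypothesis gam_gt0 : forall k, 0 < gam k.
Hypothesis gam_cvg0 : gam @ \oo --> (0 : R).
Hypothesis gam_dvg : series gam @ \oo --> +oo.
Hypothesis disagr_series : cvgn (series (fun k => enorm (disagr (th k)) ^+ 2)).
Hypothesis step_series : cvgn (series (fun k => (gam k * enorm (y k)) ^+ 2)).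
Hypothesis gradient_series : forall j : 'I_(N * d), cvgn (series (fun k =>
  gam k * (y k + stack (fun i => grad (f i) (block (th k) i))) j ord0)).
Hypothesis gossip_series : forall j : 'I_d, cvgn (series (fun k =>
  (block_mean (th k.+1) - block_mean (z k)) j ord0)).
Hypothesis A_ge0 : 0 <= A.
Hypothesis window : forall n j, \sum_(n <= k < n + j) gam k * enorm (y k) <=
  A * \sum_(n <= k < n + j) gam k + kappa.

Let x k := block_mean (th k).
Let g k : 'cV[R]_d := block_mean (- stack (fun i => grad (f i) (block (th k) i))).
(* Projecting onto [set_power G] displaces the blocks along normals to [G] at
   their own projections; these points are within [disagr] and one step of the
   mean, so [v k] is normal to [G] at [x k] up to [eps k]. *)
Let v k : 'cV[R]_d := (gam k)^-1 *: block_mean (th k + gam k *: y k - z k).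
(** Observation noise plus gossip noise, the two parts with convergent series. *)
Let e k : 'cV[R]_d :=
  gam k *: (block_mean (y k) - g k) + (x k.+1 - block_mean (z k)).
Let eps k : R := enorm (y k) * (enorm (disagr (th k)) + gam k * enorm (y k)).

Let G_prox : proximinal G. Proof. exact: compact_proximinal. Qed.
Let GN_prox : proximinal (@set_power R N d G). Proof. exact: set_power_proximinal. Qed.
Let GN_convex : segment_closed (@set_power R N d G). Proof. exact: set_power_convex. Qed.

Let xG k : G (x k). Proof. by apply: block_mean_in => //. Qed.

Let gam_neq0 k : gam k != 0. Proof. by rewrite gt_eqF. Qed.

Let disagr_cvg0 : enorm (disagr (th k)) @[k --> \oo] --> (0 : R).
Proof.
have := cvg_series_cvg_0 disagr_series.
move=> /cvgrPdist_lt h; apply/cvgrPdist_lt => c c0.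
have [n0 _ hn] := h _ (exprn_gt0 2 c0); exists n0 => // k /hn /=.
rewrite !sub0r !normrN ger0_norm ?sqr_ge0// ger0_norm ?enorm_ge0//.
by rewrite ltr_sqr ?nnegrE ?enorm_ge0 ?(ltW c0).
Qed.

Let x_step k : x k.+1 = x k + gam k *: (g k - v k) + e k.
Proof.
rewrite /e scalerBr scalerBr /v (scalerA (gam k) (gam k)^-1) mulfV// scale1r.
rewrite block_meanD block_meanN block_meanD block_meanZ.
by apply/colP => i; rewrite !mxE; ring.
Qed.

Let e_series j : cvgn (series (fun k => e k j ord0)).
Proof.
pose a i k := gam k * (y k + stack (fun i => grad (f i) (block (th k) i)))
  (mxtens_index (i, j)) ord0.
rewrite (_ : (fun k => _) = (fun k => N%:R^-1 * (\sum_i a i k) +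
  (x k.+1 - block_mean (z k)) j ord0)).
  apply: cvg_series_lin; last exact: gossip_series.
  by apply: cvg_series_sum => i; exact: gradient_series.
apply/funext => k; rewrite /e [LHS]mxE; congr (_ + _).
rewrite /g -block_meanN -block_meanD opprK -block_meanZ.
rewrite /block_mean mxE summxE; congr (_ * _); apply: eq_bigr => i _.
by rewrite mxE [LHS]mxE.
Qed.

Let z_near k : enorm (z k - th k) <= gam k * enorm (y k).
Proof. by rewrite zE; apply: enorm_proj_step => //; exact: ltW. Qed.

Let resid_le k : enorm (th k + gam k *: y k - z k) <= gam k * enorm (y k).
Proof.
have [_ h] := eprojP (th k + gam k *: y k) GN_prox.
rewrite zE (le_trans (h _ (thG k)))// addrC addKr enormZ ger0_norm//.
exact: ltW.
Qed.

Let v_le k : enorm (v k) <= enorm (y k).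
Proof.
rewrite /v enormZ ger0_norm ?invr_ge0 ?(ltW (gam_gt0 k))// ler_pdivrMl//.
exact: le_trans (enorm_block_mean N_gt0 _) (resid_le k).
Qed.

Let v_normal k u : G u -> - eps k <= dotv (v k) (x k - u).
Proof.
move=> Gu; set res := th k + gam k *: y k - z k.
have N0 : 0 < N%:R :> R by rewrite ltr0n.
have consB (a b : 'cV[R]_d) : @consensus R N d (a - b) = consensus a - consensus b.
  by apply: block_ext => i; rewrite blockD blockN !block_consensus.
(* Pairing a mean with a vector is, up to [N], pairing with its consensus copy; in the product space
   the residual [res] is exactly normal at [z k]. *)
have E : N%:R * (gam k * dotv (v k) (x k - u)) =
    dotv res (z k - consensus u) - dotv res (z k - consensus (x k)).
  have cE : consensus (x k - u) = z k - consensus u - (z k - consensus (x k)).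
    by rewrite consB opprB [RHS]addrC addrA subrK.
  rewrite -dotvNr -dotvDr -cE (dotv_consensus N_gt0).
  by rewrite /v dotvZl (mulrA (gam k)) mulfV// mul1r.
have h1 : 0 <= dotv res (z k - consensus u).
  have Gcu : set_power G (@consensus R N d u) by move=> i; rewrite block_consensus.
  have := dotv_eproj_le0 (th k + gam k *: y k) GN_convex GN_prox Gcu.
  by rewrite -zE -/res -opprB dotvNr oppr_le0.
have h2 : dotv res (z k - consensus (x k)) <= gam k * eps k.
  rewrite (le_trans (dotv_le_enorm _ _))// /eps mulrA ler_pM ?enorm_ge0 ?resid_le//.
  have -> : z k - consensus (x k) = disagr (th k) + (z k - th k).
    by rewrite /disagr -/(x k) [RHS]addrC addrA subrK.
  by rewrite (le_trans (ler_enormD _ _))// lerD2l.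
have eps0 : 0 <= eps k.
  by rewrite mulr_ge0 ?enorm_ge0// addr_ge0 ?mulr_ge0 ?enorm_ge0// ltW.
have : - (gam k * eps k) <= N%:R * (gam k * dotv (v k) (x k - u)) by lra.
rewrite (mulrCA N%:R) -mulrN ler_pM2l// => h3.
have [h4|h4] := leP 0 (dotv (v k) (x k - u)).
  by rewrite (le_trans _ h4)// oppr_le0.
apply: (le_trans h3); rewrite -[leRHS]mul1r ler_nM2r// ler1n//.
Qed.

Let eps_ge0 k : 0 <= eps k.
Proof. by rewrite mulr_ge0 ?enorm_ge0// addr_ge0 ?mulr_ge0 ?enorm_ge0// ltW. Qed.

(** With [a] the observation step and [b] the disagreement, the general term [a * (b + a)] is at
    most [2 * a ^+ 2 + b ^+ 2]. *)
Let eps_series : cvgn (series (fun k => gam k * eps k)).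
Proof.
apply: (@series_le_cvg _ _ (fun k => 2 * (gam k * enorm (y k)) ^+ 2 +
  enorm (disagr (th k)) ^+ 2)).
- by move=> k; rewrite mulr_ge0// ltW.
- by move=> k; rewrite addr_ge0 ?sqr_ge0// mulr_ge0 ?sqr_ge0.
- move=> k; rewrite /eps mulrA mulrDr.
  move: (gam k * enorm (y k)) (enorm (disagr (th k))) => a b.
  by have := sqr_ge0 (a - b); have := sqr_ge0 a; have := sqr_ge0 b; lra.
exact: cvg_series_lin.
Qed.

Let v_series : cvgn (series (fun k => (gam k * enorm (v k)) ^+ 2)).
Proof.
apply: (series_le_cvg _ _ _ step_series) => k; rewrite ?sqr_ge0//.
rewrite ler_sqr ?nnegrE ?mulr_ge0 ?enorm_ge0 ?(ltW (gam_gt0 k))//.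
by rewrite ler_pM2l.
Qed.

Let v_window n j : \sum_(n <= k < n + j) gam k * enorm (v k) <=
  A * \sum_(n <= k < n + j) gam k + kappa.
Proof.
by apply: le_trans (window n j); apply: ler_sum => k _; rewrite ler_pM2l.
Qed.

(** [g] uses each local gradient at the agent's own point; uniform continuity on [G] and vanishing
    disagreement move them all to the mean. *)
Let g_grad : enorm (g k + grad fbar (x k)) @[k --> \oo] --> (0 : R).
Proof.
have [_ gradE] := C1_average f_C1 fbar_def.
apply/cvgrPdist_lt => c c0; have c20 : 0 < c / 2 by rewrite divr_gt0.
have H i : exists n0, forall k, (n0 <= k)%N ->
    enorm (grad (f i) (x k) - grad (f i) (block (th k) i)) <= c / 2.
  have [r0 r00 hr] := compact_unif_cts G_compact (grad_continuous (f_C1 i)) c20.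
  have [n0 hn] := cvg0_lt disagr_cvg0 r00; exists n0 => k /hn hk.
  apply: hr => //; first exact: thG.
  rewrite enormB -block_disagr (le_trans (enorm_block _ _))//.
  by apply/ltW; apply: le_lt_trans hk; exact: ler_norm.
(* The sum of the thresholds serves as a bound on their maximum. *)
have [n0 hn] := choice H; exists (\sum_i n0 i)%N => // k /= hk.
rewrite sub0r normrN ger0_norm ?enorm_ge0//.
have -> : g k + grad fbar (x k) = N%:R^-1 *:
    \sum_i (grad (f i) (x k) - grad (f i) (block (th k) i)).
  rewrite gradE /g /block_mean -scalerDr sumrB addrC -sumrN; congr (_ *: (_ + _)).
  by apply: eq_bigr => i _; rewrite blockN block_stack.
rewrite enormZ ger0_norm ?invr_ge0// ltr_pdivrMl ?ltr0n//.
apply: (le_lt_trans (ler_enorm_bigsum _ _)).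
apply: (@le_lt_trans _ _ (\sum_(i < N) c / 2)).
  apply: ler_sum => i _; apply: hn; apply: leq_trans hk.
  by rewrite (bigD1 i)//= leq_addr.
rewrite sumr_const card_ord -[_ *+ N]mulr_natl ltr_pM2l ?ltr0n//.
by rewrite ltr_pdivrMr// ltr_pMr// ltr1n.
Qed.

Let F1 : C1_on setT fbar.
Proof. by have [] := C1_average f_C1 fbar_def. Qed.

Let mean_slow c : 0 < c -> exists n0, forall n, (n0 <= n)%N ->
  enorm (x n.+1 - x n) < c.
Proof.
have [r [er r0]] := series_remainder e_series.
apply: (@iterate_slow _ _ G fbar G_compact F1 x g v r gam) => // k.
by rewrite -er.
Qed.

Let mean_cluster u : G u -> cluster_point x u -> KKT fbar G u.
Proof.
have [r [er r0]] := series_remainder e_series.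
apply: (@cluster_KKT _ _ G fbar G_compact G_convex F1 x g v r gam eps A kappa) => // k.
by rewrite -er.
Qed.

Let cluster_in u : cluster_point x u -> G u.
Proof.
move=> xu; have Gcl : closed G.
  apply: compact_closed => //; exact: norm_hausdorff.
apply: Gcl => B /enorm_ball[c c0 hB]; have [n _ xn] := xu _ c0 0%N.
by exists (x n); split; [exact: xG|apply: hB; rewrite enormB].
Qed.

(** The cluster set is connected, consists of KKT points and contains [u], so it lies in the
    component of [u]. *)
Lemma mean_to_component : exists2 u, KKT fbar G u & forall c, 0 < c ->
  exists n0, forall n, (n0 <= n)%N ->
  exists2 l, connected_component (KKT fbar G) u l & enorm (block_mean (th n) - l) < c.
Proof.
have [u Gu xu] := @compact_seq_cluster _ _ G x G_compact xG.
exists u; first exact: mean_cluster.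
move=> c c0; have [n0 hn] := cvg_cluster_set G_compact xG c0.
exists n0 => n /hn[l xl nl]; exists l => //.
exists (cluster_point x) => //; split => //.
  by move=> l' xl'; apply: mean_cluster => //; exact: cluster_in.
exact: cluster_set_connected G_compact xG mean_slow.
Qed.

Lemma path_to_consensus c : 0 < c -> exists n0, forall n, (n0 <= n)%N ->
  exists2 a, [set consensus l | l in KKT fbar G] a & enorm (th n - a) < c.
Proof.
move=> c0; have c20 : 0 < c / 2 by rewrite divr_gt0.
have N1 : 0 < N%:R :> R by rewrite ltr0n.
have cN : 0 < c / 2 / N%:R by rewrite divr_gt0.
have [n1 h1] := cvg_cluster_set G_compact xG cN.
have [n2 h2] := cvg0_lt disagr_cvg0 c20.
exists (maxn n1 n2) => n; rewrite geq_max => /andP[/h1[l xl nl] /h2 hD].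
have Ll : KKT fbar G l by apply: mean_cluster => //; exact: cluster_in.
exists (consensus l); first by exists l.
(* One part vanishes with the disagreement, the other as the mean approaches [l]. *)
have -> : th n - consensus l = disagr (th n) + @consensus R N d (x n - l).
  by apply: block_ext => i; rewrite !(blockD, blockN, block_consensus) addrA subrK.
rewrite (le_lt_trans (ler_enormD _ _))// [ltRHS]splitr.
rewrite ltr_leD//; first exact: le_lt_trans (ler_norm _) hD.
have hc : enorm (@consensus R N d (x n - l)) <= N%:R * enorm (x n - l).
  rewrite -ler_sqr ?nnegrE ?mulr_ge0 ?enorm_ge0// enorm_sqr dotv_block.
  under eq_bigr do rewrite block_consensus -enorm_sqr.
  rewrite sumr_const card_ord -[_ *+ N]mulr_natl exprMn ler_wpM2r ?sqr_ge0//.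
  by rewrite expr2 ler_peMr// ler1n.
by rewrite (le_trans hc)// mulrC -ler_pdivlMr// ltW.
Qed.

End sample_path.

Section step_sizes.
Context {R : realType} (gamma : nat -> R) (gamma_gt0 : forall n, (0 < n)%N -> 0 < gamma n).

Lemma steps_cvg0 (alpha : R) : 0 <= alpha ->
  n%:R `^ alpha * gamma n @[n --> \oo] --> (0 : R) ->
  gamma k.+2 @[k --> \oo] --> (0 : R).
Proof.
move=> alpha0 /cvgrPdist_lt h; apply/cvgrPdist_lt => c c0.
have [n0 _ hn] := h _ c0; exists n0 => // k /= n0k.
have := hn k.+2; rewrite /= !sub0r !normrN => /(_ (leqW (leqW n0k))).
apply: le_lt_trans; rewrite normrM ler_peMl// ger0_norm ?powR_ge0//.
by rewrite -[leLHS](powRr0 k.+2%:R) ler_powR// ler1n.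
Qed.

Lemma steps_dvg : \sum_(1 <= k < n.+1) gamma k @[n --> \oo] --> +oo ->
  series (fun k => gamma k.+2) @ \oo --> +oo.
Proof.
move=> /cvgryPge h; apply/cvgryPge => c.
have [n0 _ hn] := h (c + gamma 1); exists n0 => // k /= n0k.
have := hn k.+1 (leqW n0k).
rewrite big_add1 big_nat_recl//= [leRHS]addrC lerD2r.
by [].
Qed.

End step_sizes.
Theorem theorem1 (R : realType) (N d p : nat)
  (N_gt0 : (0 < N)%N) (d_gt0 : (0 < d)%N) (p_gt0 : (0 < p)%N)
  (disp : measure_display) (Omega : measurableType disp)
  (P : probability Omega R)
  (f : 'I_N -> 'cV[R]_d -> R) (gamma : nat -> R)
  (theta0 : {RV P >-> 'cV[R]_(N * d)})
  (* Y 0, W 0 and gamma 0 are not used *)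
  (Y : nat -> {RV P >-> 'cV[R]_(N * d)}) (W : nat -> {RV P >-> 'M[R]_N})
  (mu : 'cV[R]_(N * d) -> probability 'cV[R]_(N * d) R)
  (q : 'I_p -> 'cV[R]_d -> R) (G : set 'cV[R]_d)
  (theta : nat -> Omega -> 'cV[R]_(N * d)) (rho : nat -> R) (alpha : R)
  (* the constraint set, the algorithm and rho_n *)
  (G_def : G = [set x | forall j, q j x <= 0])
  (theta_init : forall w, theta 0%N w = theta0 w)
  (theta_step : forall n w,
    theta n.+1 w =
    (W n.+1 w *t (1%:M : 'M[R]_d)) *m
      eproj (set_power G) (theta n w + gamma n.+1 *: Y n.+1 w))
  (rho_def : forall n,
    rho n = spectral_norm (expectation_mx P (fun w =>
      (W n w)^T *m
      (1%:M - N%:R^-1 *: ((const_mx 1 : 'cV[R]_N) *m (const_mx 1 : 'rV[R]_N)))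
      *m W n w)))
  (* network, observations and local functions *)
  (W_ge0 : forall n, (0 < n)%N ->
    {ae P, forall w, forall i j, 0 <= W n w i j})
  (W_row : forall n, (0 < n)%N ->
    {ae P, forall w, W n w *m (const_mx 1 : 'cV[R]_N) = const_mx 1})
  (W_col : forall n, (0 < n)%N ->
    (const_mx 1 : 'rV[R]_N) *m expectation_mx P (W n) = const_mx 1)
  (rho_lim : n%:R * (1 - rho n) @[n --> \oo] --> +oo)
  (WY_cond_indep : forall n, (0 < n)%N ->
    cond_indep P (history theta0 Y W n) (W n.+1) (Y n.+1))
  (W_indep : forall n, (0 < n)%N ->
    indep_of P (history theta0 Y W n) (W n.+1))
  (Y_law : forall n, (0 < n)%N ->
    forall A : set 'cV[R]_(N * d), measurable A ->
    cond_prob_eq P (history theta0 Y W n) (Y n.+1 @^-1` A)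
      (fun w => fine (mu (theta n w) A)))
  (f_C1 : forall i, C1_on setT (f i))
  (Y_mean : forall n, (0 < n)%N -> forall j : 'I_(N * d),
    cond_exp_eq P (history theta0 Y W n) (fun w => Y n.+1 w j ord0)
      (fun w => (- stack (fun i => grad (f i) (block (theta n w) i))) j ord0))
  (mu_moment : (ereal_sup
    [set \int[mu x]_y ((enorm y) ^+ 2)%:E | x in set_power G] < +oo)%E)
  (* step sizes *)
  (gamma_gt0 : forall n, (0 < n)%N -> 0 < gamma n)
  (gamma_sum : \sum_(1 <= k < n.+1) gamma k @[n --> \oo] --> +oo)
  (alpha_gt : 1 / 2 < alpha)
  (gamma_lim : n%:R `^ alpha * gamma n @[n --> \oo] --> (0 : R))
  (rho_gamma :
    (0 < limn_einf (fun n => ((1 - rho n) / (n%:R `^ alpha * gamma n))%:E))%E)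
  (* constraints *)
  (G_neq0 : G !=set0) (G_compact : compact G)
  (q_convex : forall j, convex_function [set: 'cV[R]_d] (q j))
  (q_C1 : forall j, exists U : set 'cV[R]_d,
    [/\ open U, boundary G `<=` U & C1_on U (q j)])
  (q_free : forall x, boundary G x ->
    free [seq grad (q j) x | j : 'I_p in [pred j | q j x == 0]])
  (* f and its KKT points *)
  (fbar : 'cV[R]_d -> R)
  (fbar_def : forall x, fbar x = N%:R^-1 * \sum_i f i x)
  (L : set 'cV[R]_d) (L_def : L = KKT fbar G)
  (L_values : (fbar @` L)° = set0) :
  {ae P, forall w, cvg_to_set (fun n => theta n w)
                     [set consensus x | x in L]} /\
  {ae P, forall w, exists2 x, L x &
    cvg_to_set (fun n => block_mean (theta n w)) (connected_component L x)}.
Proof.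
subst L; have G_convex : segment_closed G by rewrite G_def; exact: convex_sublevel.
have {}rho_def : forall n, rho n = spectral_norm (expectation_mx P (fun w =>
  (W n w)^T *m (centering : 'M[R]_N) *m W n w)) by [].
have gam0 := steps_cvg0 (ltW (lt_trans _ alpha_gt)) gamma_lim.
have {}gam0 : gamma k.+2 @[k --> \oo] --> (0 : R) by apply: gam0.
have gam_dvg := steps_dvg gamma_sum.
have th_in : {ae P, forall w, forall n, set_power G (theta n.+1 w)}.
  by eapply theta_in; eassumption.
have disagr_cvg : {ae P, forall w,
    cvgn (series (fun k => enorm (disagr (theta k.+1 w)) ^+ 2))}.
  by eapply ae_disagr_series; eassumption.
have step_cvg : {ae P, forall w,
    cvgn (series (fun k => (gamma k.+2 * enorm (Y k.+2 w)) ^+ 2))}.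
  by eapply ae_step_series; eassumption.
have gradient_cvg : {ae P, forall w, forall j : 'I_(N * d), cvgn (series (fun k =>
    gamma k.+2 * (Y k.+2 w +
      stack (fun i => grad (f i) (block (theta k.+1 w) i))) j ord0))}.
  by eapply ae_gradient_noise; eassumption.
pose z n := @half_step R N d disp Omega P gamma Y G theta n.
have gossip_cvg : {ae P, forall w, forall j : 'I_d, cvgn (series (fun k =>
    (block_mean (theta k.+2 w) - block_mean (z k.+1 w)) j ord0))}.
  by eapply ae_gossip_noise; eassumption.
have [A A0 window] : exists2 A, 0 <= A & {ae P, forall w, exists kappa, forall n j,
    \sum_(n <= k < n + j) gamma k.+2 * enorm (Y k.+2 w) <=
    A * \sum_(n <= k < n + j) gamma k.+2 + kappa}.
  by eapply ae_window; eassumption.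
(* On the intersection of the almost sure events the pathwise results apply with
   [th k = theta k.+1], [y k = Y k.+2] and [gam k = gamma k.+2]. *)
have key : {ae P, forall w, (exists2 u, KKT fbar G u & forall c, 0 < c ->
    exists n0, forall n, (n0 <= n)%N -> exists2 l,
      connected_component (KKT fbar G) u l & enorm (block_mean (theta n.+1 w) - l) < c) /\
  (forall c, 0 < c -> exists n0, forall n, (n0 <= n)%N ->
    exists2 a, [set consensus l | l in KKT fbar G] a & enorm (theta n.+1 w - a) < c)}.
  apply: filterS2 (filterI th_in disagr_cvg) (filterI (filterI step_cvg gradient_cvg)
    (filterI gossip_cvg window)) => w [thG dw] [[sw gw] [gow [kappa win]]].
  have zE k : z k.+1 w = eproj (set_power G) (theta k.+1 w + gamma k.+2 *: Y k.+2 w) by [].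
  have gam_gt0 k : 0 < gamma k.+2 by exact: gamma_gt0.
  split.
    exact: (mean_to_component N_gt0 f_C1 fbar_def G_neq0 G_compact G_convex L_values
      thG zE gam_gt0 gam0 gam_dvg dw sw gw gow A0 win).
  exact: (path_to_consensus N_gt0 f_C1 fbar_def G_neq0 G_compact G_convex L_values
      thG zE gam_gt0 gam0 gam_dvg dw sw gw gow A0 win).
split; apply: filterS key => w [[u Lu hu] hc].
  by apply: (cvg_to_setI (m := 1)) => c /hc[n0 h]; exists n0 => k; rewrite addn1; exact: h.
exists u => //; apply: (cvg_to_setI (m := 1)) => c /hu[n0 h].
by exists n0 => k; rewrite addn1; exact: h.
Qed.
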